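(* Let $C_k\subseteq\mathbb{R}^{m_k}$ and $D_k\subseteq\mathbb{R}^{n_k}$, $k\in\mathbb{N}$, be families of nonzero closed convex cones such that $$\lim_{k\to\infty}\frac{\delta(C_k)}{m_k}=\alpha^2,\qquad \lim_{k\to\infty}\frac{\delta(D_k)}{n_k}=\beta^2,\qquad \lim_{k\to\infty}\frac{m_k}{n_k}=\gamma^2$$ with $0<\alpha,\beta,\gamma\le1$ and $\beta>\alpha\gamma$, and such that $n_k\to\infty$ for $k\to\infty$. For each $k$ let $G\in\mathbb{R}^{n_k\times m_k}$ be a Gaussian matrix. Then there exist exceptional sets $E_k\subseteq\mathbb{R}^{n_k\times m_k}$ with $\operatorname{Prob}\{G\in E_k\}\le e^{-\Omega(n_k)}$ and real numbers $u_k=u_k(C_k,D_k)$ such that $$\mathbb{E}\big[\mathcal{R}_{C_k,D_k}(G)\mid G\notin E_k\big]<u_k,\qquad u_k\to\frac{1+\gamma}{\beta-\alpha\gamma}\quad(k\to\infty).$$ In particular, if $n_k=\Omega(k)$, then the weak average-case complexity of $\mathcal{R}_{C_k,D_k}$ is constant, i.e. the family $\{\mathcal{R}_{C_k,D_k}(G)\}_k$ has weak expectation $O(1)$.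
   Context: A Gaussian matrix has i.i.d. standard normal entries. For a closed convex cone $C\subseteq\mathbb{R}^m$, $\Pi_C(y)$ denotes the Euclidean projection of $y$ onto $C$ (the point of $C$ nearest to $y$), and the statistical dimension of $C$ is $\delta(C)=\mathbb{E}_{g\sim N(0,I_m)}\big[\|\Pi_C(g)\|^2\big]$. For nonzero closed convex cones $C\subseteq\mathbb{R}^m$, $D\subseteq\mathbb{R}^n$ and $A\in\mathbb{R}^{n\times m}$, the smallest restricted singular value is $$\sigma_{C\to D}(A)=\min_{x\in C\cap S^{m-1}}\|\Pi_D(Ax)\|,$$ and correspondingly $\sigma_{D\to C}(-A^T)=\min_{y\in D\cap S^{n-1}}\|\Pi_C(-A^Ty)\|$. The (generalised) Renegar condition number is $$\mathcal{R}_{C,D}(A)=\min\left\{\frac{\|A\|}{\sigma_{C\to D}(A)},\ \frac{\|A\|}{\sigma_{D\to C}(-A^T)}\right\},$$ where $\|A\|$ is the operator (spectral) norm, and a quotient with zero denominator is $\infty$. Weak expectation: for probability spaces $(M_k,\mu_k)$ and measurable $T_k$ on $M_k$, $k\in\mathbb{N}$, the family $\{T_k\}$ has a weak expectation of $O(f(k))$ if there are sets $E_k\subseteq M_k$ with $\mu_k(E_k)=e^{-\Omega(k)}$ such that the conditional expectation $\mathbb{E}[T_k(x)\mid x\notin E_k]$ is bounded by $f(k)$, constants being disregarded as usual in $O$-notation. *)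

(* Defs.v *)
From HB Require Import structures.
From mathcomp Require Import all_boot all_order all_algebra.
From mathcomp Require Import all_classical all_reals all_analysis.
From mathcomp Require Import measurable_realfun.

Set Implicit Arguments.
Unset Strict Implicit.
Unset Printing Implicit Defensive.

Import Order.TTheory GRing.Theory Num.Theory.
Import numFieldNormedType.Exports.

Local Open Scope classical_set_scope.
Local Open Scope ring_scope.

(* Borel sigma-algebra on matrices, hence on column vectors *)
HB.instance Definition _ (R : realType) (n m : nat) :=
  @isMeasurable.Build (sigma_display (@open 'M[R]_(n, m))) 'M[R]_(n, m)
    <<s @open 'M[R]_(n, m) >>
    (@sigma_algebra0 _ setT (@open 'M[R]_(n, m)))
    (@sigma_algebraC _ (@open 'M[R]_(n, m)))
    (@sigma_algebra_bigcup _ setT (@open 'M[R]_(n, m))).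

Section gaussian_tuple.
Context {R : realType}.
Notation RT := (measurableTypeR R).

Definition tuple_cons n (p : RT * n.-tuple RT) : n.+1.-tuple RT :=
  [the n.+1.-tuple RT of p.1 :: p.2].

Lemma measurable_tuple_cons n :
  measurable_fun [set: RT * n.-tuple RT] (@tuple_cons n).
Proof. exact: measurable_cons. Qed.

HB.instance Definition _ n :=
  isMeasurableFun.Build _ _ _ _ (@tuple_cons n) (@measurable_tuple_cons n).

(* N(0, I_n) as an iterated product of the standard normal law *)
Fixpoint gaussian_tuple n : probability (n.-tuple RT) R :=
  match n with
  | 0 => dirac [tuple]
  | n'.+1 =>
    distribution (normal_prob 0 1 \x gaussian_tuple n')%E (@tuple_cons n')
  end.

Lemma gaussian_tuple_box n (B : 'I_n -> set RT) :
  (forall i, measurable (B i)) ->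
  gaussian_tuple n [set t | forall i, B i (tnth t i)] =
  (\prod_i normal_prob 0 1 (B i))%E.
Proof.
elim: n B => [|n IHn] B mB.
  rewrite big_ord0 /= diracE mem_set//; by case.
rewrite big_ord_recl /= /distribution /pushforward /=.
have -> : @tuple_cons n @^-1` [set t | forall i, B i (tnth t i)] =
   B ord0 `*` [set t | forall i, B (lift ord0 i) (tnth t i)].
  apply/seteqP; split=> [[x t]|[x t] []] /=.
    move=> H; split; first exact: (H ord0).
    by move=> i; have := H (lift ord0 i); rewrite tnthS.
  by move=> H0 H i; case: (unliftP ord0 i) => [j ->|->//]; rewrite tnthS.
rewrite product_measure1E//; first by congr (_ * _)%E; exact: (IHn (fun i => B (lift ord0 i))).
have -> : [set t : n.-tuple RT | forall i, B (lift ord0 i) (tnth t i)] =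
   \bigcap_(i in [set: 'I_n]) ((@tnth _ RT ^~ i) @^-1` B (lift ord0 i)).
  by apply/seteqP; split=> t /= H i *; exact: H.
apply: fin_bigcap_measurable => // i _.
rewrite -[X in measurable X]setTI; exact: measurable_tnth.
Qed.

Variables n m : nat.

Definition tuple_mx (t : (n * m).-tuple RT) : 'M[R]_(n, m) :=
  vec_mx (\row_k tnth t k).

Lemma measurable_tuple_mx : measurable_fun [set: (n * m).-tuple RT] tuple_mx.
Proof.
apply: (measurability (@open 'M[R]_(n, m))) => //.
move=> _ [U oU <-]; rewrite setTI.
pose bx (p : 'M[rat]_(n, m) * nat) :=
  ball (map_mx ratr p.1 : 'M[R]_(n, m)) p.2.+1%:R^-1.
pose F p :=
  if pselect (bx p `<=` U) then tuple_mx @^-1` (bx p) else set0.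
have -> : tuple_mx @^-1` U = \bigcup_p F p.
  apply/seteqP; split=> [t Ut|t [p _]]; last first.
    by rewrite /F; case: pselect => //= pU; exact: pU.
  have /nbhs_ballP[e /= e0 eU] : nbhs (tuple_mx t) U by exact: open_nbhs_nbhs.
  have e2 : 0 < e / 2 by rewrite divr_gt0.
  have [k _ /(_ k (leqnn _)) /= ke] := near_infty_natSinv_lt (PosNum e2).
  have k0 : (0 : R) < k.+1%:R^-1 by rewrite invr_gt0 ltr0n.
  have q_ij i j : {q : rat | ball (ratr q : R) k.+1%:R^-1 (tuple_mx t i j)}.
    apply: cid; have : tuple_mx t i j - k.+1%:R^-1 < tuple_mx t i j + k.+1%:R^-1.
      by rewrite ltrBlDr -addrA ltrDl addr_gt0.
    move=> /rat_in_itvoo[q]; rewrite in_itv /= => /andP[q1 q2]; exists q.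
    by rewrite /ball /= distrC ltr_distlC q1 q2.
  pose q : 'M[rat]_(n, m) := \matrix_(i, j) sval (q_ij i j).
  have bt : bx (q, k) (tuple_mx t).
    by split=> // i j; rewrite !mxE; exact: svalP (q_ij i j).
  exists (q, k) => //; rewrite /F; case: pselect => //=; case.
  move=> y by_; apply: eU.
  apply: (@le_ball _ _ _ (k.+1%:R^-1 + k.+1%:R^-1)).
    by rewrite [leRHS]splitr; apply: lerD; apply: ltW.
  by apply: ball_triangle by_; exact: ball_sym.
apply: countable_bigcupT_measurable; first exact: countableP.
move=> p; rewrite /F; case: pselect => //= _.
have -> : tuple_mx @^-1` bx p = \bigcap_(k in [set: 'I_(n * m)])
   ((@tnth _ RT ^~ k) @^-1`
      ball (mxvec (map_mx ratr p.1) ord0 k : R) p.2.+1%:R^-1).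
  apply/seteqP; split=> [t [_ /= H] k _|t /= H].
    rewrite /preimage /=; case: (mxvec_indexP k) => i j; rewrite mxvecE.
    by have := H i j; rewrite !mxE.
  split=> [|i j]; first by rewrite invr_gt0 ltr0n.
  by have := H (mxvec_index i j) I; rewrite /= mxvecE /tuple_mx !mxE.
apply: fin_bigcap_measurable => // k _.
rewrite -[X in measurable X]setTI; apply: measurable_tnth => //.
by rewrite ball_itv; exact: measurable_itv.
Qed.

HB.instance Definition _ :=
  isMeasurableFun.Build _ _ _ _ tuple_mx measurable_tuple_mx.

(* law of a Gaussian matrix; for m = 1 this is N(0, I_n) *)
Definition gaussian : probability 'M[R]_(n, m) R :=
  distribution (gaussian_tuple (n * m)) tuple_mx.

(* the entries are i.i.d. standard normal under this law *)
Lemma gaussian_box (B : 'I_n -> 'I_m -> set RT) :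
  (forall i j, measurable (B i j)) ->
  gaussian [set A | forall i j, B i j (A i j)] =
  (\prod_i \prod_j normal_prob 0 1 (B i j))%E.
Proof.
move=> mB; pose Bk k : set RT := mxvec (\matrix_(i, j) B i j) ord0 k.
have BkE i j : Bk (mxvec_index i j) = B i j by rewrite /Bk mxvecE mxE.
rewrite /gaussian /= /distribution /pushforward.
have -> : tuple_mx @^-1` [set A | forall i j, B i j (A i j)] =
    [set t | forall k, Bk k (tnth t k)].
  apply/seteqP; split=> t /= H.
    by move=> k; case: (mxvec_indexP k) => i j; have := H i j; rewrite BkE !mxE.
  by move=> i j; have := H (mxvec_index i j); rewrite BkE !mxE.
rewrite gaussian_tuple_box; last first.
  by move=> k; case: (mxvec_indexP k) => i j; rewrite BkE.
rewrite pair_bigA (reindex _ (curry_mxvec_bij n m)) /=.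
by apply: eq_bigr => -[i j] _ /=; rewrite BkE.
Qed.

End gaussian_tuple.

Arguments gaussian {R} n m.
Arguments gaussian_box {R} n m B.

Section conic_condition.
Context {R : realType}.

Definition closed_convex_cone m (C : set 'cV[R]_m) : Prop :=
  [/\ closed C, convex_set C &
      forall (t : R) (x : 'cV[R]_m), 0 <= t -> C x -> C (t *: x)].

Definition nonzero_cone m (C : set 'cV[R]_m) : Prop :=
  exists2 x, C x & x != 0.

(* Euclidean norm; the norm the library puts on matrices is the sup norm *)
Definition enorm m (x : 'cV[R]_m) : R := Num.sqrt (\sum_i x i ord0 ^+ 2).

Definition proj m (C : set 'cV[R]_m) (y : 'cV[R]_m) : 'cV[R]_m :=
  xget 0 [set p | C p /\ forall z, C z -> enorm (y - p) <= enorm (y - z)].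

Definition statdim m (C : set 'cV[R]_m) : R :=
  fine ('E_(gaussian m 1)[(fun g : 'cV[R]_m => enorm (proj C g) ^+ 2)%R])%E.

Definition opnorm n m (A : 'M[R]_(n, m)) : R :=
  sup [set enorm (A *m x) | x in [set x : 'cV[R]_m | enorm x <= 1]].

(* the infimum is attained when C and D are nonzero closed convex cones *)
Definition rsv n m (C : set 'cV[R]_m) (D : set 'cV[R]_n) (A : 'M[R]_(n, m)) : R :=
  inf [set enorm (proj D (A *m x)) | x in C `&` [set x | enorm x = 1]].

Definition quot_oo (a b : R) : \bar R := if b == 0 then +oo%E else (a / b)%:E.

Definition renegar n m (C : set 'cV[R]_m) (D : set 'cV[R]_n)
    (A : 'M[R]_(n, m)) : \bar R :=
  mine (quot_oo (opnorm A) (rsv C D A)) (quot_oo (opnorm A) (rsv D C (- A^T))).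

End conic_condition.

Section weak_expectation.
Context {R : realType}.

(* conditional expectation given an event; meaningful when 0 < P A *)
Definition cond_expectation d (T : measurableType d) (P : probability T R)
    (X : T -> \bar R) (A : set T) : \bar R :=
  ((\int[P]_(x in A) X x) * ((fine (P A))^-1)%:E)%E.

(* p k <= e^{-Omega(a k)} *)
Definition exp_small (p : nat -> \bar R) (a : nat -> R) : Prop :=
  exists2 c : R, 0 < c &
    \forall k \near \oo, (p k <= (expR (- (c * a k)))%:E)%E.

(* The clause on ~` E k makes every conditional expectation well defined; for
   large k it already follows from exp_small. *)
Definition weak_expectation_O (d : nat -> measure_display)
    (M : forall k, measurableType (d k)) (mu : forall k, probability (M k) R)
    (T : forall k, M k -> \bar R) (f : nat -> R) : Prop :=
  (forall k, measurable_fun [set: M k] (T k)) /\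
  exists E : forall k, set (M k),
    [/\ forall k, measurable (E k),
        exp_small (fun k => mu k (E k)) (fun k => k%:R),
        forall k, (0 < mu k (~` E k))%E &
        exists K : R, \forall k \near \oo,
          (cond_expectation (mu k) (T k) (~` E k) <= (K * f k)%:E)%E].

End weak_expectation.

(* Main.v *)
Require Import Defs.
From HB Require Import structures.
From mathcomp Require Import all_boot all_order all_algebra.
From mathcomp Require Import all_classical all_reals all_analysis.
From mathcomp Require Import measurable_realfun.
From mathcomp Require Import ring lra.

Set Implicit Arguments.
Unset Strict Implicit.
Unset Printing Implicit Defensive.

Import Order.TTheory GRing.Theory Num.Theory.
Import numFieldNormedType.Exports.

Local Open Scope classical_set_scope.
Local Open Scope ring_scope.

(** The condition number is at most K / c as soon as |A| <= K and
    0 < c <= sigma_{C->D}(A), so two tail bounds for a Gaussian matrix G suffice: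
    with probability 1 - exp(- const * n), up to an arbitrarily small multiple of
    sqrt n,

      |G| <= sqrt m + sqrt n   and   sigma_{C->D}(G) >= sqrt delta(D) - sqrt delta(C).

    After division by sqrt n these levels tend to 1 + gamma and
    beta - alpha * gamma, whose quotient is the limit in the theorem
    ([renegar_tail], [renegar_le_near]).

    Both bounds come from Gordon's comparison between the processes <G x, y> + z
    and <g, y> + <h, x>, where x and y are unit vectors and z, g, h are
    independent standard Gaussian.  For y and y' their covariances agree when x is
    fixed, and otherwise differ by (1 - <x, x'>) (1 - <y, y'>) >= 0.  The unit
    vectors of the cones are replaced by finite nets, the maxima over the nets by
    the smooth function log-sum-exp, and the comparison is made for the
    exponential moments of such expressions ([gordon_comparison], [soft_gordon]);
    Markov's inequality then gives the tails ([minmax_tail], [max_tail]).  The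
    expectation of max_y <g, y> over a net of C is sqrt delta(C) up to a constant and a
    small multiple of sqrt n ([softlin_mean_le], [softlin_mean_ge]), because
    max_y <g, y> over unit vectors y of C is |Pi_C(g)| unless Pi_C(g) = 0.  The
    deviation of the maxima from their means is controlled by a second comparison,
    between two independent copies of a process and two equal copies
    ([softdiff_comparison], [softlin_concentrated]).

    The comparison of two centred Gaussian vectors ([gaussian_comparison]) is proved
    without differentiating under an integral.  Averaging over a Gaussian vector is an
    operator on nonnegative functionals; as N(0, 1) is stable, it is
    the (2 ^ k)-th iterate of the average over the vector shrunk by 2 ^ (- k / 2).
    These operators commute, so it is enough to compare one shrunk step of each, up
    to a factor 1 + 2 ^ (- k) * kappa + O(2 ^ (- 3 k / 2)).  That is a second-order
    Taylor expansion, uniform relative to the functional: an exponential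
    whose exponent has bounded second-order expansions ([expands]), a class that
    contains iterated log-sum-exp.

    For the conditional expectations, take as exceptional set the failure of the
    bound R <= L + 1, where L is the limit.  A second failure set, for the bound
    R <= L + eta, has exponentially small probability and R <= L + 1 on it outside
    the exceptional set; so the conditional expectation is at most L + eta + o(1)
    ([cond_expectation_le]).  For the finitely many k where the tail bounds say
    nothing, some set of positive probability is needed on which R is bounded.  It is
    a small box around a matrix with finite condition number; such a matrix exists
    for every pair of nonzero closed convex cones ([exists_wellposed]). *)

(** * Taylor bounds for the exponential *)

Section exp_taylor.
Context {R : realType}.
Implicit Types (x y : R) (f df : R -> R).

(** By the mean value theorem. It turns a Taylor bound of one order into the bound
    of the next order. *)
Lemma derive_ge0_ge0 f df : (forall x, is_derive x 1 f (df x)) ->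
  f 0 = 0 -> (forall x, 0 <= x -> 0 <= df x) -> forall x, 0 <= x -> 0 <= f x.
Proof.
move=> fdf f0 df0 x x0.
have fc : {within `[0, x], continuous f}.
  apply: continuous_subspaceT => y.
  by apply/differentiable_continuous/derivable1_diffP; apply: ex_derive.
have [c + fx] := MVT_segment x0 (fun y _ => fdf y) fc.
rewrite in_itv/= => /andP[c0 _]; move: fx; rewrite f0 !subr0 => ->.
by rewrite mulr_ge0// df0.
Qed.

Lemma expR_ge_quad x : 0 <= x -> 1 + x + x ^+ 2 / 2 <= expR x.
Proof.
move=> x0; rewrite -subr_ge0.
pose f (t : R) := expR t - (1 + t + t ^+ 2 / 2).
pose df (t : R) := expR t - (1 + t).
apply: (@derive_ge0_ge0 f df) => //.
- move=> t; apply: is_derive_eq.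
  by rewrite /df /GRing.scale/=; field.
- by rewrite /f expR0; ring.
- by move=> t _; rewrite subr_ge0 expR_ge1Dx.
Qed.

(** This bound and the next two use x ^ k * exp x as remainder instead of x ^ k *
    exp x / k!, which makes the derivative of each of them follow from the
    previous one. *)
Lemma expR_le_lin x : 0 <= x -> expR x <= 1 + x * expR x.
Proof.
move=> x0; have := expR_ge1Dx (- x); rewrite expRN.
rewrite -(ler_pM2r (expR_gt0 x)) mulVf ?gt_eqF ?expR_gt0//; lra.
Qed.

Lemma expR_le_quad x : 0 <= x -> expR x <= 1 + x + x ^+ 2 * expR x.
Proof.
move=> x0; rewrite -subr_ge0.
pose f (t : R) := 1 + t + t ^+ 2 * expR t - expR t.
pose df (t : R) := 1 + (2 * t * expR t + t ^+ 2 * expR t) - expR t.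
apply: (@derive_ge0_ge0 f df) => //.
- move=> t; apply: is_derive_eq.
  by rewrite /df /GRing.scale/=; field.
- by rewrite /f expR0; ring.
- move=> t t0; have := expR_le_lin t0; rewrite /df.
  have : 0 <= t ^+ 2 * expR t by rewrite mulr_ge0 ?sqr_ge0 ?expR_ge0.
  have : 0 <= t * expR t by rewrite mulr_ge0 ?expR_ge0.
  by nra.
Qed.

Lemma expR_le_cube x : 0 <= x -> expR x <= 1 + x + x ^+ 2 / 2 + x ^+ 3 * expR x.
Proof.
move=> x0; rewrite -subr_ge0.
pose f (t : R) := 1 + t + t ^+ 2 / 2 + t ^+ 3 * expR t - expR t.
pose df (t : R) := 1 + t + (3 * t ^+ 2 * expR t + t ^+ 3 * expR t) - expR t.
apply: (@derive_ge0_ge0 f df) => //.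
- move=> t; apply: is_derive_eq.
  by rewrite /df /GRing.scale/=; field.
- by rewrite /f expR0; ring.
- move=> t t0; have := expR_le_quad t0; rewrite /df.
  have : 0 <= t ^+ 2 * expR t by rewrite mulr_ge0 ?sqr_ge0 ?expR_ge0.
  have : 0 <= t ^+ 3 * expR t by rewrite mulr_ge0 ?exprn_ge0 ?expR_ge0.
  by nra.
Qed.

Lemma expRN_le_quad x : 0 <= x -> expR (- x) <= 1 - x + x ^+ 2 / 2.
Proof.
move=> x0; rewrite -subr_ge0.
pose f (t : R) := 1 - t + t ^+ 2 / 2 - expR (- t).
pose df (t : R) := t - 1 + expR (- t).
apply: (@derive_ge0_ge0 f df) => //.
- move=> t; apply: is_derive_eq.
  by rewrite /df /GRing.scale/=; field.
- by rewrite /f oppr0 expR0; ring.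
- by move=> t _; have := expR_ge1Dx (- t); rewrite /df; lra.
Qed.

Lemma expRN_ge_cube x : 0 <= x -> 1 - x + x ^+ 2 / 2 - x ^+ 3 <= expR (- x).
Proof.
move=> x0; rewrite -subr_ge0.
pose f (t : R) := expR (- t) - (1 - t + t ^+ 2 / 2 - t ^+ 3).
pose df (t : R) := - expR (- t) + 1 - t + 3 * t ^+ 2.
apply: (@derive_ge0_ge0 f df) => //.
- move=> t; apply: is_derive_eq.
  by rewrite /df /GRing.scale/=; field.
- by rewrite /f oppr0 expR0; ring.
- move=> t t0; have := expRN_le_quad t0; rewrite /df.
  by have := sqr_ge0 t; lra.
Qed.

Lemma expR_taylor2 x :
  `|expR x - (1 + x + x ^+ 2 / 2)| <= `|x| ^+ 3 * expR `|x|.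
Proof.
rewrite ler_norml; case: (leP 0 x) => x0; rewrite ?(ger0_norm x0) ?(ltr0_norm x0).
  have := expR_ge_quad x0; have := expR_le_cube x0.
  have : 0 <= x ^+ 3 * expR x by rewrite mulr_ge0 ?exprn_ge0 ?expR_ge0.
  by move=> h1 h2 h3; apply/andP; split; lra.
have y0 : 0 <= - x by rewrite oppr_ge0 ltW.
have := expRN_le_quad y0; have := expRN_ge_cube y0.
rewrite opprK sqrrN => h1 h2.
have e1 : 1 <= expR (- x) by rewrite -expR0 ler_expR.
have : (- x) ^+ 3 <= (- x) ^+ 3 * expR (- x).
  by rewrite ler_peMr// exprn_ge0.
by move=> h3; apply/andP; split; lra.
Qed.

Lemma cube_le_expR x : 0 <= x -> x ^+ 3 <= 6 * expR x.
Proof.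
move=> x0; have := expR_ge1Dxn 2 x0.
rewrite (_ : 3`! = 6)%N//; lra.
Qed.

Lemma expR_norm_le x : expR `|x| <= expR x + expR (- x).
Proof.
by case: (ger0P x) => _; have := expR_ge0 x; have := expR_ge0 (- x); lra.
Qed.

End exp_taylor.

(** * The standard normal law on the line *)

Section gauss1.
Context {R : realType}.
Notation RT := (measurableTypeR R).
Local Notation mu := (@lebesgue_measure R).
Local Notation N01 := (@normal_prob R 0 1).
Local Notation pdf := (@normal_pdf R 0 1).
Local Open Scope ereal_scope.

Import HBNNSimple.

Let mpdf : measurable_fun setT (EFin \o pdf).
Proof. by apply/measurable_EFinP; exact: measurable_normal_pdf. Qed.

Let mexp (t : R) : measurable_fun [set: RT] (fun z : RT => (expR (t * z))%:E).
Proof.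
by apply/measurable_EFinP/measurableT_comp => //; exact: measurable_funM.
Qed.

(** By monotone approximation from simple functions; the law is defined only
    through its values on sets. *)
Lemma ge0_integral_normal (f : RT -> \bar R) : measurable_fun setT f ->
  (forall x, 0 <= f x) ->
  \int[N01]_x f x = \int[mu]_x (f x * (pdf x)%:E).
Proof.
move=> mf f0.
have indicE A : measurable A ->
    \int[N01]_x (\1_A x)%:E = \int[mu]_x ((\1_A x)%:E * (pdf x)%:E).
  move=> mA; rewrite integral_indic// setIT.
  transitivity (\int[mu]_(x in A) (pdf x)%:E) => //.
  rewrite [LHS]integral_mkcond.
  apply: eq_integral => x _; rewrite patchE indicE.
  by case: ifPn => _; rewrite ?mul1e ?mul0e.
have nnsE (g : {nnsfun RT >-> R}) :
    \int[N01]_x (g x)%:E = \int[mu]_x ((g x)%:E * (pdf x)%:E).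
  under [LHS]eq_integral do rewrite fimfunE -fsumEFin//.
  rewrite [LHS]ge0_integral_fsum//; last 2 first.
    - by move=> r; exact/measurable_EFinP/measurableT_comp.
    - by move=> n x _; rewrite EFinM nnfun_muleindic_ge0.
  under [RHS]eq_integral.
    move=> x xD; rewrite fimfunE -fsumEFin// ge0_mule_fsuml; last first.
      by move=> r; rewrite EFinM nnfun_muleindic_ge0.
    over.
  rewrite [RHS]ge0_integral_fsum//; last 2 first.
    - move=> r; apply: emeasurable_funM => //.
      by apply/measurable_EFinP; do 2 apply/measurableT_comp => //.
    - move=> n x _; rewrite EFinM mule_ge0// ?nnfun_muleindic_ge0//.
      by rewrite lee_fin normal_pdf_ge0.
  apply: eq_fsbigr => r _.
  under [RHS]eq_integral do rewrite EFinM -muleA.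
  rewrite integralZl_indic_nnsfun// indicE//.
  have [r0|r0] := leP 0%R r.
    rewrite ge0_integralZl//.
    - apply: emeasurable_funM => //.
      by apply/measurable_EFinP/measurable_indic.
    - by move=> x _; rewrite mule_ge0// lee_fin ?normal_pdf_ge0.
  rewrite preimage_nnfun0//.
  rewrite [X in _ * X]integral0_eq ?mule0.
    by rewrite [RHS]integral0_eq// => x _; rewrite indic0 mul0e mule0.
  by move=> x _; rewrite indic0 mul0e.
pose f_ := nnsfun_approx measurableT mf.
transitivity (limn (fun n => \int[N01]_x (f_ n x)%:E)).
  rewrite -monotone_convergence//=.
  - apply: eq_integral => x _; apply/esym/cvg_lim => //=.
    exact: cvg_nnsfun_approx.
  - by move=> n; apply/measurable_EFinP.
  - by move=> n x _; rewrite lee_fin.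
  - by move=> x _ a b ab; rewrite lee_fin//; exact/lefP/nd_nnsfun_approx.
rewrite (_ : (fun _ => _) = fun n => \int[mu]_x ((f_ n x)%:E * (pdf x)%:E));
  last by apply/funext => n; exact: nnsE.
rewrite -monotone_convergence//=.
- apply: eq_integral => x _; apply/cvg_lim => //.
  apply: cvgeZr => //.
  exact: cvg_nnsfun_approx.
- by move=> n; apply: emeasurable_funM => //; apply/measurable_EFinP.
- by move=> n x _; rewrite mule_ge0// lee_fin// normal_pdf_ge0.
- move=> x _ a b ab; rewrite lee_wpmul2r ?lee_fin ?normal_pdf_ge0//.
  exact/lefP/nd_nnsfun_approx.
Qed.

(** The measure A |-> c * mu (phi^-1 A), with phi the affine map, gives an
    interval its length, so it is Lebesgue measure. *)
Lemma ge0_integral_affine (c b : R) (f : RT -> \bar R) : (0 < c)%R ->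
  measurable_fun setT f -> (forall x, 0 <= f x) ->
  \int[mu]_x f (c * x + b)%R = c^-1%:E * \int[mu]_x f x.
Proof.
move=> c0 mf f0.
pose phi : RT -> RT := fun x => (c * x + b)%R.
have mphi : measurable_fun setT phi.
  by apply: measurable_funD => //; exact: measurable_funM.
have muE (A : set RT) : measurable A -> mu A = (c%:E * mu (phi @^-1` A)).
  have cE : c = (NngNum (ltW c0))%:num by [].
  rewrite [in RHS]cE; move: A.
  apply: (@lebesgue_measure_unique R
    (mscale (NngNum (ltW c0)) (measure_function_pushforward__canonical__measure_function_Measure mu mphi))).
  move=> _ [[x y]] _ <-; rewrite /mscale/= /pushforward.
  rewrite [X in _ = _ * mu X](_ : _ = [set` `](x - b) / c, (y - b) / c]%R]); last first.
    apply/seteqP; split=> z /=; rewrite !in_itv/= /phi;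
      by rewrite ltr_pdivrMr// ler_pdivlMr// (mulrC z) ltrBlDr lerBrDr.
  rewrite !lebesgue_measure_itv/= !lte_fin ltr_pM2r ?invr_gt0// ltrD2r.
  case: ifPn => _; last by rewrite mule0.
  by rewrite -!EFinD -EFinM; congr EFin; field; rewrite gt_eqF.
have -> : \int[mu]_x f (c * x + b)%R = \int[pushforward mu phi]_x f x.
  by rewrite ge0_integral_pushforward.
have cV0 : (0 <= c^-1)%R by rewrite invr_ge0 ltW.
rewrite -[c^-1%R]/((NngNum cV0)%:num) -ge0_integral_mscale//.
apply: eq_measure_integral => A mA _; rewrite /pushforward.
transitivity (c^-1%:E * mu A) => //.
by rewrite muE// muleA -EFinM mulVf ?gt_eqF// mul1e.
Qed.

Lemma normal01E x :
  pdf x = ((Num.sqrt (pi *+ 2))^-1 * expR (- (x ^+ 2 / 2)))%R.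
Proof.
rewrite (@normal_pdfE R 0 1) ?oner_eq0// /normal_peak /normal_fun expr1n mul1r subr0.
by rewrite mulNr.
Qed.

(** If z and w are independent standard normal, so is (z + w) / sqrt 2, because
    the density of (z, w) is invariant under rotation by 45 degrees: here v = c *
    (z + w) takes the place of w, the density is rewritten by this symmetry, and z
    is integrated out. *)
Lemma normal_stable (c : R) (f : RT -> \bar R) : (0 < c)%R -> (c ^+ 2 = 2^-1)%R ->
  measurable_fun setT f -> (forall x, 0 <= f x) ->
  \int[N01]_z \int[N01]_w f (c * z + c * w)%R = \int[N01]_x f x.
Proof.
move=> c0 c2 mf f0.
have pdf0 x : 0 <= (pdf x)%:E by rewrite lee_fin normal_pdf_ge0.
(* both exponents are - ((z ^ 2 + v ^ 2) / c ^ 2 - 2 z v / c) / 2, in a form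
   symmetric in z and v since 1 / c ^ 2 = 2 *)
have cc z v : (pdf z * pdf (c^-1 * v - z) = pdf v * pdf (c^-1 * z - v))%R.
  rewrite !normal01E mulrACA [RHS]mulrACA -!expRD; congr (_ * expR _)%R.
  have d2 : (c^-1 ^+ 2 = 2)%R by rewrite exprVn c2 invrK.
  move: (c^-1)%R d2 => d d2.
  apply/eqP; rewrite -subr_eq0; apply/eqP.
  by transitivity ((d ^+ 2 - 2) * (v ^+ 2 - z ^+ 2) / -2)%R; [field|rewrite d2; field].
pose K (p : RT * RT) := f p.2 * (pdf p.2 * pdf (c^-1 * p.1 - p.2)%R)%:E.
have mK : measurable_fun setT K.
  apply: emeasurable_funM; first exact: measurableT_comp.
  apply/measurable_EFinP/measurable_funM.
    by apply: measurableT_comp => //; exact: measurable_normal_pdf.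
  apply: measurableT_comp => //; first exact: measurable_normal_pdf.
  apply: measurable_funB => //.
  exact: measurable_funM.
have K0 p : 0 <= K p.
  by rewrite mule_ge0// lee_fin mulr_ge0 ?normal_pdf_ge0.
have E1 z : (\int[N01]_w f (c * z + c * w)%R) * (pdf z)%:E =
    c^-1%:E * \int[mu]_v K (z, v).
  rewrite ge0_integral_normal//; last first.
    apply: measurableT_comp => //.
    by apply: measurable_funD => //; exact: measurable_funM.
  rewrite muleC -ge0_integralZl//; last 2 first.
  - apply: emeasurable_funM => //.
    apply: measurableT_comp => //.
    by apply: measurable_funD => //; exact: measurable_funM.
  - by move=> x _; rewrite mule_ge0.
  rewrite -(@ge0_integral_affine c (c * z)%R)//; last exact: measurableT_comp.
  apply: eq_integral => w _; rewrite /K/= -cc.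
  rewrite (addrC (c * w)%R) muleCA -EFinM; congr (_ * (_ * pdf _)%:E).
  by field; rewrite gt_eqF.
rewrite ge0_integral_normal; last 2 first.
- apply: (@measurable_fun_fubini_tonelli_F _ _ RT RT R N01
    (fun p => f (c * p.1 + c * p.2)%R)) => //.
  apply: measurableT_comp => //.
  by apply: measurable_funD => //; exact: measurable_funM.
- by move=> z; exact: integral_ge0.
under eq_integral do rewrite E1.
rewrite ge0_integralZl//; last 3 first.
- exact: measurable_fun_fubini_tonelli_F.
- by move=> z _; exact: integral_ge0.
- by rewrite lee_fin invr_ge0 ltW.
rewrite (fubini_tonelli K)//.
rewrite -ge0_integralZl//; last 3 first.
- exact: measurable_fun_fubini_tonelli_G.
- by move=> z _; exact: integral_ge0.
- by rewrite lee_fin invr_ge0 ltW.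
rewrite [RHS]ge0_integral_normal//.
apply: eq_integral => v _; rewrite /K /=.
under eq_integral do rewrite EFinM muleA.
rewrite ge0_integralZl//; last 2 first.
- apply/measurable_EFinP; apply: measurableT_comp.
    exact: measurable_normal_pdf.
  by apply: measurable_funB => //; exact: measurable_funM.
- by rewrite mule_ge0.
have -> : \int[mu]_z (pdf (c^-1 * z - v)%R)%:E = c%:E.
  rewrite (@ge0_integral_affine c^-1 (- v)%R (fun x => (pdf x)%:E)) ?invr_gt0//.
  by rewrite invrK integral_normal_pdf mule1.
by rewrite muleCA -EFinM mulVf ?gt_eqF// mule1.
Qed.

(** Completing the square turns the integrand into exp (t ^ 2 / 2) times the
    density shifted by t. *)
Lemma normal_mgf (t : R) :
  \int[N01]_z (expR (t * z))%:E = (expR (t ^+ 2 / 2))%:E.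
Proof.
rewrite ge0_integral_normal; last 2 first.
- by apply/measurable_EFinP/measurableT_comp => //; exact: measurable_funM.
- by move=> z; rewrite lee_fin expR_ge0.
transitivity (\int[mu]_x ((expR (t ^+ 2 / 2))%:E * (pdf (1 * x - t)%R)%:E)).
  apply: eq_integral => x _; rewrite !normal01E -!EFinM; congr EFin.
  rewrite mulrCA [RHS]mulrCA -!expRD; congr (_ * expR _)%R.
  by field.
rewrite ge0_integralZl//; last 2 first.
- apply/measurable_EFinP; apply: measurableT_comp.
    exact: measurable_normal_pdf.
  by apply: measurable_funB => //; exact: measurable_funM.
- by move=> x _; rewrite lee_fin normal_pdf_ge0.
rewrite (@ge0_integral_affine 1 (- t)%R (fun x => (pdf x)%:E))//; last first.
  by move=> x; rewrite lee_fin normal_pdf_ge0.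
by rewrite integral_normal_pdf invr1 !mule1.
Qed.

Lemma normal_symm (f : RT -> \bar R) : measurable_fun setT f ->
  (forall x, 0 <= f x) ->
  \int[N01]_x f (- x)%R = \int[N01]_x f x.
Proof.
move=> mf f0.
rewrite !ge0_integral_normal//; last by apply: measurableT_comp.
pose phi : RT -> RT := fun x => (- x)%R.
have mphi : measurable_fun setT phi by exact: measurableT_comp.
pose h (x : RT) := f x * (pdf x)%:E.
have mh : measurable_fun setT h by exact: emeasurable_funM.
have h0 x : 0 <= h x by rewrite mule_ge0// lee_fin normal_pdf_ge0.
transitivity (\int[mu]_x h (phi x)).
  by apply: eq_integral => x _; rewrite /h /phi !normal01E sqrrN.
transitivity (\int[pushforward mu phi]_x h x).
  by rewrite ge0_integral_pushforward.
by apply: eq_measure_integral => A mA _; exact: lebesgue_measureN.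
Qed.

Lemma normal_expabs_le (K : R) :
  \int[N01]_z (expR (K * `|z|))%:E <= (2 * expR (K ^+ 2 / 2))%:E.
Proof.
apply: (@le_trans _ _ (\int[N01]_z ((expR (K * z))%:E + (expR (- K * z))%:E))).
  apply: ge0_le_integral => //.
  - apply/measurable_EFinP/measurableT_comp => //.
    by apply: measurable_funM => //; exact: measurableT_comp.
  - by apply: emeasurable_funD; exact: mexp.
  - move=> z _; rewrite -EFinD lee_fin mulNr.
    have [z0|z0] := leP 0%R (z : R); rewrite ?(ger0_norm z0) ?(ltr0_norm z0).
      by rewrite lerDl expR_ge0.
    by rewrite mulrN lerDr expR_ge0.
rewrite ge0_integralD//.
by rewrite !normal_mgf sqrrN -EFinD lee_fin mulr_natl.
Qed.

Lemma integral_affine d (T : measurableType d) (P : probability T R)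
    (a b : R) (f : T -> \bar R) : (0 <= a)%R -> (0 <= b)%R ->
  measurable_fun setT f -> (forall x, 0 <= f x) ->
  \int[P]_x (a%:E + b%:E * f x) = a%:E + b%:E * \int[P]_x f x.
Proof.
move=> a0 b0 mf f0.
rewrite ge0_integralD//; last 2 first.
- by move=> x _; rewrite mule_ge0.
- exact: measurable_funeM.
rewrite ge0_integralZl//; congr (_ + _).
have -> : \int[P]_x a%:E = \int[P]_x cst a%:E x by [].
rewrite integral_cst// -[RHS]mule1; congr (_ * _); exact: probability_setT.
Qed.

Let msq : measurable_fun [set: RT] (fun z : RT => ((z : R) ^+ 2)%:E).
Proof. by apply/measurable_EFinP; exact: measurable_funX. Qed.

Let normal_cosh (s : R) :
  \int[N01]_z ((expR (s * z))%:E + (expR (- s * z))%:E) =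
  (2 * expR (s ^+ 2 / 2))%:E.
Proof.
rewrite ge0_integralD//; try by move=> z _; rewrite lee_fin expR_ge0.
by rewrite !normal_mgf sqrrN -EFinD mulr_natl.
Qed.

Lemma cosh_ge (x : R) : (2 + x ^+ 2 <= expR x + expR (- x))%R.
Proof.
wlog x0 : x / (0 <= x)%R => [hw|].
  case: (leP 0%R x) => [|/ltW x0]; first exact: hw.
  by have := hw (- x)%R; rewrite oppr_ge0 sqrrN opprK addrC [(expR (- x) + _)%R]addrC; apply.
pose f (t : R) := (expR t + expR (- t) - (2 + t ^+ 2))%R.
pose df (t : R) := (expR t - expR (- t) - 2 * t)%R.
pose ddf (t : R) := (expR t + expR (- t) - 2)%R.
rewrite -subr_ge0; apply: (@derive_ge0_ge0 R f df) => //.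
- by move=> t; apply: is_derive_eq; rewrite /df /GRing.scale/=; field.
- by rewrite /f oppr0 expR0; ring.
move=> t t0; apply: (@derive_ge0_ge0 R df ddf) => //.
- by move=> u; apply: is_derive_eq; rewrite /ddf /GRing.scale/=; field.
- by rewrite /df oppr0 expR0; ring.
- by move=> u _; have := expR_ge1Dx u; have := expR_ge1Dx (- u)%R; rewrite /ddf; lra.
Qed.

Lemma cosh_le (x : R) :
  (expR x + expR (- x) <= 2 + x ^+ 2 + 2 * (`|x| ^+ 3 * expR `|x|))%R.
Proof.
have := expR_taylor2 x; have := expR_taylor2 (- x)%R.
rewrite normrN sqrrN !ler_norml => /andP[_ h1] /andP[_ h2]; lra.
Qed.

(** The second moment is read off from the exponential moments: 2 + s ^ 2 z ^ 2 <=
    exp (s z) + exp (- s z) integrates to 2 + s ^ 2 * E z ^ 2 <= 2 * exp (s ^ 2 /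
    2), and s tends to 0. *)
Lemma normal_sqr_le1 : \int[N01]_z ((z : R) ^+ 2)%:E <= 1.
Proof.
set I := (X in X <= 1).
have I0 : 0 <= I by apply: integral_ge0 => z _; rewrite lee_fin sqr_ge0.
have key (s : R) : 2%:E + (s ^+ 2)%:E * I <= (2 * expR (s ^+ 2 / 2))%:E.
  rewrite -normal_cosh -integral_affine ?sqr_ge0//; last first.
    by move=> z; rewrite lee_fin sqr_ge0.
  apply: ge0_le_integral => //.
  - by move=> z _; rewrite adde_ge0// mule_ge0// lee_fin sqr_ge0.
  - by apply: emeasurable_funD => //; exact: measurable_funeM.
  - exact: emeasurable_funD.
  - by move=> z _; rewrite -!EFinD lee_fin -exprMn mulNr cosh_ge.
have Ifin : I \is a fin_num.
  rewrite ge0_fin_numE// ltey; apply/eqP => Iy.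
  by have := key 1%R; rewrite expr1n mul1e Iy.
have [r Ir] : exists r, I = r%:E by exists (fine I); rewrite fineK.
rewrite {}Ir in key |- *; rewrite lee_fin.
apply/ler_addgt0Pr => e e0.
(* h stands for s ^ 2 / 2 *)
pose h := Num.min 1%R (e / expR 1)%R.
have h0 : (0 < h)%R by rewrite lt_min ltr01 divr_gt0// expR_gt0.
have h1 : (h <= 1)%R by rewrite ge_min lexx.
have he : (h * expR 1 <= e)%R by rewrite -ler_pdivlMr ?expR_gt0// ge_min lexx orbT.
have := key (Num.sqrt (2 * h))%R.
rewrite sqr_sqrtr; last by rewrite mulr_ge0 ?ltW.
rewrite (_ : 2 * h / 2 = h)%R; last by field.
rewrite -EFinM -EFinD lee_fin => key'.
have := expR_le_quad (ltW h0).
have : (h ^+ 2 * expR h <= h * e)%R.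
  rewrite expr2 -mulrA; apply: ler_wpM2l; first exact: ltW.
  apply: le_trans he; apply: ler_wpM2l; first exact: ltW.
  by rewrite ler_expR.
move=> h2 h3.
have : (h * r <= h * (1 + e))%R by nra.
by rewrite ler_pM2l.
Qed.

(** The lower bound uses the same limit as the upper one, with the third-order
    remainder of cosh bounded by an exponential moment of |z|. *)
Lemma normal_sqr : \int[N01]_z ((z : R) ^+ 2)%:E = 1.
Proof.
apply/eqP; rewrite eq_le normal_sqr_le1/=.
have := normal_sqr_le1; set I := (X in 1 <= X) => I1.
have I0 : 0 <= I by apply: integral_ge0 => z _; rewrite lee_fin sqr_ge0.
have Ifin : I \is a fin_num.
  by rewrite ge0_fin_numE// (le_lt_trans I1) ?ltry.
pose K : R := (12 * (2 * expR (2 ^+ 2 / 2)))%R.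
have mabs (t : R) : measurable_fun [set: RT] (fun z : RT => (expR (t * `|z|))%:E).
  apply/measurable_EFinP/measurableT_comp => //.
  by apply: measurable_funM => //; exact: measurableT_comp.
have key (s : R) : (0 < s <= 1)%R ->
    (2 * expR (s ^+ 2 / 2))%:E <= 2%:E + (s ^+ 2)%:E * I + (s ^+ 3 * K)%:E.
  move=> /andP[s0 s1].
  rewrite -normal_cosh -integral_affine ?sqr_ge0//; last first.
    by move=> z; rewrite lee_fin sqr_ge0.
  apply: (@le_trans _ _ (\int[N01]_z (2%:E + (s ^+ 2)%:E * ((z : R) ^+ 2)%:E +
     (12 * s ^+ 3)%:E * (expR (2 * `|z|))%:E))).
    apply: ge0_le_integral => //.
    - by move=> z _; rewrite adde_ge0// lee_fin expR_ge0.
    - exact: emeasurable_funD.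
    - apply: emeasurable_funD => //; last exact: measurable_funeM.
      by apply: emeasurable_funD => //; exact: measurable_funeM.
    move=> z _; rewrite -!EFinD lee_fin -exprMn mulNr.
    apply: (le_trans (cosh_le _)); rewrite lerD2l.
    rewrite normrM (gtr0_norm s0) exprMn.
    have z0 : (0 <= `|z : R|)%R by [].
    have h1 := cube_le_expR z0.
    have h2 : (expR (s * `|z|) <= expR `|z|)%R.
      by rewrite ler_expR ler_piMl.
    have h3 : (expR (2 * `|z|) = expR `|z| * expR `|z|)%R.
      by rewrite -expRD; congr expR; ring.
    have h4 : (`|z| ^+ 3 * expR (s * `|z|) <= 6 * expR `|z| * expR `|z|)%R.
      by apply: ler_pM => //; rewrite ?exprn_ge0 ?expR_ge0.
    have s3 : (0 <= s ^+ 3)%R by rewrite exprn_ge0// ltW.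
    have := ler_wpM2l s3 h4; rewrite h3.
    move: (s ^+ 3)%R (`|z| ^+ 3)%R (expR `|z|) (expR (s * `|z|)) => A B C D; lra.
  rewrite ge0_integralD//.
  - rewrite leeD2l// ge0_integralZl//; last first.
      by rewrite lee_fin mulr_ge0// exprn_ge0// ltW.
    rewrite (_ : (s ^+ 3 * K)%:E = (12 * s ^+ 3)%:E * (2 * expR (2 ^+ 2 / 2))%:E).
      by rewrite lee_wpmul2l ?normal_expabs_le// lee_fin mulr_ge0// exprn_ge0// ltW.
    by rewrite -EFinM; congr EFin; rewrite /K; ring.
  - by move=> z _; rewrite adde_ge0// mule_ge0// lee_fin sqr_ge0.
  - by apply: emeasurable_funD => //; exact: measurable_funeM.
  - move=> z _; rewrite mule_ge0// lee_fin ?expR_ge0// mulr_ge0// exprn_ge0// ltW//.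
  - exact: measurable_funeM.
have [r Ir] : exists r, I = r%:E by exists (fine I); rewrite fineK.
rewrite {}Ir in key |- *; rewrite lee_fin.
have K0 : (0 < K)%R by rewrite !mulr_gt0// expR_gt0.
apply/ler_addgt0Pr => e e0.
pose s := Num.min 1%R (e / K)%R.
have s0 : (0 < s)%R by rewrite lt_min ltr01 divr_gt0.
have s1 : (s <= 1)%R by rewrite ge_min lexx.
have se : (s * K <= e)%R by rewrite -ler_pdivlMr// ge_min lexx orbT.
have := key s; rewrite s0 s1 => /(_ isT).
rewrite -EFinM -!EFinD lee_fin => key'.
have := expR_ge1Dx (s ^+ 2 / 2)%R => h2.
have : (s ^+ 2 * 1 <= s ^+ 2 * (r + e))%R.
  have : (s ^+ 3 * K <= s ^+ 2 * e)%R by rewrite exprSr -mulrA ler_wpM2l ?sqr_ge0.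
  by lra.
by rewrite ler_pM2l// exprn_gt0.
Qed.

End gauss1.

(** * Gaussian averages as commuting operators *)

Section gavg.
Context {R : realType} {S : Type}.
Notation RT := (measurableTypeR R).
Local Notation N01 := (@normal_prob R 0 1).
Implicit Types (u v a b : S -> R) (l : seq (S -> R)).
Implicit Types Phi Psi : (S -> R) -> \bar R.
Local Open Scope ereal_scope.

(** A functional is evaluated on random vectors U, so measurability is asked along
    every measurable family; this avoids a sigma-algebra on S -> R, and it is
    stable under Gaussian averaging. *)
Definition functional Phi := (forall u, 0 <= Phi u) /\
  forall d (T : measurableType d) (U : S -> T -> RT),
    (forall s, measurable_fun setT (U s)) ->
    measurable_fun setT (fun t => Phi (U ^~ t)).

Definition gavg a Phi u := \int[N01]_z Phi (fun s => u s + z * a s)%R.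

Lemma functional_line Phi a u : functional Phi ->
  measurable_fun setT (fun z : RT => Phi (fun s => u s + z * a s)%R).
Proof.
move=> [_ mPhi]; apply: (mPhi _ _ (fun s (z : RT) => u s + z * a s)%R) => s.
by apply: measurable_funD => //; exact: measurable_funM.
Qed.

Lemma functional_gavg a Phi : functional Phi -> functional (gavg a Phi).
Proof.
move=> [Phi0 mPhi]; split=> [u|d T U mU]; first exact: integral_ge0.
apply: (@measurable_fun_fubini_tonelli_F _ _ T RT R N01
  (fun p => Phi (fun s => U s p.1 + p.2 * a s)%R)) => //.
apply: (mPhi _ _ (fun s (p : T * RT) => U s p.1 + p.2 * a s)%R) => s.
apply: measurable_funD; first exact: (measurableT_comp (mU s) measurable_fst).
exact: measurable_funM.
Qed.

Lemma functionalZ (k : R) Phi : (0 <= k)%R -> functional Phi ->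
  functional (fun u => k%:E * Phi u).
Proof.
move=> k0 [Phi0 mPhi]; split=> [u|d T U mU]; first by rewrite mule_ge0.
by apply: measurable_funeM; exact: mPhi.
Qed.

Lemma gavgC a b Phi u : functional Phi ->
  gavg a (gavg b Phi) u = gavg b (gavg a Phi) u.
Proof.
move=> [Phi0 mPhi].
pose K (p : RT * RT) := Phi (fun s => u s + p.1 * a s + p.2 * b s)%R.
have mK : measurable_fun setT K.
  apply: (mPhi _ _ (fun s (p : RT * RT) => u s + p.1 * a s + p.2 * b s)%R) => s.
  by apply: measurable_funD; [apply: measurable_funD|];
    rewrite //; exact: measurable_funM.
transitivity (\int[N01]_z \int[N01]_w K (z, w)); first by [].
rewrite (fubini_tonelli K mK) => [|p]; last exact: Phi0.
apply: eq_integral => z _; apply: eq_integral => w _; rewrite /K.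
by congr Phi; apply/funext => s; rewrite addrAC.
Qed.

(** Stability of the normal law: one step of size a is two independent steps of
    size a / sqrt 2. *)
Lemma gavg_split (c : R) a Phi u : (0 < c)%R -> (c ^+ 2 = 2^-1)%R ->
  functional Phi ->
  gavg (fun s => c * a s)%R (gavg (fun s => c * a s)%R Phi) u = gavg a Phi u.
Proof.
move=> c0 c2 fPhi; rewrite [RHS]/gavg.
rewrite -(normal_stable c0 c2 (functional_line _ _ fPhi) (fun z => fPhi.1 _)).
apply: eq_integral => z _; apply: eq_integral => w _.
by congr Phi; apply/funext => s; ring.
Qed.

Lemma gavg_le a Phi Psi u : functional Phi -> functional Psi ->
  (forall v, Phi v <= Psi v) -> gavg a Phi u <= gavg a Psi u.
Proof.
move=> fPhi fPsi le; apply: ge0_le_integral => //.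
- by move=> z _; exact: fPhi.1.
- exact: functional_line.
- exact: functional_line.
Qed.

Lemma gavgZ (k : R) a Phi u : (0 <= k)%R -> functional Phi ->
  gavg a (fun v => k%:E * Phi v) u = k%:E * gavg a Phi u.
Proof.
move=> k0 fPhi; rewrite /gavg ge0_integralZl//.
- exact: functional_line.
- by move=> z _; exact: fPhi.1.
Qed.

(** For l = [a_1; ...; a_p] this is E Phi (u + z_1 a_1 + ... + z_p a_p), the
    average over a Gaussian vector with covariance the sum of a s * a s' over a in
    l. *)
Definition gavgs l Phi := foldr gavg Phi l.

Lemma functional_gavgs l Phi : functional Phi -> functional (gavgs l Phi).
Proof. by move=> fPhi; elim: l => //= a l IH; exact: functional_gavg. Qed.

Lemma gavgs_le l Phi Psi u : functional Phi -> functional Psi ->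
  (forall v, Phi v <= Psi v) -> gavgs l Phi u <= gavgs l Psi u.
Proof.
move=> fPhi fPsi le; elim: l u => //= a l IH u.
by apply: gavg_le => //; exact: functional_gavgs.
Qed.

Lemma gavgsZ (k : R) l Phi : (0 <= k)%R -> functional Phi ->
  gavgs l (fun v => k%:E * Phi v) = (fun v => k%:E * gavgs l Phi v).
Proof.
move=> k0 fPhi; elim: l => //= a l ->; apply/funext => u.
by apply: gavgZ => //; exact: functional_gavgs.
Qed.

Lemma gavgs_gavgC a l Phi : functional Phi ->
  gavgs l (gavg a Phi) = gavg a (gavgs l Phi).
Proof.
move=> fPhi; elim: l => //= b l ->; apply/funext => u.
by apply: gavgC; exact: functional_gavgs.
Qed.

Lemma gavgsC l l' Phi : functional Phi ->
  gavgs l (gavgs l' Phi) = gavgs l' (gavgs l Phi).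
Proof.
move=> fPhi; elim: l' => //= a l' IH.
by rewrite gavgs_gavgC ?IH//; exact: functional_gavgs.
Qed.

Lemma gavgs_cat l l' Phi : gavgs (l ++ l') Phi = gavgs l (gavgs l' Phi).
Proof. by rewrite /gavgs foldr_cat. Qed.

Definition dilate (c : R) l := [seq (fun s => c * a s)%R | a <- l].

Lemma gavgs_split (c : R) l Phi : (0 < c)%R -> (c ^+ 2 = 2^-1)%R ->
  functional Phi ->
  gavgs (dilate c l) (gavgs (dilate c l) Phi) = gavgs l Phi.
Proof.
move=> c0 c2; elim: l Phi => //= a l IH Phi fPhi.
rewrite gavgs_gavgC; last exact: functional_gavgs.
rewrite IH//; apply/funext => u; apply: gavg_split => //.
exact: functional_gavgs.
Qed.

Lemma functional_iter l k Phi : functional Phi ->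
  functional (iter k (gavgs l) Phi).
Proof. by move=> fPhi; elim: k => //= k IH; exact: functional_gavgs. Qed.

Lemma iter_gavgsC l l' k Phi : functional Phi ->
  iter k (gavgs l) (gavgs l' Phi) = gavgs l' (iter k (gavgs l) Phi).
Proof.
by move=> fPhi; elim: k => //= k ->; rewrite gavgsC//; exact: functional_iter.
Qed.

(** A Gaussian vector is the sum of 2 ^ k independent copies of itself, each
    shrunk by 2 ^ (- k / 2). *)
Lemma iter_gavgs_split (c : R) l k Phi : (0 < c)%R -> (c ^+ 2 = 2^-1)%R ->
  functional Phi ->
  iter (2 ^ k) (gavgs (dilate (c ^+ k) l)) Phi = gavgs l Phi.
Proof.
move=> c0 c2 fPhi; elim: k => [|k IH].
  rewrite expr0 /= /dilate; congr gavgs.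
  by rewrite -[RHS]map_id; apply: eq_map => a; apply/funext => s; rewrite mul1r.
rewrite -{}IH expnS mulnC.
have -> : dilate (c ^+ k.+1) l = dilate c (dilate (c ^+ k) l).
  rewrite /dilate -map_comp; apply: eq_map => a; apply/funext => s /=.
  by rewrite exprS mulrA.
elim: (2 ^ k)%N => //= j ->.
by rewrite gavgs_split//; exact: functional_iter.
Qed.

(** A one-step comparison that holds at every point can be iterated because
    averages are monotone and commute. *)
Lemma iter_gavgs_compare l l' (rho : R) k Phi u : (0 <= rho)%R ->
  functional Phi -> (forall v, gavgs l Phi v <= rho%:E * gavgs l' Phi v) ->
  iter k (gavgs l) Phi u <= (rho ^+ k)%:E * iter k (gavgs l') Phi u.
Proof.
move=> rho0 fPhi le; elim: k u => [|k IH] u; first by rewrite mul1e.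
rewrite [leLHS]/= exprS [leRHS]/=.
apply: (@le_trans _ _ (gavgs l (fun v => (rho ^+ k)%:E * iter k (gavgs l') Phi v) u)).
  apply: gavgs_le => //; first exact: functional_iter.
  by apply: functionalZ; [rewrite exprn_ge0|exact: functional_iter].
rewrite gavgsZ ?exprn_ge0//; last exact: functional_iter.
rewrite -iter_gavgsC// mulrC EFinM -muleA; apply: lee_wpmul2l.
  by rewrite lee_fin exprn_ge0.
have fl : functional (gavgs l Phi) by exact: functional_gavgs.
have fl' : functional (gavgs l' Phi) by exact: functional_gavgs.
rewrite -(@iter_gavgsC l' l' k Phi fPhi).
have -> : rho%:E * iter k (gavgs l') (gavgs l' Phi) u =
    iter k (gavgs l') (fun v => rho%:E * gavgs l' Phi v) u.
  elim: k u {IH} => // k IH u /=.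
  transitivity (gavgs l' (fun v => rho%:E * iter k (gavgs l') (gavgs l' Phi) v) u).
    by rewrite gavgsZ//; exact: functional_iter.
  by congr (gavgs _ _ _); apply/funext => v; rewrite IH.
elim: k u {IH} => // k IH u /=.
apply: gavgs_le; [exact: functional_iter| |exact: IH].
by apply: functional_iter; exact: functionalZ.
Qed.

End gavg.

(** * Gaussian matrices and the Frobenius product *)

Section mxdot.
Context {R : realType}.

Definition mxdot n m (A B : 'M[R]_(n, m)) : R := \sum_i \sum_j A i j * B i j.

Lemma mxdotC n m (A B : 'M[R]_(n, m)) : mxdot A B = mxdot B A.
Proof. by apply: eq_bigr => i _; apply: eq_bigr => j _; rewrite mulrC. Qed.

Lemma mxdotDl n m (A B D : 'M[R]_(n, m)) :
  mxdot (A + B) D = mxdot A D + mxdot B D.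
Proof.
rewrite -big_split; apply: eq_bigr => i _; rewrite -big_split.
by apply: eq_bigr => j _; rewrite mxE mulrDl.
Qed.

Lemma mxdotZl n m (c : R) (A B : 'M[R]_(n, m)) :
  mxdot (c *: A) B = c * mxdot A B.
Proof.
rewrite mulr_sumr; apply: eq_bigr => i _; rewrite mulr_sumr.
by apply: eq_bigr => j _; rewrite mxE mulrA.
Qed.

Lemma mxdotNl n m (A B : 'M[R]_(n, m)) : mxdot (- A) B = - mxdot A B.
Proof. by rewrite -scaleN1r mxdotZl mulN1r. Qed.

Lemma mxdotBl n m (A B D : 'M[R]_(n, m)) :
  mxdot (A - B) D = mxdot A D - mxdot B D.
Proof. by rewrite mxdotDl mxdotNl. Qed.

Lemma mxdotDr n m (A B D : 'M[R]_(n, m)) :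
  mxdot A (B + D) = mxdot A B + mxdot A D.
Proof. by rewrite mxdotC mxdotDl !(mxdotC A). Qed.

Lemma mxdotZr n m (c : R) (A B : 'M[R]_(n, m)) :
  mxdot A (c *: B) = c * mxdot A B.
Proof. by rewrite mxdotC mxdotZl mxdotC. Qed.

Lemma mxdotNr n m (A B : 'M[R]_(n, m)) : mxdot A (- B) = - mxdot A B.
Proof. by rewrite mxdotC mxdotNl mxdotC. Qed.

Lemma mxdotBr n m (A B D : 'M[R]_(n, m)) :
  mxdot A (B - D) = mxdot A B - mxdot A D.
Proof. by rewrite mxdotDr mxdotNr. Qed.

Lemma mxdot0l n m (A : 'M[R]_(n, m)) : mxdot 0 A = 0.
Proof. by rewrite -(scale0r A) mxdotZl mul0r. Qed.

Lemma mxdot0r n m (A : 'M[R]_(n, m)) : mxdot A 0 = 0.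
Proof. by rewrite mxdotC mxdot0l. Qed.

Lemma mxdot_ge0 n m (A : 'M[R]_(n, m)) : 0 <= mxdot A A.
Proof. by apply: sumr_ge0 => i _; apply: sumr_ge0 => j _; rewrite -expr2 sqr_ge0. Qed.

Lemma mxdot_eq0 n m (A : 'M[R]_(n, m)) : mxdot A A = 0 -> A = 0.
Proof.
move=> /eqP; rewrite psumr_eq0 => [/allP h|i _]; last first.
  by apply: sumr_ge0 => j _; rewrite -expr2 sqr_ge0.
apply/matrixP => i j; rewrite mxE.
have := h i (mem_index_enum _); rewrite psumr_eq0 => [/allP h'|k _]; last first.
  by rewrite -expr2 sqr_ge0.
by have := h' j (mem_index_enum _); rewrite -expr2 sqrf_eq0 => /eqP.
Qed.

Lemma mxdot_vec n m (A B : 'M[R]_(n, m)) :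
  mxdot A B = \sum_k mxvec A 0 k * mxvec B 0 k.
Proof.
rewrite /mxdot pair_bigA (reindex _ (curry_mxvec_bij n m)) /=.
by apply: eq_bigr => -[i j] _ /=; rewrite !mxvecE.
Qed.

End mxdot.

Section lipschitz.
Context {R : realType} {n m : nat}.
Notation RT := (measurableTypeR R).

Lemma mx_continuous_measurable (f : 'M[R]_(n, m) -> R) :
  continuous f -> measurable_fun setT (f : 'M[R]_(n, m) -> RT).
Proof.
move=> /continuousP cf; apply: (measurability _ (RGenOpens.measurableE R)).
move=> _ [_ [a [b ->] <-]]; rewrite setTI.
by apply: sub_sigma_algebra; exact/cf/interval_open.
Qed.

(** The one-sided estimate suffices since A and B may be exchanged. *)
Lemma mx_lipschitz_continuous (f : 'M[R]_(n, m) -> R) (K : R) :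
  (forall A B, f A <= f B + K * `|A - B|) -> continuous f.
Proof.
move=> fK A; apply/(@cvgrPdist_le _ _ _ (nbhs A) (nbhs_filter A)) => e e0.
have K1 : 0 < `|K| + 1 by rewrite ltr_wpDl.
have eK : 0 < e / (`|K| + 1) by rewrite divr_gt0.
apply: filterS (nbhsx_ballx A _ eK) => B; rewrite -ball_normE /= => /ltW AB.
have h : `|K| * `|A - B| <= e.
  have : (`|K| + 1) * `|A - B| <= e by rewrite mulrC -ler_pdivlMr.
  by rewrite mulrDl mul1r; apply: le_trans; rewrite lerDl.
have h' : K * `|A - B| <= `|K| * `|A - B| by rewrite ler_wpM2r// ler_norm.
have := fK A B; have := fK B A; rewrite (distrC B) ler_norml => h1 h2.
by apply/andP; split; lra.
Qed.

Lemma mx_lipschitz_measurable (f : 'M[R]_(n, m) -> R) (K : R) :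
  (forall A B, f A <= f B + K * `|A - B|) ->
  measurable_fun setT (f : 'M[R]_(n, m) -> RT).
Proof. by move=> /mx_lipschitz_continuous/mx_continuous_measurable. Qed.

Lemma mx_norm_coef (A : 'M[R]_(n, m)) i j : `|A i j| <= `|A|.
Proof.
rewrite [leRHS]/Num.norm/= mx_normrE.
exact: (@le_bigmax _ _ _ 0 (fun k : 'I_n * 'I_m => `|A k.1 k.2|) (i, j)).
Qed.

Lemma measurable_mxdot (M : 'M[R]_(n, m)) :
  measurable_fun setT ((fun A => mxdot A M) : 'M[R]_(n, m) -> RT).
Proof.
apply: (@mx_lipschitz_measurable _ (\sum_i \sum_j `|M i j|)) => A B.
rewrite -lerBlDl -mxdotBl mulr_suml; apply: ler_sum => i _.
rewrite mulr_suml; apply: ler_sum => j _.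
apply: (le_trans (ler_norm _)); rewrite normrM mulrC.
by rewrite ler_wpM2l// mx_norm_coef.
Qed.

End lipschitz.

Section bridge.
Context {R : realType} {S : Type}.
Notation RT := (measurableTypeR R).
Local Notation N01 := (@normal_prob R 0 1).
Local Open Scope ereal_scope.

(** Fubini, one coordinate at a time. *)
Lemma integral_gaussian_tuple p (b : 'I_p -> S -> R) Phi u : functional Phi ->
  \int[gaussian_tuple p]_t Phi (fun s => u s + \sum_i tnth t i * b i s)%R =
  gavgs [seq b i | i <- enum 'I_p] Phi u.
Proof.
move=> fPhi.
have mf q (c : 'I_q -> S -> R) : measurable_fun setT
    (fun t : q.-tuple RT => Phi (fun s => u s + \sum_i tnth t i * c i s)%R).
  apply: (fPhi.2 _ _ (fun s (t : q.-tuple RT) => u s + \sum_i tnth t i * c i s)%R).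
  move=> s; apply: measurable_funD => //; apply: measurable_sum => i.
  by apply: measurable_funM => //; exact: measurable_tnth.
elim: p b u mf => [|p IH] b u mf.
  rewrite enum_ord0 /= integral_dirac//; last exact: mf.
  rewrite -[RHS]mul1e; congr (_ * _); first by rewrite /dirac indicE mem_set.
  by congr Phi; apply/funext => s; rewrite big_ord0 addr0.
rewrite enum_ordSl /= ge0_integral_distribution; [|exact: mf|by move=> t; exact: fPhi.1].
rewrite fubini_tonelli1//; last 2 first.
- exact: (measurableT_comp (mf _ _) (measurable_tuple_cons (n := p))).
- by move=> p'; exact: fPhi.1.
apply: eq_integral => z _.
rewrite -map_comp -(IH (b \o lift ord0)); last first.
  move=> q c.
  apply: (fPhi.2 _ _ (fun s (t : q.-tuple RT) => u s + z * b ord0 s + \sum_i tnth t i * c i s)%R).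
  move=> s; apply: measurable_funD => //; apply: measurable_sum => i.
  by apply: measurable_funM => //; exact: measurable_tnth.
apply: eq_integral => t _; congr Phi; apply/funext => s /=.
rewrite big_ord_recl /= addrA; congr (_ + _)%R.
by apply: eq_bigr => i _; rewrite tnthS.
Qed.

(** The coefficient vectors of the process s |-> <G, M s>: entry number k of G
    contributes entry number k of M s. *)
Definition glist n m (M : S -> 'M[R]_(n, m)) : seq (S -> R) :=
  [seq (fun s => mxvec (M s) ord0 k) | k <- enum 'I_(n * m)].

Lemma glist_cov n m (M : S -> 'M[R]_(n, m)) s s' :
  (\sum_(a <- glist M) a s * a s' = mxdot (M s) (M s'))%R.
Proof. by rewrite big_map big_enum mxdot_vec. Qed.

Lemma integral_gaussian n m (M : S -> 'M[R]_(n, m)) Phi u : functional Phi ->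
  \int[gaussian n m]_A Phi (fun s => u s + mxdot A (M s))%R =
  gavgs (glist M) Phi u.
Proof.
move=> fPhi; rewrite ge0_integral_distribution//; last 2 first.
- apply: (fPhi.2 _ _ (fun s A => u s + mxdot A (M s))%R) => s.
  apply: measurable_funD => //.
  exact: measurable_mxdot.
- by move=> A; exact: fPhi.1.
rewrite -integral_gaussian_tuple//.
apply: eq_integral => t _; congr Phi; apply/funext => s /=.
congr (_ + _)%R; rewrite mxdot_vec; apply: eq_bigr => k _.
by rewrite /tuple_mx vec_mxK mxE.
Qed.

End bridge.

(** * Gaussian integrals of almost quadratic functions *)

Section normal_bounds.
Context {R : realType}.
Notation RT := (measurableTypeR R).
Local Notation N01 := (@normal_prob R 0 1).
Local Open Scope ereal_scope.
Variables (h : RT -> \bar R) (A B D k : R).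
Hypotheses (mh : measurable_fun setT h) (h0 : forall z, 0 <= h z) (D0 : (0 <= D)%R).

Let M : R := (`|A| + `|B|)%R.
Let M0 : (0 <= M)%R. Proof. by rewrite addr_ge0. Qed.
Let AM : (0 <= A + M)%R.
Proof. by rewrite /M; have := ler_norm (- A)%R; rewrite normrN; have := normr_ge0 B; lra. Qed.
Let BM : (0 <= B + M)%R.
Proof. by rewrite /M; have := ler_norm (- B)%R; rewrite normrN; have := normr_ge0 A; lra. Qed.

Let msq : measurable_fun [set: RT] (fun z : RT => ((z : R) ^+ 2)%:E).
Proof. by apply/measurable_EFinP; exact: measurable_funX. Qed.

Let mabs : measurable_fun [set: RT] (fun z : RT => (expR (k * `|z|))%:E).
Proof.
apply/measurable_EFinP/measurableT_comp => //.
by apply: measurable_funM => //; exact: measurableT_comp.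
Qed.

Let sq0 (z : RT) : 0 <= ((z : R) ^+ 2)%:E. Proof. by rewrite lee_fin sqr_ge0. Qed.

Let hs z := h z + h (- z)%R.

Let mhs : measurable_fun setT hs.
Proof. by apply: emeasurable_funD => //; exact: measurableT_comp. Qed.

Let hs0 z : 0 <= hs z. Proof. exact: adde_ge0. Qed.

Let int_hs : \int[N01]_z hs z = 2%:E * \int[N01]_z h z.
Proof.
rewrite ge0_integralD//; last exact: measurableT_comp.
by rewrite (normal_symm mh)// -[2%R]/(1 + 1)%R EFinD ge0_muleDl// !mul1e.
Qed.

Let int_exp : \int[N01]_z ((D * 2)%:E * (expR (k * `|z|))%:E) <=
  (2 * (2 * D * expR (k ^+ 2 / 2)))%:E.
Proof.
rewrite ge0_integralZl//; last by rewrite lee_fin mulr_ge0.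
rewrite [leRHS](_ : _ = (D * 2)%:E * (2 * expR (k ^+ 2 / 2))%:E); last first.
  by rewrite -EFinM; congr EFin; ring.
by rewrite lee_wpmul2l ?normal_expabs_le// lee_fin mulr_ge0.
Qed.

Let int_quad (a b : R) : (0 <= a)%R -> (0 <= b)%R ->
  \int[N01]_z (a%:E + b%:E * ((z : R) ^+ 2)%:E) = (a + b)%:E.
Proof. by move=> a0 b0; rewrite integral_affine// normal_sqr mule1. Qed.

Let M2 : (0 <= 2 * M)%R. Proof. by rewrite mulr_ge0. Qed.

Let quad0 (a b : R) (z : RT) : (0 <= a)%R -> (0 <= b)%R ->
  0 <= a%:E + b%:E * ((z : R) ^+ 2)%:E.
Proof. by move=> a0 b0; rewrite adde_ge0// mule_ge0. Qed.

Let mquad (a b : R) : measurable_fun setT (fun z : RT => a%:E + b%:E * ((z : R) ^+ 2)%:E).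
Proof. by apply: emeasurable_funD => //; exact: measurable_funeM. Qed.

(** Only the even part of h matters, since z and - z have the same law; the
    first-order terms of a Taylor expansion cancel there. A and B may be negative,
    hence the shift by M that keeps all integrands nonnegative. *)
Lemma normal_quad_le :
  (forall z : R, h z + h (- z)%R <= (2 * (A + B * z ^+ 2 + D * expR (k * `|z|)))%:E) ->
  \int[N01]_z h z <= (A + B + 2 * D * expR (k ^+ 2 / 2))%:E.
Proof.
move=> hle.
have : \int[N01]_z (hs z + ((2 * M)%:E + (2 * M)%:E * ((z : R) ^+ 2)%:E)) <=
    \int[N01]_z ((2 * (A + M))%:E + (2 * (B + M))%:E * ((z : R) ^+ 2)%:E +
       (D * 2)%:E * (expR (k * `|z|))%:E).
  apply: ge0_le_integral => //.
  - by move=> z _; apply: adde_ge0 => //; exact: quad0.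
  - by apply: emeasurable_funD => //; exact: mquad.
  - by apply: emeasurable_funD; [exact: mquad|exact: measurable_funeM].
  - move=> z _; apply: (le_trans (leeD2r _ (hle z))).
    rewrite -!EFinM -!EFinD lee_fin; lra.
rewrite ge0_integralD//; last by move=> z _; exact: quad0.
rewrite int_quad// [X in _ <= X]ge0_integralD//; last 3 first.
- by move=> z _; apply: quad0; rewrite mulr_ge0.
- by move=> z _; rewrite mule_ge0// lee_fin ?mulr_ge0 ?expR_ge0.
- exact: measurable_funeM.
rewrite int_quad ?mulr_ge0// int_hs => H.
have {}H := le_trans H (leeD2l _ int_exp).
have I0 : 0 <= \int[N01]_z h z by exact: integral_ge0.
move: H I0.
case: (\int[N01]_z h z) => [r| |]//.
  rewrite -!EFinM -!EFinD !lee_fin => H _; lra.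
by rewrite gt0_muley ?lte_fin// -EFinD.
Qed.

Lemma normal_quad_ge :
  (forall z : R, (2 * (A + B * z ^+ 2 - D * expR (k * `|z|)))%:E <= h z + h (- z)%R) ->
  (A + B - 2 * D * expR (k ^+ 2 / 2))%:E <= \int[N01]_z h z.
Proof.
move=> hle.
have : \int[N01]_z ((2 * (A + M))%:E + (2 * (B + M))%:E * ((z : R) ^+ 2)%:E) <=
  \int[N01]_z (hs z + ((2 * M)%:E + (2 * M)%:E * ((z : R) ^+ 2)%:E) +
       (D * 2)%:E * (expR (k * `|z|))%:E).
  apply: ge0_le_integral => //.
  - by move=> z _; apply: quad0; rewrite mulr_ge0.
  - apply: emeasurable_funD; last exact: measurable_funeM.
    by apply: emeasurable_funD => //; exact: mquad.
  - move=> z _; rewrite -addeA.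
    apply: (le_trans _ (leeD2r _ (hle z))).
    rewrite -!EFinM -!EFinD lee_fin; lra.
rewrite int_quad ?mulr_ge0// ge0_integralD//; last 4 first.
- by move=> z _; apply: adde_ge0 => //; exact: quad0.
- exact: emeasurable_funD.
- by move=> z _; rewrite mule_ge0// lee_fin ?mulr_ge0 ?expR_ge0.
- exact: measurable_funeM.
rewrite ge0_integralD//; last by move=> z _; exact: quad0.
rewrite int_quad// int_hs => H.
have {}H := le_trans H (leeD2l _ int_exp).
have I0 : 0 <= \int[N01]_z h z by exact: integral_ge0.
move: H I0.
case: (\int[N01]_z h z) => [r| |]; rewrite ?leey//.
rewrite -!EFinM -!EFinD !lee_fin => H _; lra.
Qed.

End normal_bounds.

(** * Second-order expansions and log-sum-exp *)

Section expands.
Context {R : realType} {S : finType}.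
Implicit Types (u v w a : S -> R) (f g : (S -> R) -> R).
Implicit Types (ell q : (S -> R) -> (S -> R) -> R).

Definition norm1 v : R := \sum_s `|v s|.

Lemma norm1_ge0 v : 0 <= norm1 v. Proof. exact: sumr_ge0. Qed.

Lemma norm1Z (e : R) v : norm1 (fun s => e * v s) = `|e| * norm1 v.
Proof. by rewrite /norm1 mulr_sumr; apply: eq_bigr => s _; rewrite normrM. Qed.

Lemma norm1D v w : norm1 (fun s => v s + w s) <= norm1 v + norm1 w.
Proof. by rewrite -big_split; apply: ler_sum => s _; exact: ler_normD. Qed.

(** f has at every point a second-order Taylor expansion ell + q / 2 whose terms
    are bounded by powers of C |v|, with C independent of the point. Only the
    properties of ell and q that a Gaussian average uses are recorded: ell is
    linear along lines, and q is homogeneous and satisfies the parallelogram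
    identity. *)
Record expands f ell q (C : R) : Prop := Expands {
  expands_ge0 : 0 <= C ;
  expands_inc : forall u v, `|f (fun s => u s + v s) - f u| <= C * norm1 v ;
  expands_lin : forall u v, `|ell u v| <= C * norm1 v ;
  expands_quad : forall u v, `|q u v| <= (C * norm1 v) ^+ 2 ;
  expands_rem : forall u v,
    `|f (fun s => u s + v s) - f u - (ell u v + q u v / 2)| <= (C * norm1 v) ^+ 3 ;
  expands_ellD : forall u w a (z : R),
    ell u (fun s => w s + z * a s) = ell u w + z * ell u a ;
  expands_ellZ : forall u w (e : R), ell u (fun s => e * w s) = e * ell u w ;
  expands_qpar : forall u w a (z : R),
    q u (fun s => w s + z * a s) + q u (fun s => w s + - z * a s) =
    2 * q u w + 2 * z ^+ 2 * q u a ;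
  expands_qZ : forall u w (e : R), q u (fun s => e * w s) = e ^+ 2 * q u w }.

Lemma expands_coord (b : R) s :
  expands (fun u => b * u s) (fun u v => b * v s) (fun _ _ => 0) `|b|.
Proof.
have le v : `|v s| <= norm1 v by rewrite /norm1 (bigD1 s)//= lerDl sumr_ge0.
split=> //.
- by move=> u v; rewrite -mulrBr addrAC subrr add0r normrM ler_wpM2l.
- by move=> u v; rewrite normrM ler_wpM2l.
- by move=> u v; rewrite normr0 sqr_ge0.
- move=> u v; rewrite (_ : _ - _ = 0) ?normr0; last by ring.
  by rewrite exprn_ge0// mulr_ge0// norm1_ge0.
- by move=> u w a z; ring.
- by move=> u w e; ring.
- by move=> *; ring.
- by move=> *; ring.
Qed.

Lemma expandsZ (r : R) f ell q C : expands f ell q C ->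
  expands (fun u => r * f u) (fun u v => r * ell u v) (fun u v => r * q u v)
    ((1 + `|r|) * C).
Proof.
move=> H; have C0 := expands_ge0 H.
have r1 : 1 <= 1 + `|r| by rewrite lerDl.
have x0 v : 0 <= C * norm1 v by rewrite mulr_ge0// norm1_ge0.
have rr : `|r| <= 1 + `|r| by rewrite lerDr.
have rk k : `|r| <= (1 + `|r|) ^+ k.+1.
  by rewrite (le_trans rr)// exprS ler_peMr ?(le_trans ler01)// exprn_ege1.
split.
- by rewrite mulr_ge0// (le_trans ler01).
- move=> u v; rewrite -mulrBr normrM -mulrA ler_pM//; exact: (expands_inc H).
- move=> u v; rewrite normrM -mulrA ler_pM//; exact: (expands_lin H).
- move=> u v; rewrite normrM -mulrA exprMn ler_pM ?rk//; exact: (expands_quad H).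
- move=> u v; rewrite (_ : _ - _ =
    r * (f (fun s => u s + v s) - f u - (ell u v + q u v / 2))); last by field.
  rewrite normrM -mulrA exprMn ler_pM ?rk//; exact: (expands_rem H).
- by move=> u w a z; rewrite (expands_ellD H); ring.
- by move=> u w e; rewrite (expands_ellZ H); ring.
- by move=> u w a z; rewrite -mulrDr (expands_qpar H); ring.
- by move=> u w e; rewrite (expands_qZ H); ring.
Qed.

Lemma expandsD f g ell ell' q q' C C' :
  expands f ell q C -> expands g ell' q' C' ->
  expands (fun u => f u + g u) (fun u v => ell u v + ell' u v)
     (fun u v => q u v + q' u v) (C + C').
Proof.
move=> H H'; have C0 := expands_ge0 H; have C0' := expands_ge0 H'.
have x0 v : 0 <= C * norm1 v by rewrite mulr_ge0// norm1_ge0.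
have x0' v : 0 <= C' * norm1 v by rewrite mulr_ge0// norm1_ge0.
split.
- exact: addr_ge0.
- move=> u v; rewrite mulrDl (_ : _ + _ = (f (fun s => u s + v s) - f u) + (g (fun s => u s + v s) - g u)); last by ring.
  by rewrite (le_trans (ler_normD _ _))// lerD//; [exact: (expands_inc H)|exact: (expands_inc H')].
- by move=> u v; rewrite mulrDl (le_trans (ler_normD _ _))// lerD//; [exact: (expands_lin H)|exact: (expands_lin H')].
- move=> u v; rewrite mulrDl (le_trans (ler_normD _ _))//.
  have := expands_quad H u v; have := expands_quad H' u v.
  by have := x0 v; have := x0' v; nra.
- move=> u v; rewrite (_ : _ - _ =
    (f (fun s => u s + v s) - f u - (ell u v + q u v / 2)) +
    (g (fun s => u s + v s) - g u - (ell' u v + q' u v / 2))); last by field.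
  rewrite mulrDl (le_trans (ler_normD _ _))//.
  apply: (le_trans (lerD (expands_rem H u v) (expands_rem H' u v))).
  move: (x0 v) (x0' v); move: (C * _) (C' * _) => x y x1 y1.
  have : 0 <= x * y * (x + y) by rewrite !mulr_ge0// addr_ge0.
  by nra.
- by move=> u w a z; rewrite (expands_ellD H) (expands_ellD H'); ring.
- by move=> u w e; rewrite (expands_ellZ H) (expands_ellZ H'); ring.
- move=> u w a z; have := expands_qpar H u w a z; have := expands_qpar H' u w a z.
  by lra.
- by move=> u w e; rewrite (expands_qZ H) (expands_qZ H'); ring.
Qed.

End expands.

Section lse_core.
Context {R : realType}.

Lemma expR1_le4 : expR 1 <= 4 :> R.
Proof.
have e2 : expR 1 = expR (2^-1) ^+ 2 :> R by rewrite -expRM_natl; congr expR; field.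
have h2 : expR (2^-1) <= 1 + 2^-1 * expR (2^-1) :> R.
  by apply: expR_le_lin; rewrite invr_ge0.
have h0 := expR_gt0 (2^-1 : R).
rewrite e2; nra.
Qed.

Lemma ln_le_sub1 (x : R) : 0 < x -> ln x <= x - 1.
Proof. by move=> x0; have := @le_ln1Dx R (x - 1); rewrite subrKC; apply; lra. Qed.

(** The logarithm is Lipschitz away from 0; the constants are crude and suit
    arguments with |ln S| <= 1 and |T| <= 3. *)
Lemma ln_sub_le (S T y : R) : expR (-1) <= S -> - 3 <= T ->
  `|S - expR T| <= y -> `|ln S - T| <= 64 * y.
Proof.
move=> S1 T3 Sy.
have e4 := expR1_le4; have e0 := expR_gt0 (1 : R).
have S4 : 1 / 4 <= S.
  apply: le_trans S1; rewrite expRN div1r lef_pV2 ?posrE//.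
have S0 : 0 < S by lra.
have eT : expR (- T) <= 64.
  apply: (@le_trans _ _ (expR (3%:R * 1))); first by rewrite ler_expR; lra.
  by rewrite expRM_natl; have := ltW e0; nra.
have eT0 := expR_gt0 (- T).
have eNT : expR (- T) * expR T = 1 by rewrite -expRD addNr expR0.
have y0 : 0 <= y by apply: le_trans Sy.
move: Sy; rewrite ler_norml => /andP[Sy1 Sy2].
rewrite ler_norml; apply/andP; split.
  have : ln (expR T * S^-1) <= expR T * S^-1 - 1.
    by apply: ln_le_sub1; rewrite mulr_gt0 ?invr_gt0 ?expR_gt0.
  rewrite lnM ?posrE ?invr_gt0 ?expR_gt0// expRK lnV ?posrE// => h.
  have : expR T * S^-1 - 1 <= 4 * y.
    rewrite lerBlDr ler_pdivrMr//.
    have : 0 <= (S - 1 / 4) * y by rewrite mulr_ge0// subr_ge0.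
    by lra.
  by lra.
have : ln (S * expR (- T)) <= S * expR (- T) - 1.
  by apply: ln_le_sub1; rewrite mulr_gt0 ?expR_gt0.
rewrite lnM ?posrE ?expR_gt0// expRK => h.
have : S * expR (- T) - 1 <= 64 * y.
  have : 0 <= expR (- T) * (y - (S - expR T)) by apply: mulr_ge0; [exact: ltW|lra].
  have : 0 <= (64 - expR (- T)) * y by apply: mulr_ge0 => //; lra.
  by lra.
by lra.
Qed.

Section core.
Context {I : finType}.
Variables (p d e q : I -> R) (x : R).
Hypotheses (p0 : forall i, 0 <= p i) (p1 : \sum_i p i = 1) (x0 : 0 <= x).
Hypotheses (dx : forall i, `|d i| <= x) (ex : forall i, `|e i| <= x).
Hypothesis qx : forall i, `|q i| <= x ^+ 2.
Hypothesis rx : forall i, `|d i - (e i + q i / 2)| <= x ^+ 3.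

Let L := \sum_i p i * e i.
Let Q := \sum_i p i * (q i + e i ^+ 2) - L ^+ 2.
Let Z := \sum_i p i * expR (d i).

Lemma avg_le (y : I -> R) (b : R) : (forall i, y i <= b) -> \sum_i p i * y i <= b.
Proof.
move=> yb; rewrite -[leRHS]mul1r -p1 mulr_suml.
by apply: ler_sum => i _; rewrite ler_wpM2l.
Qed.

Lemma avg_ge (y : I -> R) (b : R) : (forall i, b <= y i) -> b <= \sum_i p i * y i.
Proof.
move=> yb; rewrite -[leLHS]mul1r -p1 mulr_suml.
by apply: ler_sum => i _; rewrite ler_wpM2l.
Qed.

Lemma avg_norm (y : I -> R) (b : R) : (forall i, `|y i| <= b) ->
  `|\sum_i p i * y i| <= b.
Proof.
move=> yb; rewrite ler_norml avg_le ?avg_ge// => i;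
  by have := yb i; rewrite ler_norml => /andP[].
Qed.

Lemma lse_inc_core : `|ln Z| <= x.
Proof.
have Z1 : expR (- x) <= Z.
  by apply: avg_ge => i; rewrite ler_expR; have := dx i; rewrite ler_norml => /andP[].
have Z2 : Z <= expR x.
  by apply: avg_le => i; rewrite ler_expR; have := dx i; rewrite ler_norml => /andP[].
have Z0 : 0 < Z by apply: lt_le_trans Z1; exact: expR_gt0.
rewrite ler_norml; apply/andP; split.
  by rewrite -[leLHS]expRK ler_ln ?posrE ?expR_gt0.
by rewrite -[leRHS]expRK ler_ln ?posrE ?expR_gt0.
Qed.

Lemma lse_lin_core : `|L| <= x. Proof. exact: avg_norm. Qed.

Lemma lse_quad_core : `|Q| <= 3 * x ^+ 2.
Proof.
have h1 : `|\sum_i p i * (q i + e i ^+ 2)| <= 2 * x ^+ 2.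
  apply: avg_norm => i; rewrite mulr_natl mulr2n.
  apply: (le_trans (ler_normD _ _)); apply: lerD => //.
  by rewrite normrX; have := ex i; have := normr_ge0 (e i); nra.
have h2 : `|L ^+ 2| <= x ^+ 2.
  by rewrite normrX; have := lse_lin_core; have := normr_ge0 L; nra.
apply: (le_trans (ler_normB _ _)); lra.
Qed.

(** Here d i is the increment of the exponent number i, with expansion e i + q i /
    2, and ln Z is the increment of log-sum-exp. For x >= 1 the bounds on each
    term suffice. For x <= 1 the quantities Z and exp (L + Q / 2) agree with 1 + L
    + (Q + L ^ 2) / 2 up to O (x ^ 3), and the logarithm is Lipschitz there. *)
Lemma lse_rem_core : `|ln Z - (L + Q / 2)| <= (100 * x) ^+ 3.
Proof.
have x3 : 0 <= x ^+ 3 by rewrite exprn_ge0.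
have hL := lse_lin_core; have hQ := lse_quad_core; have hZ := lse_inc_core.
have nT : `|L + Q / 2| <= x + 3 / 2 * x ^+ 2.
  apply: (le_trans (ler_normD _ _)); rewrite normrM (ger0_norm (_ : 0 <= 2^-1))//.
  lra.
(* for large increments the third power dominates all terms *)
have [x1|/ltW x1] := leP 1 x.
  apply: (le_trans (ler_normB _ _)).
  have : x ^+ 2 <= x ^+ 3 by rewrite (exprSr x 2) ler_peMr// sqr_ge0.
  have : x <= x ^+ 2 by rewrite expr2 ler_peMr.
  rewrite exprMn; lra.
have x2 : x ^+ 2 <= x by rewrite expr2 ler_piMl.
have x20 : 0 <= x ^+ 2 by rewrite sqr_ge0.
have x32 : x ^+ 3 <= x ^+ 2 by rewrite (exprSr x 2) ler_piMr.
have e4 := expR1_le4; have e0 := expR_gt0 (1 : R).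
have Z1 : expR (-1) <= Z.
  apply: avg_ge => i; rewrite ler_expR; have := dx i; rewrite ler_norml => /andP[].
  lra.
have T3 : `|L + Q / 2| <= 5 / 2 * x by lra.
rewrite exprMn.
apply: (@le_trans _ _ (64 * (1100 * x ^+ 3))); last by lra.
apply: ln_sub_le => //.
  by move: T3; rewrite ler_norml => /andP[]; lra.
have hd i : `|expR (d i) - (1 + e i + (q i + e i ^+ 2) / 2)| <= 10 * x ^+ 3.
  have t1 : `|expR (d i) - (1 + d i + d i ^+ 2 / 2)| <= 4 * x ^+ 3.
    apply: (le_trans (expR_taylor2 _)); rewrite mulrC.
    apply: ler_pM; rewrite ?expR_ge0 ?exprn_ge0//.
      by rewrite (le_trans _ e4)// ler_expR (le_trans (dx i)).
    by rewrite lerXn2r ?nnegrE.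
  have t2 : `|d i - e i| <= 3 / 2 * x ^+ 2.
    rewrite (_ : d i - e i = (d i - (e i + q i / 2)) + q i / 2); last by field.
    apply: (le_trans (ler_normD _ _)).
    rewrite normrM (ger0_norm (_ : 0 <= 2^-1))//.
    by have := rx i; have := qx i; lra.
  have t3 : `|d i ^+ 2 - e i ^+ 2| <= 3 * x ^+ 3.
    rewrite subr_sqr normrM (_ : 3 * x ^+ 3 = (3 / 2 * x ^+ 2) * (2 * x)); last by field.
    apply: ler_pM => //; apply: (le_trans (ler_normD _ _)).
    by have := dx i; have := ex i; lra.
  rewrite (_ : _ - _ = (expR (d i) - (1 + d i + d i ^+ 2 / 2)) +
    ((d i - (e i + q i / 2)) + (d i ^+ 2 - e i ^+ 2) / 2)); last by field.
  apply: (le_trans (ler_normD _ _)).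
  have := ler_normD (d i - (e i + q i / 2)) ((d i ^+ 2 - e i ^+ 2) / 2).
  rewrite [`|_ / 2|]normrM (ger0_norm (_ : 0 <= 2^-1))//.
  by have := rx i; lra.
have hZ' : `|Z - (1 + L + (Q + L ^+ 2) / 2)| <= 10 * x ^+ 3.
  have -> : Z - (1 + L + (Q + L ^+ 2) / 2) =
     \sum_i p i * (expR (d i) - (1 + e i + (q i + e i ^+ 2) / 2)).
    transitivity (Z - (\sum_i p i + L + (\sum_i p i * (q i + e i ^+ 2)) / 2)).
      by rewrite /Q subrK p1.
    rewrite /L /Z mulr_suml -!big_split -sumrB /=.
    by apply: eq_bigr => i _; field.
  exact: avg_norm.
have hT : `|expR (L + Q / 2) - (1 + (L + Q / 2) + (L + Q / 2) ^+ 2 / 2)| <= 1024 * x ^+ 3.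
  apply: (le_trans (expR_taylor2 _)).
  apply: (@le_trans _ _ ((5 / 2 * x) ^+ 3 * 64)); last by rewrite exprMn; lra.
  apply: ler_pM; rewrite ?expR_ge0 ?exprn_ge0//.
    by rewrite lerXn2r ?nnegrE// (le_trans _ T3).
  apply: (@le_trans _ _ (expR (3%:R * 1))); first by rewrite ler_expR; lra.
  by rewrite expRM_natl; have := ltW e0; nra.
have hTL : `|(L + Q / 2) ^+ 2 - L ^+ 2| <= 6 * x ^+ 3.
  rewrite subr_sqr normrM (_ : 6 * x ^+ 3 = (3 / 2 * x ^+ 2) * (4 * x)); last by field.
  apply: ler_pM => //.
    rewrite (_ : _ - _ = Q / 2); last by ring.
    by rewrite normrM (ger0_norm (_ : 0 <= 2^-1))//; lra.
  by apply: (le_trans (ler_normD _ _)); lra.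
rewrite (_ : _ - _ = (Z - (1 + L + (Q + L ^+ 2) / 2)) -
   (expR (L + Q / 2) - (1 + (L + Q / 2) + (L + Q / 2) ^+ 2 / 2)) -
   ((L + Q / 2) ^+ 2 - L ^+ 2) / 2); last by field.
apply: (le_trans (ler_normB _ _)).
have := ler_normB (Z - (1 + L + (Q + L ^+ 2) / 2))
   (expR (L + Q / 2) - (1 + (L + Q / 2) + (L + Q / 2) ^+ 2 / 2)).
rewrite [`|_ / 2|]normrM (ger0_norm (_ : 0 <= 2^-1))//.
by lra.
Qed.

End core.
End lse_core.

Section lse.
Context {R : realType} {S I : finType}.
Variable i0 : I.
Implicit Types (u v w a : S -> R).

Definition lse (x : I -> R) : R := ln (\sum_i expR (x i)).

Definition softmax (x : I -> R) i : R := expR (x i) / \sum_j expR (x j).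

Lemma sum_expR_gt0 (x : I -> R) : 0 < \sum_i expR (x i).
Proof.
rewrite (bigD1 i0)//= ltr_pwDl ?expR_gt0//.
by apply: sumr_ge0 => i _; exact: expR_ge0.
Qed.

Lemma expR_lse (x : I -> R) : expR (lse x) = \sum_i expR (x i).
Proof. by rewrite lnK// posrE sum_expR_gt0. Qed.

Lemma softmax_ge0 (x : I -> R) i : 0 <= softmax x i.
Proof. by rewrite divr_ge0 ?expR_ge0// ltW// sum_expR_gt0. Qed.

Lemma softmax_sum1 (x : I -> R) : \sum_i softmax x i = 1.
Proof. by rewrite -mulr_suml divff// gt_eqF// sum_expR_gt0. Qed.

(** An increment of log-sum-exp is the logarithm of an average of exponentials
    with softmax weights, which makes all bounds independent of the base point and
    of the number of terms. *)
Lemma lse_sub (x y : I -> R) :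
  lse y - lse x = ln (\sum_i softmax x i * expR (y i - x i)).
Proof.
rewrite /lse -lnV ?posrE ?sum_expR_gt0// -lnM ?posrE ?invr_gt0 ?sum_expR_gt0//.
congr ln; rewrite mulr_suml; apply: eq_bigr => i _.
by rewrite /softmax mulrAC -expRD addrC subrK.
Qed.

Lemma expands_lse (f : I -> (S -> R) -> R) (ell q : I -> (S -> R) -> (S -> R) -> R) C :
  (forall i, expands (f i) (ell i) (q i) C) ->
  let p u := softmax (f ^~ u) in
  let L u v := \sum_i p u i * ell i u v in
  expands (fun u => lse (f ^~ u)) L
    (fun u v => \sum_i p u i * (q i u v + ell i u v ^+ 2) - L u v ^+ 2)
    (100 * C).
Proof.
move=> H p L; have C0 := expands_ge0 (H i0).
have x0 v : 0 <= C * norm1 v by rewrite mulr_ge0// norm1_ge0.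
have p0 u i : 0 <= p u i by exact: softmax_ge0.
have p1 u : \sum_i p u i = 1 by exact: softmax_sum1.
have LD u w a z : L u (fun s => w s + z * a s) = L u w + z * L u a.
  rewrite /L mulr_sumr -big_split/=; apply: eq_bigr => i _.
  by rewrite (expands_ellD (H i))/=; ring.
have LZ u w e : L u (fun s => e * w s) = e * L u w.
  by rewrite /L mulr_sumr; apply: eq_bigr => i _; rewrite (expands_ellZ (H i)); ring.
split => //.
- by rewrite mulr_ge0.
- move=> u v; rewrite lse_sub -mulrA.
  apply: le_trans (_ : C * norm1 v <= _); last by rewrite ler_peMl// ler1n.
  by apply: (lse_inc_core (p0 u) (p1 u)) => // i; exact: (expands_inc (H i)).
- move=> u v; rewrite -mulrA.
  apply: le_trans (_ : C * norm1 v <= _); last by rewrite ler_peMl// ler1n.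
  by apply: (lse_lin_core (p0 u) (p1 u)) => // i; exact: (expands_lin (H i)).
- move=> u v; rewrite -mulrA.
  apply: le_trans (_ : 3 * (C * norm1 v) ^+ 2 <= _); last first.
    by move: (C * norm1 v) => y; rewrite exprMn; have := sqr_ge0 y; lra.
  by apply: (lse_quad_core (p0 u) (p1 u)) => // i;
    [exact: (expands_lin (H i))|exact: (expands_quad (H i))].
- move=> u v; rewrite lse_sub -mulrA.
  by apply: (lse_rem_core (p0 u) (p1 u)) => // i;
    [exact: (expands_inc (H i))|exact: (expands_lin (H i))|
     exact: (expands_quad (H i))|exact: (expands_rem (H i))].
- move=> u w a z; rewrite !LD addrACA.
  have -> : \sum_i p u i * (q i u (fun s => w s + z * a s) +
        ell i u (fun s => w s + z * a s) ^+ 2) +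
      \sum_i p u i * (q i u (fun s => w s + - z * a s) +
        ell i u (fun s => w s + - z * a s) ^+ 2) =
      2 * (\sum_i p u i * (q i u w + ell i u w ^+ 2)) +
      2 * z ^+ 2 * (\sum_i p u i * (q i u a + ell i u a ^+ 2)); last first.
    by ring.
  rewrite !mulr_sumr -!big_split/=; apply: eq_bigr => i _.
  rewrite -mulrDr addrACA (expands_qpar (H i)) !(expands_ellD (H i)); ring.
- move=> u w e; rewrite LZ exprMn mulrBr mulr_sumr; congr (_ - _).
  apply: eq_bigr => i _; rewrite (expands_qZ (H i)) (expands_ellZ (H i)); ring.
Qed.

End lse.

(** * Comparison of Gaussian vectors *)

Section gaussian_comparison.
Context {R : realType} {S : finType}.
Implicit Types (u v w a : S -> R) (l : seq (S -> R)).
Variables (f : (S -> R) -> R) (ell q : (S -> R) -> (S -> R) -> R) (C : R).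
Hypothesis fexp : expands f ell q C.
Let F u : R := expR (f u).
Let Phi u : \bar R := (F u)%:E.
Hypothesis fPhi : functional Phi.

(** The second derivative of exp f divided by exp f. *)
Definition hess u v : R := q u v + ell u v ^+ 2.

Let C0 : 0 <= C := expands_ge0 fexp.
Let x0 v : 0 <= C * norm1 v. Proof. by rewrite mulr_ge0// norm1_ge0. Qed.
Let F0 u : 0 < F u. Proof. exact: expR_gt0. Qed.

Lemma exp_expands u v : `|F (fun s => u s + v s) - F u * (1 + ell u v + hess u v / 2)| <=
  F u * (3 * (C * norm1 v) ^+ 3 * expR (C * norm1 v)).
Proof.
have -> : F (fun s => u s + v s) = F u * expR (f (fun s => u s + v s) - f u).
  by rewrite -expRD addrC subrK.
rewrite -mulrBr normrM (gtr0_norm (F0 u)) ler_pM2l//.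
have := expands_inc fexp u v; have := expands_lin fexp u v.
have := expands_rem fexp u v; have := expands_quad fexp u v.
rewrite /hess; move: (f _ - f u) (ell u v) (q u v) (C * norm1 v) (x0 v) => d e p x x_0.
move=> px rx ex dx.
have x3 : 0 <= x ^+ 3 by rewrite exprn_ge0.
have ex1 : 1 + x <= expR x by exact: expR_ge1Dx.
have t1 : `|expR d - (1 + d + d ^+ 2 / 2)| <= x ^+ 3 * expR x.
  apply: (le_trans (expR_taylor2 _)).
  by apply: ler_pM; rewrite ?expR_ge0 ?exprn_ge0 ?ler_expR// lerXn2r ?nnegrE.
have t2 : `|d - e| <= x ^+ 2 / 2 + x ^+ 3.
  rewrite (_ : d - e = (d - (e + p / 2)) + p / 2); last by field.
  apply: (le_trans (ler_normD _ _)).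
  by rewrite normrM (ger0_norm (_ : 0 <= 2^-1))//; lra.
have t3 : `|d ^+ 2 - e ^+ 2| <= (x ^+ 2 / 2 + x ^+ 3) * (2 * x).
  rewrite subr_sqr normrM; apply: ler_pM => //.
  by apply: (le_trans (ler_normD _ _)); lra.
rewrite (_ : _ - _ = (expR d - (1 + d + d ^+ 2 / 2)) +
    ((d - (e + p / 2)) + (d ^+ 2 - e ^+ 2) / 2)); last by field.
apply: (le_trans (ler_normD _ _)).
have := ler_normD (d - (e + p / 2)) ((d ^+ 2 - e ^+ 2) / 2).
rewrite [`|_ / 2|]normrM (ger0_norm (_ : 0 <= 2^-1))// => h.
have : 0 <= x ^+ 3 * (expR x - (1 + x)) by rewrite mulr_ge0// subr_ge0.
have : 0 <= x ^+ 3 * x by rewrite mulr_ge0.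
by lra.
Qed.

Let hess_par u w a (z : R) :
  hess u (fun s => w s + z * a s) + hess u (fun s => w s + - z * a s) =
  2 * hess u w + 2 * z ^+ 2 * hess u a.
Proof.
rewrite /hess addrACA (expands_qpar fexp) !(expands_ellD fexp); ring.
Qed.

Let hess_le u v : `|hess u v| <= 2 * (C * norm1 v) ^+ 2.
Proof.
rewrite /hess mulr_natl mulr2n (le_trans (ler_normD _ _))// lerD//.
  exact: (expands_quad fexp).
by rewrite normrX lerXn2r ?nnegrE// (expands_lin fexp).
Qed.

(** Induction on l. The extra displacement w is what makes the induction go
    through: a Gaussian step turns w into w + z a, the terms that are odd in z
    average out, E z ^ 2 = 1 produces the new term hess u a, and the error grows
    like the exponential of |z|. The error stays relative to F u. *)
Lemma gavgs_expands l : exists2 K : R, 0 <= K &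
  forall u w (e : R), 0 <= e <= 1 ->
  let A := F u * (1 + e * ell u w + e ^+ 2 / 2 * (hess u w + \sum_(a <- l) hess u a)) in
  let B := e ^+ 3 * K * expR (2 * C * norm1 w) * F u in
  ((A - B)%:E <= gavgs (dilate e l) Phi (fun s => u s + e * w s)%R <= (A + B)%:E)%E.
Proof.
elim: l => [|a l [K K0 IH]].
  exists 18 => // u w e /andP[e0 e1]; rewrite big_nil addr0 /= /Phi !lee_fin.
  rewrite -ler_distl.
  have E : 1 + e * ell u w + e ^+ 2 / 2 * hess u w =
      1 + ell u (fun s => e * w s) + hess u (fun s => e * w s) / 2.
    by rewrite /hess (expands_ellZ fexp) (expands_qZ fexp); field.
  rewrite E; apply: (le_trans (exp_expands u (fun s => e * w s))).
  rewrite mulrC ler_pM2r// norm1Z (ger0_norm e0).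
  move: (C * norm1 w) (x0 w) (mulrCA C e (norm1 w)) (mulrA 2 C (norm1 w)) => x x_0 -> <-.
  have e3 : 0 <= e ^+ 3 by rewrite exprn_ge0.
  have h1 := cube_le_expR x_0.
  have h2 : expR (e * x) <= expR x by rewrite ler_expR ler_piMl.
  have h3 : expR (2 * x) = expR x * expR x by rewrite -expRD; congr expR; ring.
  have h4 : x ^+ 3 * expR (e * x) <= 6 * expR x * expR x.
    by apply: ler_pM => //; rewrite ?exprn_ge0 ?expR_ge0.
  have := ler_wpM2l e3 h4; rewrite h3 exprMn; lra.
pose k := 2 * C * norm1 a.
exists (2 * K * expR (k ^+ 2 / 2)); first by rewrite !mulr_ge0 ?expR_ge0.
move=> u w e e01; have /andP[e0 e1] := e01.
rewrite /= big_cons.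
set T := \sum_(b <- l) hess u b.
pose A := F u * (1 + e * ell u w + e ^+ 2 / 2 * (hess u w + T)).
pose B := F u * (e ^+ 2 / 2 * hess u a).
pose D := e ^+ 3 * K * expR (2 * C * norm1 w) * F u.
have D0 : 0 <= D by rewrite !mulr_ge0 ?exprn_ge0 ?expR_ge0// ltW.
pose h (z : measurableTypeR R) := gavgs (dilate e l) Phi (fun s => u s + e * w s + z * (e * a s)).
have fg : functional (gavgs (dilate e l) Phi) by exact: functional_gavgs.
have mh : measurable_fun setT h by exact: (functional_line (fun s => e * a s) (fun s => u s + e * w s) fg).
have h0 z : (0 <= h z)%E by exact: fg.1.
have hE (z : R) : h z = gavgs (dilate e l) Phi (fun s => u s + e * (w s + z * a s)).
  by congr gavgs; apply/funext => s; ring.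
have nB (z : R) : e ^+ 3 * K * expR (2 * C * norm1 (fun s => w s + z * a s)) * F u <=
    D * expR (k * `|z|).
  have hE1 : expR (2 * C * norm1 (fun s => w s + z * a s)) <=
      expR (2 * C * norm1 w) * expR (k * `|z|).
    rewrite -expRD ler_expR /k -!mulrA -!mulrDr.
    apply: ler_wpM2l => //; apply: ler_wpM2l => //.
    by rewrite (le_trans (norm1D _ _))// lerD2l norm1Z mulrC.
  have P0 : 0 <= e ^+ 3 * K * F u by rewrite !mulr_ge0 ?exprn_ge0// ltW.
  have := ler_wpM2l P0 hE1; rewrite /D; lra.
(* the terms of first order in z cancel, and z ^ 2 collects hess u a *)
have hsum (z : R) :
   F u * (1 + e * ell u (fun s => w s + z * a s) + e ^+ 2 / 2 * (hess u (fun s => w s + z * a s) + T)) +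
   F u * (1 + e * ell u (fun s => w s + - z * a s) + e ^+ 2 / 2 * (hess u (fun s => w s + - z * a s) + T)) =
   2 * (A + B * z ^+ 2).
  have := hess_par u w a z; rewrite /A /B !(expands_ellD fexp).
  move: (hess u (fun s => w s + z * a s)) (hess u (fun s => w s + - z * a s)) => X Y E.
  have -> : X = 2 * hess u w + 2 * z ^+ 2 * hess u a - Y by rewrite -E addrK.
  by field.
have -> : F u * (1 + e * ell u w + e ^+ 2 / 2 * (hess u w + (hess u a + T))) = A + B.
  by rewrite /A /B; ring.
have -> : e ^+ 3 * (2 * K * expR (k ^+ 2 / 2)) * expR (2 * C * norm1 w) * F u =
   2 * D * expR (k ^+ 2 / 2) by rewrite /D; ring.
have IHz (z : R) := IH u (fun s => w s + z * a s) e e01.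
apply/andP; split.
  apply: (@normal_quad_ge R h) => // z; rewrite !hE.
  have /andP[h1 _] := IHz z; have /andP[h2 _] := IHz (- z).
  apply: le_trans (leeD h1 h2); rewrite -EFinD lee_fin -/T.
  have := hsum z; have := nB z; have := nB (- z); rewrite normrN; lra.
apply: (@normal_quad_le R h) => // z; rewrite !hE.
have /andP[_ h1] := IHz z; have /andP[_ h2] := IHz (- z).
apply: (le_trans (leeD h1 h2)); rewrite -EFinD lee_fin -/T.
have := hsum z; have := nB z; have := nB (- z); rewrite normrN; lra.
Qed.

(** The expansions of the two averages differ by at most e ^ 2 * kappa + O (e ^
    3), and for small e the second one is at least F u / 2, so this difference is
    also a relative one. *)
Lemma gavgs_one_step l l' (kappa : R) : 0 <= kappa ->
  (forall u, \sum_(a <- l) hess u a - \sum_(a <- l') hess u a <= 2 * kappa) ->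
  exists2 K : R, 0 <= K & exists2 e0 : R, 0 < e0 &
  forall u e, 0 <= e -> e <= e0 ->
  (gavgs (dilate e l) Phi u <=
   (1 + e ^+ 2 * kappa + e ^+ 3 * K)%:E * gavgs (dilate e l') Phi u)%E.
Proof.
move=> k0 hk.
have [K1 K10 H1] := gavgs_expands l; have [K2 K20 H2] := gavgs_expands l'.
pose M := \sum_(a <- l') (C * norm1 a) ^+ 2.
have M0 : 0 <= M by apply: sumr_ge0 => a _; rewrite sqr_ge0.
have MP u : `|\sum_(a <- l') hess u a| <= 2 * M.
  rewrite mulr_sumr (le_trans (ler_norm_sum _ _ _))//.
  by apply: ler_sum => a _; exact: hess_le.
pose e0 := (1 + 2 * (M + K2))^-1.
have e0P : 0 < 1 + 2 * (M + K2) by rewrite ltr_wpDr// mulr_ge0// addr_ge0.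
exists (2 * (kappa * (M + K2)) + 2 * (K1 + K2)).
  by rewrite addr_ge0// ?mulr_ge0// ?addr_ge0.
exists e0; first by rewrite invr_gt0.
move=> u e e_0 ee0.
have e1 : e * (1 + 2 * (M + K2)) <= 1 by rewrite -ler_pdivlMr// div1r.
have MK : 0 <= M + K2 by rewrite addr_ge0.
have eM : 0 <= e * (M + K2) by rewrite mulr_ge0.
have e_1 : e <= 1 by lra.
have e01 : 0 <= e <= 1 by rewrite e_0.
have zE : (fun s : S => u s + e * (fun=> 0) s) = u.
  by apply/funext => s; rewrite mulr0 addr0.
have n0 : norm1 (fun _ : S => 0 : R) = 0.
  by rewrite /norm1 big1// => s _; rewrite normr0.
have l0 : ell u (fun=> 0) = 0.
  by apply/eqP; rewrite -normr_le0 (le_trans (expands_lin fexp _ _))// n0 mulr0.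
have h0 : hess u (fun=> 0) = 0.
  by apply/eqP; rewrite -normr_le0 (le_trans (hess_le _ _))// n0 mulr0 expr0n mulr0.
have := H1 u (fun=> 0) e e01; have := H2 u (fun=> 0) e e01.
rewrite zE l0 h0 n0 !(mulr0, addr0, add0r) expR0 !mulr1 => /andP[+ _] /andP[_].
set T := \sum_(a <- l) _; set T' := \sum_(a <- l') _.
move=> h1 h2.
have hT : T - T' <= 2 * kappa by exact: hk.
have hT' : - (2 * M) <= T' by have := MP u; rewrite ler_norml => /andP[].
have e20 : 0 <= e ^+ 2 by rewrite sqr_ge0.
have e30 : 0 <= e ^+ 3 by rewrite exprn_ge0.
(* y * F u is the lower bound for the average over l' *)
pose y := 1 + e ^+ 2 / 2 * T' - e ^+ 3 * K2.
have e2e : e ^+ 2 <= e by rewrite expr2 ler_piMl.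
have e3e : e ^+ 3 <= e by rewrite exprS (le_trans _ e2e)// expr2 ler_wpM2l.
have y1 : 1 - e * (M + K2) <= y.
  have : 0 <= e ^+ 2 * (T' + 2 * M) by apply: mulr_ge0 => //; lra.
  have : 0 <= (e - e ^+ 2) * M by rewrite mulr_ge0// subr_ge0.
  have : 0 <= (e - e ^+ 3) * K2 by rewrite mulr_ge0// subr_ge0.
  by rewrite /y; lra.
have y2 : 1 / 2 <= y by lra.
apply: (le_trans h2).
have rho0 : 0 <= 1 + e ^+ 2 * kappa + e ^+ 3 * (2 * (kappa * (M + K2)) + 2 * (K1 + K2)).
  by rewrite !addr_ge0// !mulr_ge0// !addr_ge0// ?mulr_ge0// ?addr_ge0.
apply: le_trans (_ : _ <= (1 + e ^+ 2 * kappa +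
    e ^+ 3 * (2 * (kappa * (M + K2)) + 2 * (K1 + K2)))%:E * _)%E _; last first.
  by apply: lee_wpmul2l h1; rewrite lee_fin.
rewrite -EFinM lee_fin.
rewrite (_ : _ + _ = F u * (1 + e ^+ 2 / 2 * T + e ^+ 3 * K1)); last by ring.
rewrite [leRHS](_ : _ = F u * ((1 + e ^+ 2 * kappa +
    e ^+ 3 * (2 * (kappa * (M + K2)) + 2 * (K1 + K2))) * y)); last by rewrite /y; ring.
rewrite ler_pM2l//.
have i1 : 0 <= e ^+ 2 * (2 * kappa - (T - T')) by rewrite mulr_ge0// subr_ge0.
have i2 : 0 <= e ^+ 3 * (2 * (kappa * (M + K2)) + 2 * (K1 + K2)) * (y - 1 / 2).
  apply: mulr_ge0; last by rewrite subr_ge0.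
  by rewrite mulr_ge0// addr_ge0// ?mulr_ge0// ?addr_ge0// mulr_ge0.
have i3 : 0 <= e ^+ 2 * kappa * (y - (1 - e * (M + K2))).
  by apply: mulr_ge0; [rewrite mulr_ge0|rewrite subr_ge0].
move: i2 i3; rewrite /y; lra.
Qed.

(** The generator of the Gaussian average with covariance l is half the sum of
    second derivatives along l. Splitting both vectors in 2 ^ k shrunk copies
    gives the factor (1 + kappa / 2 ^ k + O (2 ^ (- 3 k / 2))) ^ (2 ^ k), which
    tends to exp kappa. *)
Theorem gaussian_comparison l l' (kappa : R) u : 0 <= kappa ->
  (forall u, \sum_(a <- l) hess u a - \sum_(a <- l') hess u a <= 2 * kappa) ->
  (gavgs l Phi u <= (expR kappa)%:E * gavgs l' Phi u)%E.
Proof.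
move=> k0 hk; have [K K0 [e0 e00 H]] := gavgs_one_step k0 hk.
pose c : R := Num.sqrt 2^-1.
have c0 : 0 < c by rewrite sqrtr_gt0 invr_gt0.
have c2 : c ^+ 2 = 2^-1 by rewrite sqr_sqrtr// invr_ge0.
have c1 : c < 1.
  by rewrite -(@ltr_pXn2r _ 2)// ?nnegrE ?ltW// c2 expr1n invf_lt1// ltr1n.
have fin l1 : exists2 r : R, 0 <= r & gavgs l1 Phi u = r%:E.
  have [K1 _ H1] := gavgs_expands l1.
  have := H1 u (fun=> 0) 1; rewrite ler01 lexx => /(_ isT) /andP[_].
  have -> : (fun s : S => u s + 1 * (fun=> 0) s) = u.
    by apply/funext => s; rewrite mulr0 addr0.
  have -> : dilate 1 l1 = l1.
    by rewrite -[RHS]map_id; apply: eq_map => a; apply/funext => s; rewrite mul1r.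
  have := (functional_gavgs l1 fPhi).1 u.
  by case: (gavgs l1 Phi u) => // r r0 _; exists r.
have [r r0 rE] := fin l; have [r' r'0 r'E] := fin l'.
rewrite rE r'E -EFinM lee_fin.
have key d : 0 < d -> r <= expR (kappa + d) * r'.
  move=> d0.
  (* k so large that the third-order term changes the exponent by at most d *)
  have [k ck] : exists k, c ^+ k <= Num.min e0 (d / (K + 1)).
    have m0 : 0 < Num.min e0 (d / (K + 1)).
      by rewrite lt_min e00 divr_gt0// ltr_wpDl.
    have : (fun k => c ^+ k) @ \oo --> (0 : R) by apply: cvg_expr; rewrite ger0_norm ?ltW.
    move=> /cvgrPdist_le /(_ _ m0) [k _ /(_ k (leqnn k))] /=.
    rewrite sub0r normrN ger0_norm; first by exists k.
    by rewrite exprn_ge0// ltW.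
  move: ck; rewrite le_min => /andP[cke ckd].
  have ck0 : 0 <= c ^+ k by rewrite exprn_ge0// ltW.
  pose rho := 1 + (c ^+ k) ^+ 2 * kappa + (c ^+ k) ^+ 3 * K.
  have rho0 : 0 <= rho by rewrite !addr_ge0// mulr_ge0// exprn_ge0.
  have := @iter_gavgs_compare R S (dilate (c ^+ k) l) (dilate (c ^+ k) l') rho
    (2 ^ k) Phi u rho0 fPhi (fun v => H v _ ck0 cke).
  rewrite !iter_gavgs_split// rE r'E -EFinM lee_fin => h.
  apply: (le_trans h); apply: ler_wpM2r => //.
  apply: (@le_trans _ _ (expR ((2 ^ k)%:R * (rho - 1)))).
    rewrite expRM_natl lerXn2r ?nnegrE ?expR_ge0//.
    by apply: le_trans (expR_ge1Dx _); rewrite subrKC.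
  rewrite ler_expR natrX.
  have E2 : 2 ^+ k * (c ^+ k) ^+ 2 = 1 :> R.
    by rewrite -exprM mulnC exprM c2 -exprMn mulfV// expr1n.
  have -> : 2 ^+ k * (rho - 1) = (2 ^+ k * (c ^+ k) ^+ 2) * (kappa + c ^+ k * K).
    by rewrite /rho; ring.
  rewrite E2 mul1r lerD2l.
  have K1 : 0 < K + 1 by rewrite ltr_wpDl.
  move: ckd; rewrite ler_pdivlMr// => ckd; lra.
have [r00|rpos] := eqVneq r 0; first by rewrite r00 mulr_ge0// expR_ge0.
have {rpos}rpos : 0 < r by rewrite lt_neqAle eq_sym rpos.
have r'pos : 0 < r'.
  rewrite lt_neqAle r'0 andbT eq_sym; apply/eqP => E.
  by have := key 1 ltr01; rewrite E mulr0 leNgt rpos.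
rewrite -[r]lnK ?posrE// -[X in _ * X]lnK ?posrE// -expRD ler_expR.
apply/ler_addgt0Pr => d d0.
have := key d d0; rewrite -ler_ln ?posrE ?mulr_gt0 ?expR_gt0//.
by rewrite lnM ?posrE ?expR_gt0// expRK; lra.
Qed.

End gaussian_comparison.

(** * Gordon's inequality and concentration for log-sum-exp *)

Section functionals.
Context {R : realType}.
Notation RT := (measurableTypeR R).

Definition cov {S : Type} (l : seq (S -> R)) s s' : R := \sum_(a <- l) a s * a s'.

Lemma sum_cov {S : Type} {J J' : finType} (l : seq (S -> R)) (g : J -> S) (h : J' -> S)
    (c : J -> R) (d : J' -> R) :
  \sum_(a <- l) (\sum_j c j * a (g j)) * (\sum_j d j * a (h j)) =
  \sum_j \sum_j' c j * d j' * cov l (g j) (h j').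
Proof.
transitivity (\sum_(a <- l) \sum_j \sum_j' c j * d j' * (a (g j) * a (h j'))).
  apply: eq_bigr => a _; rewrite mulr_suml; apply: eq_bigr => j _.
  by rewrite mulr_sumr; apply: eq_bigr => j' _; ring.
rewrite exchange_big; apply: eq_bigr => j _ /=.
by rewrite exchange_big; apply: eq_bigr => j' _ /=; rewrite mulr_sumr.
Qed.

Definition measurable_functional {S : Type} (f : (S -> R) -> R) : Prop :=
  forall d (T : measurableType d) (U : S -> T -> RT),
    (forall s, measurable_fun setT (U s)) ->
    measurable_fun setT ((fun t => f (U ^~ t)) : T -> RT).

Lemma measurable_lse {S : Type} {I : finType} (f : I -> (S -> R) -> R) :
  (forall i, measurable_functional (f i)) ->
  measurable_functional (fun u => lse (f ^~ u)).
Proof.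
move=> mf d T U mU; apply: measurableT_comp; first exact: measurable_ln.
apply: measurable_sum => i; apply: measurableT_comp => //; exact: mf.
Qed.

Lemma functional_expR {S : Type} (f : (S -> R) -> R) :
  measurable_functional f -> functional (fun u => (expR (f u))%:E).
Proof.
move=> mf; split=> [u|d T U mU]; first by rewrite lee_fin expR_ge0.
by apply/measurable_EFinP/measurableT_comp => //; exact: mf.
Qed.

Section gordon.
Context {I J : finType}.
Variables (i0 : I) (j0 : J) (r s b : R).
Implicit Types u v a : I * J -> R.

(** With r = mu / b and b large, this is close to mu * max_i max_j u (i, j) for s
    = 1 and to - mu * min_i max_j u (i, j) for s = - 1. *)
Definition softminmax u : R :=
  r * lse (fun i => s * lse (fun j => b * u (i, j))).

Let inner (i : I) := expandsZ s (expands_lse j0 (fun j : J => expands_coord b (i, j))).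
Let outer := expandsZ r (expands_lse i0 inner).

Lemma functional_softminmax : functional (fun u => (expR (softminmax u))%:E).
Proof.
apply: functional_expR => d T U mU; apply: measurable_funM => //.
apply: (measurable_lse (f := fun i u => s * lse (fun j => b * u (i, j)))) mU.
move=> i {}d {}T {}U mU; apply: measurable_funM => //.
apply: (measurable_lse (f := fun j u => b * u (i, j))) mU.
by move=> j {}d {}T {}U mU; exact: (measurable_funM (measurable_cst b) (mU _)).
Qed.

(** With P the softmax weights over i, the sum of the second derivatives along l
    is the sum of r * P i * G i, where G i involves only covariances with equal
    first index, minus r * (1 - r) times a combination with nonnegative weights of
    all covariances. The first part is the same for l and l', and the second is
    larger for the larger covariance. This is where r <= 1 is used. *)
Theorem gordon_comparison (l l' : seq (I * J -> R)) u : 0 <= r <= 1 ->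
  (forall i j j', cov l (i, j) (i, j') = cov l' (i, j) (i, j')) ->
  (forall p p', cov l' p p' <= cov l p p') ->
  (gavgs l (fun u => (expR (softminmax u))%:E) u <=
   gavgs l' (fun u => (expR (softminmax u))%:E) u)%E.
Proof.
move=> /andP[r0 r1] covE cov_le.
have := @gaussian_comparison R _ _ _ _ _ outer functional_softminmax l l' 0 u (lexx _).
rewrite expR0 mul1e; apply=> {}u; rewrite mulr0 subr_le0 /hess.
set P := softmax _.
pose p i := softmax (fun j => b * u (i, j)).
pose ell i a := \sum_j p i j * (b * a (i, j)).
pose G i a := s * (\sum_j p i j * (b * a (i, j)) ^+ 2 - ell i a ^+ 2) + (s * ell i a) ^+ 2.
pose L a := \sum_i P i * (s * ell i a).
have hE a : r * (\sum_i P i * (s * (\sum_j p i j * (0 + (b * a (i, j)) ^+ 2) - ell i a ^+ 2) +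
    (s * ell i a) ^+ 2) - L a ^+ 2) + (r * L a) ^+ 2 =
    r * \sum_i P i * G i a - r * (1 - r) * L a ^+ 2.
  rewrite (_ : \sum_i _ = \sum_i P i * G i a); last first.
    by apply: eq_bigr => i _; rewrite /G; congr (_ * (_ * (_ - _) + _)); apply: eq_bigr => j _; rewrite add0r.
  by ring.
under eq_bigr do rewrite hE.
under [leRHS]eq_bigr do rewrite hE.
rewrite !sumrB -!mulr_sumr.
have ell2 i k : \sum_(a <- k) ell i a ^+ 2 =
    \sum_j \sum_j' p i j * b * (p i j' * b) * cov k (i, j) (i, j').
  rewrite -sum_cov; apply: eq_bigr => a _; rewrite expr2.
  by congr (_ * _); apply: eq_bigr => j _; rewrite mulrA.
have GE i k : \sum_(a <- k) G i a = s * (\sum_j p i j * b ^+ 2 * cov k (i, j) (i, j) -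
   \sum_(a <- k) ell i a ^+ 2) + s ^+ 2 * \sum_(a <- k) ell i a ^+ 2.
  rewrite big_split/= -!mulr_sumr sumrB; congr (_ * (_ - _) + _); last first.
    by rewrite mulr_sumr; apply: eq_bigr => a _; rewrite exprMn.
  rewrite exchange_big; apply: eq_bigr => j _; rewrite mulr_sumr.
  by apply: eq_bigr => a _; ring.
have -> : \sum_(a <- l) \sum_i P i * G i a = \sum_(a <- l') \sum_i P i * G i a.
  rewrite exchange_big [RHS]exchange_big; apply: eq_bigr => i _ /=.
  rewrite -!mulr_sumr !GE !ell2; congr (_ * (_ * (_ - _) + _ * _)).
  - by apply: eq_bigr => j _; rewrite covE.
  - by apply: eq_bigr => j _; apply: eq_bigr => j' _; rewrite covE.
  - by apply: eq_bigr => j _; apply: eq_bigr => j' _; rewrite covE.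
rewrite lerD2l lerN2; apply: ler_wpM2l; first by rewrite mulr_ge0// subr_ge0.
(* the probability weights of the gradient of softminmax *)
pose w (x : I * J) := P x.1 * p x.1 x.2.
have w0 x : 0 <= w x by rewrite mulr_ge0//; apply: softmax_ge0.
have LE k : \sum_(a <- k) L a ^+ 2 =
    (s * b) ^+ 2 * \sum_x \sum_y w x * w y * cov k x y.
  rewrite -(sum_cov k id id) mulr_sumr; apply: eq_bigr => a _.
  rewrite -expr2 -exprMn; congr (_ ^+ 2).
  have -> : \sum_x w x * a (id x) = \sum_i \sum_j P i * p i j * a (i, j).
    by rewrite pair_bigA; apply: eq_bigr => -[i j] _.
  rewrite mulr_sumr.
  apply: eq_bigr => i _; rewrite !mulr_sumr; apply: eq_bigr => j _; ring.
rewrite !LE; apply: ler_wpM2l; first exact: sqr_ge0.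
apply: ler_sum => x _; apply: ler_sum => y _; apply: ler_wpM2l => //.
by rewrite mulr_ge0.
Qed.

End gordon.

Section concentration.
Context {J : finType}.
Variables (j0 : J) (r b : R).
Implicit Types u v a : bool * J -> R.

Definition softdiff u : R :=
  r * lse (fun j => b * u (true, j)) + - r * lse (fun j => b * u (false, j)).

Let half (c : bool) (r : R) := expandsZ r (expands_lse j0 (fun j : J => expands_coord b (c, j))).

Lemma functional_softdiff : functional (fun u => (expR (softdiff u))%:E).
Proof.
apply: functional_expR.
have m c : measurable_functional (fun u : bool * J -> R => lse (fun j => b * u (c, j))).
  apply: (measurable_lse (f := fun j u => b * u (c, j))).
  by move=> j {}d {}T {}U mU; exact: (measurable_funM (measurable_cst b) (mU _)).
by move=> d T U mU; apply: measurable_funD; apply: measurable_funM => //; exact: m.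
Qed.

(** The two processes have the same laws under l and l'; only their mutual
    covariance differs, and it enters through the mixed second derivative, with
    weights of total mass 2 (r * b) ^ 2. *)
Theorem softdiff_comparison (l l' : seq (bool * J -> R)) u :
  (forall c j j', cov l (c, j) (c, j') = cov l' (c, j) (c, j')) ->
  (forall j j', cov l' (true, j) (false, j') <= cov l (true, j) (false, j') + 1) ->
  (gavgs l (fun u => (expR (softdiff u))%:E) u <=
   (expR ((r * b) ^+ 2))%:E * gavgs l' (fun u => (expR (softdiff u))%:E) u)%E.
Proof.
move=> covE cov_le.
apply: (@gaussian_comparison R _ _ _ _ _ (expandsD (half true r) (half false (- r)))
  functional_softdiff) => [|{}u]; first exact: sqr_ge0.
rewrite /hess.
pose p c := softmax (fun j => b * u (c, j)).
pose ell c a := \sum_j p c j * (b * a (c, j)).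
pose G c a := \sum_j p c j * (0 + (b * a (c, j)) ^+ 2) - ell c a ^+ 2.
have hE a : r * G true a + - r * G false a + (r * ell true a + - r * ell false a) ^+ 2 =
    (r * G true a + r ^+ 2 * ell true a ^+ 2) +
    (- r * G false a + r ^+ 2 * ell false a ^+ 2) -
    2 * r ^+ 2 * (ell true a * ell false a) by ring.
under eq_bigr do rewrite hE.
under [X in _ - X]eq_bigr do rewrite hE.
rewrite !sumrB !big_split/= -!mulr_sumr.
have ellE c c' k : \sum_(a <- k) ell c a * ell c' a =
    \sum_j \sum_j' p c j * b * (p c' j' * b) * cov k (c, j) (c', j').
  rewrite -sum_cov; apply: eq_bigr => a _.
  by congr (_ * _); apply: eq_bigr => j _; rewrite mulrA.
have ell2 c : \sum_(a <- l) ell c a ^+ 2 = \sum_(a <- l') ell c a ^+ 2.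
  rewrite !ellE; apply: eq_bigr => j _; apply: eq_bigr => j' _; by rewrite covE.
have GE c : \sum_(a <- l) G c a = \sum_(a <- l') G c a.
  rewrite !sumrB ell2; congr (_ - _).
  rewrite exchange_big [RHS]exchange_big; apply: eq_bigr => j _ /=.
  rewrite -!mulr_sumr; congr (_ * _).
  have E k : \sum_(a <- k) (0 + (b * a (c, j)) ^+ 2) = b ^+ 2 * cov k (c, j) (c, j).
    by rewrite mulr_sumr; apply: eq_bigr => a _; ring.
  by rewrite !E covE.
rewrite !ell2 !GE (ellE true false l) (ellE true false l').
set X := \sum_j \sum_j' _ * cov l _ _; set Y := \sum_j \sum_j' _ * cov l' _ _.
rewrite (_ : _ - _ = 2 * r ^+ 2 * (Y - X)); last by ring.
rewrite [leRHS](_ : _ = 2 * r ^+ 2 * b ^+ 2); last by ring.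
apply: ler_wpM2l; first by rewrite mulr_ge0 ?sqr_ge0.
rewrite /X /Y.
rewrite -sumrB.
have -> : b ^+ 2 = \sum_j p true j * b * (\sum_j' p false j' * b).
  have pb c : \sum_j p c j * b = b by rewrite -mulr_suml softmax_sum1// mul1r.
  by rewrite (pb false) -mulr_suml pb expr2.
apply: ler_sum => j _; rewrite -sumrB mulr_sumr; apply: ler_sum => j' _.
have c0 : 0 <= p true j * b * (p false j' * b).
  rewrite mulrACA -expr2 mulr_ge0 ?sqr_ge0// mulr_ge0//; exact: softmax_ge0.
by rewrite -mulrBr ler_piMr// lerBlDl.
Qed.

End concentration.
End functionals.

(** * Consequences of two-sided exponential concentration *)

Section prob_lemmas.
Context d (T : measurableType d) (R : realType) (P : probability T R).
Local Open Scope ereal_scope.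
Notation RT := (measurableTypeR R).

Lemma integral_prob_cst (c : R) : \int[P]_x c%:E = c%:E.
Proof.
have -> : \int[P]_x c%:E = \int[P]_x cst c%:E x by [].
by rewrite integral_cst// -[RHS]mule1; congr (_ * _); exact: probability_setT.
Qed.

(** Integrate the tangent line of exp at the mean. *)
Lemma jensen_expR (f : T -> R) (c : R) : P.-integrable setT (EFin \o f) ->
  (expR (c * \int[P]_x f x))%:E <= \int[P]_x (expR (c * f x))%:E.
Proof.
move=> fi.
have mf : measurable_fun setT (f : T -> RT).
  by apply/measurable_EFinP; exact: measurable_int fi.
have me : measurable_fun setT (fun x => (expR (c * f x))%:E).
  by apply/measurable_EFinP/measurableT_comp => //; exact: measurable_funM.
have [|] := ltP (\int[P]_x (expR (c * f x))%:E) +oo; last by rewrite leye_eq => /eqP ->; rewrite leey.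
move=> fin.
have ei : P.-integrable setT (fun x => (expR (c * f x))%:E).
  apply/integrableP; split => //.
  by under eq_integral do rewrite gee0_abs ?lee_fin ?expR_ge0//.
set m := Rintegral _ _ _.
have fm : \int[P]_x (f x)%:E = m%:E by rewrite /m /Rintegral fineK// integrable_fin_num.
have li : P.-integrable setT (fun x => (expR (c * m) * (1 - c * m))%:E + (expR (c * m) * c)%:E * (f x)%:E).
  apply: integrableD => //.
    exact: (finite_measure_integrable_cst P (expR (c * m) * (1 - c * m))%R).
  exact: integrableZl.
have -> : (expR (c * m))%:E = \int[P]_x ((expR (c * m) * (1 - c * m))%:E + (expR (c * m) * c)%:E * (f x)%:E).
  rewrite integralD//; last 2 first.
  - exact: (finite_measure_integrable_cst P (expR (c * m) * (1 - c * m))%R).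
  - exact: integrableZl.
  rewrite integral_prob_cst integralZl// fm -EFinM -EFinD; congr EFin; ring.
apply: le_integral => // x _; rewrite -EFinM -EFinD lee_fin.
have -> : expR (c * f x) = (expR (c * m) * expR (c * (f x - m)))%R.
  by rewrite -expRD; congr expR; ring.
have := expR_ge1Dx (c * (f x - m))%R; have := expR_ge0 (c * m)%R => h1 h2.
have := ler_wpM2l h1 h2; lra.
Qed.

(** Minkowski's inequality in L^2 from the pointwise bound (F + W) ^ 2 <= (1 + b /
    a) F ^ 2 + (1 + a / b) W ^ 2. *)
Lemma L2_triangle (N F W : T -> R) (a b : R) : (0 < a)%R -> (0 < b)%R ->
  measurable_fun setT (N : T -> RT) ->
  measurable_fun setT (F : T -> RT) -> measurable_fun setT (W : T -> RT) ->
  (forall x, 0 <= N x <= F x + W x)%R ->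
  \int[P]_x (F x ^+ 2)%:E <= (a ^+ 2)%:E -> \int[P]_x (W x ^+ 2)%:E <= (b ^+ 2)%:E ->
  \int[P]_x (N x ^+ 2)%:E <= ((a + b) ^+ 2)%:E.
Proof.
move=> a0 b0 mN mF mW NFW Fa Wb.
have sq0 (g : T -> R) x : 0 <= (g x ^+ 2)%:E by rewrite lee_fin sqr_ge0.
have msq (g : T -> R) : measurable_fun setT (g : T -> RT) ->
    measurable_fun setT (fun x => (g x ^+ 2)%:E).
  by move=> mg; apply/measurable_EFinP; exact: measurable_funX.
have ab0 : (0 <= 1 + b / a)%R by rewrite addr_ge0// divr_ge0// ltW.
have ba0 : (0 <= 1 + a / b)%R by rewrite addr_ge0// divr_ge0// ltW.
apply: (@le_trans _ _ (\int[P]_x ((1 + b / a)%:E * (F x ^+ 2)%:E + (1 + a / b)%:E * (W x ^+ 2)%:E))).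
  apply: ge0_le_integral => //.
  - exact: msq.
  - by apply: emeasurable_funD; apply: measurable_funeM; exact: msq.
  - move=> x _; rewrite -!EFinM -EFinD lee_fin.
    have /andP[N0 NF] := NFW x.
    apply: (@le_trans _ _ ((F x + W x) ^+ 2)%R).
      by rewrite lerXn2r ?nnegrE// (le_trans N0).
    have -> : ((1 + b / a) * F x ^+ 2 + (1 + a / b) * W x ^+ 2 =
       (F x + W x) ^+ 2 + (b * F x - a * W x) ^+ 2 / (a * b))%R.
      by field; rewrite !gt_eqF.
    by rewrite lerDl divr_ge0 ?sqr_ge0// mulr_ge0// ltW.
rewrite ge0_integralD//; last 4 first.
- by move=> x _; rewrite mule_ge0.
- by apply: measurable_funeM; exact: msq.
- by move=> x _; rewrite mule_ge0.
- by apply: measurable_funeM; exact: msq.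
rewrite !ge0_integralZl//; [|exact: msq|exact: msq].
apply: (@le_trans _ _ ((1 + b / a)%:E * (a ^+ 2)%:E + (1 + a / b)%:E * (b ^+ 2)%:E)).
  by apply: leeD; apply: lee_wpmul2l.
rewrite -!EFinM -EFinD lee_fin [leLHS](_ : _ = (a + b) ^+ 2)%R//.
by field; rewrite !gt_eqF.
Qed.

Section concentrated.
Variable f : T -> R.
Hypothesis mf : measurable_fun setT (f : T -> RT).
Hypothesis conc : forall c : R, (0 < c)%R ->
  (\int[P]_x (expR (c * f x))%:E) * (\int[P]_x (expR (- c * f x))%:E) <=
  (expR (c ^+ 2))%:E.

Let E c := \int[P]_x (expR (c * f x))%:E.

Let mE c : measurable_fun setT (fun x => (expR (c * f x))%:E).
Proof. by apply/measurable_EFinP/measurableT_comp => //; exact: measurable_funM. Qed.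

Let E_gt0 c : 0 < E c.
Proof.
rewrite lt_neqAle integral_ge0 ?andbT; last by move=> x _; rewrite lee_fin expR_ge0.
apply/eqP => E0.
have : ae_eq P setT (fun x => (expR (c * f x))%:E) (cst 0).
  by apply/(ae_eq_integral_abs P measurableT (mE c));
    under eq_integral do rewrite gee0_abs ?lee_fin ?expR_ge0//.
case=> N [mN PN0 sub].
have NT : N = setT.
  apply/seteqP; split => // x _; apply: sub => /= /(_ I) /eqP.
  by rewrite eqe gt_eqF// expR_gt0.
have := probability_setT P; rewrite -NT [X in X = _]PN0 => /esym/eqP.
by rewrite onee_eq0.
Qed.

Let E_lty c : (0 < c)%R -> E c < +oo /\ E (- c)%R < +oo.
Proof.
move=> c0; have := conc c0; rewrite -/(E c) -/(E (- c)%R).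
have := E_gt0 c; have := E_gt0 (- c)%R.
case: (E c) => [r| |]//; case: (E (- c)%R) => [r'| |]//.
- by rewrite !ltry.
- by rewrite !lte_fin => _ r0; rewrite gt0_muley ?lte_fin.
- by rewrite !lte_fin => r0 _; rewrite gt0_mulye ?lte_fin.
Qed.

(** The product of the two exponential moments is finite and neither vanishes, so
    both are finite. *)
Lemma concentrated_integrable : P.-integrable setT (EFin \o f).
Proof.
have [E1 E2] := E_lty ltr01.
apply/integrableP; split; first exact/measurable_EFinP.
apply: (@le_lt_trans _ _ (E 1 + E (- 1)%R)); last by rewrite lte_add_pinfty.
rewrite -ge0_integralD//; try by move=> x _; rewrite lee_fin expR_ge0.
apply: ge0_le_integral => //.
- by apply: measurableT_comp => //; exact/measurable_EFinP.
- exact: emeasurable_funD.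
- move=> x _; rewrite -EFinD lee_fin mul1r mulN1r.
  apply: le_trans (expR_norm_le _).
  by have := expR_ge1Dx `|f x|; lra.
Qed.

Local Notation mean := (\int[P]_x f x)%R.

(** Jensen bounds one of the two factors in the hypothesis from below. *)
Lemma concentrated_mgf (c : R) : (0 < c)%R ->
  E c <= (expR (c ^+ 2 + c * mean))%:E /\ E (- c)%R <= (expR (c ^+ 2 - c * mean))%:E.
Proof.
move=> c0; have [E1 E2] := E_lty c0.
have := conc c0; rewrite -/(E c) -/(E (- c)%R).
have := jensen_expR c concentrated_integrable.
have := jensen_expR (- c)%R concentrated_integrable.
rewrite -/(E c) -/(E (- c)%R).
have := E_gt0 c; have := E_gt0 (- c)%R.
case: (E c) E1 => [r| |]// _; case: (E (- c)%R) E2 => [r'| |]// _.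
rewrite -EFinM !lee_fin !lte_fin !mulNr => r'0 r0 h1 h2 h.
rewrite !expRD expRN in h1 *.
have p0 := expR_gt0 (c * mean).
have ip : (expR (c * mean) * (expR (c * mean))^-1 = 1)%R by rewrite mulfV// gt_eqF.
split.
  rewrite -(ler_pM2r r'0) (le_trans h)//.
  have := ler_wpM2l (mulr_ge0 (expR_ge0 (c ^+ 2)) (ltW p0)) h1.
  by rewrite -mulrA ip mulr1.
rewrite -(ler_pM2l r0) (le_trans h)//.
have ip0 : (0 <= (expR (c * mean))^-1)%R by rewrite invr_ge0 ltW.
have := ler_wpM2l (mulr_ge0 (expR_ge0 (c ^+ 2)) ip0) h2.
by rewrite -mulrA (mulrC _^-1)%R ip mulr1 (mulrC r).
Qed.

(** From 2 + x ^ 2 <= exp x + exp (- x) with x = f - mean and the exponential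
    moments at c = 1, the variance is at most 2 e - 2. *)
Lemma concentrated_var : \int[P]_x ((f x - mean) ^+ 2)%:E <= 6%:E.
Proof.
have [E1 E2] := concentrated_mgf ltr01.
rewrite expr1n !mul1r in E1 E2.
have msq : measurable_fun setT (fun x => ((f x - mean) ^+ 2)%:E).
  by apply/measurable_EFinP/measurable_funX; exact: measurable_funB.
have sq0 x : 0 <= ((f x - mean) ^+ 2)%:E by rewrite lee_fin sqr_ge0.
have H : 2%:E + 1%:E * \int[P]_x ((f x - mean) ^+ 2)%:E <= (2 * expR 1)%:E.
  rewrite -integral_affine//.
  apply: (@le_trans _ _ (\int[P]_x ((expR (- mean))%:E * (expR (1 * f x))%:E +
      (expR mean)%:E * (expR (-1 * f x))%:E))).
    apply: ge0_le_integral => //.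
    - by move=> x _; rewrite adde_ge0// mule_ge0// lee_fin.
    - by apply: emeasurable_funD => //; exact: measurable_funeM.
    - by apply: emeasurable_funD; exact: measurable_funeM.
    - move=> x _; rewrite mul1e -!EFinM -!EFinD lee_fin -!expRD mul1r mulN1r.
      have := cosh_ge (f x - mean).
      by rewrite opprB (addrC (- mean)%R).
  rewrite ge0_integralD//; try by move=> x _; rewrite mule_ge0// lee_fin expR_ge0.
  - rewrite !ge0_integralZl//; try by rewrite ?lee_fin ?expR_ge0//.
    + apply: (@le_trans _ _ ((expR (- mean))%:E * (expR (1 + mean))%:E +
        (expR mean)%:E * (expR (1 - mean))%:E)).
        by apply: leeD; apply: lee_wpmul2l; rewrite ?lee_fin ?expR_ge0.
      rewrite -!EFinM -EFinD lee_fin -!expRD.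
      rewrite (_ : - mean + (1 + mean) = 1)%R; last by ring.
      rewrite (_ : mean + (1 - mean) = 1)%R; last by ring.
      by rewrite mulr_natl mulr2n.
  - exact: measurable_funeM.
  - exact: measurable_funeM.
rewrite mul1e in H.
have h4 : (2 * expR 1)%:E <= 8%:E :> \bar R.
  by rewrite lee_fin; have := @expR1_le4 R; lra.
have {}H := le_trans H h4.
move: H; case: (\int[P]_x ((f x - mean) ^+ 2)%:E) => [r| |].
- by rewrite -EFinD !lee_fin; lra.
- by rewrite addey//.
- by move=> _; rewrite leNye.
Qed.

End concentrated.
End prob_lemmas.

(** * Smoothed maxima of Gaussian linear forms *)

Section lse_facts.
Context {R : realType} {I : finType}.
Variable i0 : I.

Lemma lse_shift (c : R) (x : I -> R) : lse (fun i => c + x i) = c + lse x.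
Proof.
rewrite /lse -[c in RHS]expRK -lnM ?posrE ?expR_gt0 ?sum_expR_gt0//.
by congr ln; rewrite mulr_sumr; apply: eq_bigr => i _; rewrite expRD.
Qed.

Lemma lse_ge (x : I -> R) i : x i <= lse x.
Proof.
rewrite -ler_expR (expR_lse i0) (bigD1 i)//= lerDl.
by apply: sumr_ge0 => j _; exact: expR_ge0.
Qed.

Lemma lse_le (x : I -> R) (c : R) : (forall i, x i <= c) ->
  lse x <= c + ln #|I|%:R.
Proof.
move=> xc; rewrite -ler_expR (expR_lse i0) expRD lnK; last first.
  by rewrite posrE ltr0n; apply/card_gt0P; exists i0.
rewrite mulr_natr -sumr_const; apply: ler_sum => i _; by rewrite ler_expR.
Qed.

End lse_facts.

Section gaussian_softmax.
Context {R : realType}.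
Notation RT := (measurableTypeR R).

(** Smoothed maximum of the linear forms <g, y_j>; it exceeds the maximum by at
    most ln |J| / b. *)
Definition softlin n (J : finType) (b : R) (y : J -> 'cV[R]_n) (g : 'cV[R]_n) : R :=
  lse (fun j => b * mxdot g (y j)) / b.

Lemma measurable_softlin n (J : finType) b (y : J -> 'cV[R]_n) :
  measurable_fun setT (softlin b y : 'cV[R]_n -> RT).
Proof.
apply: measurable_funM => //.
apply: (@measurable_lse R J J (fun j u => b * u j) _ _ _ (fun j g => mxdot g (y j))).
  by move=> j d T U mU; exact: (measurable_funM (measurable_cst b) (mU _)).
by move=> j; exact: measurable_mxdot.
Qed.

Lemma unit_mxdot_le1 n m (A B : 'M[R]_(n, m)) : mxdot A A = 1 -> mxdot B B = 1 ->
  mxdot A B <= 1.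
Proof.
move=> A1 B1; have := mxdot_ge0 (A - B).
by rewrite mxdotBl !mxdotBr A1 B1 (mxdotC B A); lra.
Qed.

Lemma cov_glist_cat n n' m m' (S : Type) (M : S -> 'M[R]_(n, m)) (M' : S -> 'M[R]_(n', m')) s s' :
  cov (glist M ++ glist M') s s' = mxdot (M s) (M s') + mxdot (M' s) (M' s').
Proof. by rewrite /cov big_cat !glist_cov. Qed.

Lemma integral_gaussian2 n n' m m' (S : Type) (M : S -> 'M[R]_(n, m)) (M' : S -> 'M[R]_(n', m'))
    (Phi : (S -> R) -> \bar R) : functional Phi ->
  gavgs (glist M ++ glist M') Phi (fun=> 0) =
  (\int[gaussian n m]_A \int[gaussian n' m']_B
     Phi (fun s => mxdot A (M s) + mxdot B (M' s))%R)%E.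
Proof.
move=> fPhi; rewrite gavgs_cat -integral_gaussian; last exact: functional_gavgs.
apply: eq_integral => A _; rewrite -integral_gaussian//.
by apply: eq_integral => B _; congr Phi; apply/funext => s; rewrite add0r.
Qed.

Lemma integral_prod_split d d' (T : measurableType d) (T' : measurableType d')
  (P : probability T R) (P' : probability T' R) (f : T -> R) (g : T' -> R) :
  measurable_fun setT (f : T -> RT) -> measurable_fun setT (g : T' -> RT) ->
  (forall x, 0 <= f x) -> (forall x, 0 <= g x) ->
  (\int[P]_x \int[P']_y (f x * g y)%:E =
   (\int[P]_x (f x)%:E) * (\int[P']_y (g y)%:E))%E.
Proof.
move=> /measurable_EFinP mf /measurable_EFinP mg f0 g0.
under eq_integral => x _.
  under eq_integral do rewrite EFinM.
  rewrite ge0_integralZl//; [|by move=> y _; rewrite lee_fin|by rewrite lee_fin].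
  over.
rewrite ge0_integralZr//; first by move=> x _; rewrite lee_fin.
by apply: integral_ge0 => y _; rewrite lee_fin.
Qed.

Section concentration.
Variables (n : nat) (J : finType) (j0 : J) (y : J -> 'cV[R]_n) (b : R).
Hypotheses (y1 : forall j, mxdot (y j) (y j) = 1) (b0 : 0 < b).
Local Notation P := (gaussian n 1).

Let mexp (c : R) : measurable_fun setT ((fun g => expR (c * softlin b y g)) : 'cV[R]_n -> RT).
Proof.
apply: measurableT_comp => //; apply: measurable_funM => //.
exact: measurable_softlin.
Qed.

(** Comparison of the difference of two independent copies of the smoothed maximum
    with the difference of two equal copies, which is 0. The cross covariance of
    two equal copies is <y_j, y_j'> <= 1, and that of independent copies is 0. *)
Lemma softlin_concentrated (c : R) : 0 < c ->
  ((\int[P]_g (expR (c * softlin b y g))%:E) *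
   (\int[P]_g (expR (- c * softlin b y g))%:E) <= (expR (c ^+ 2))%:E)%E.
Proof.
move=> c0; pose r := c / b.
have rb : r * b = c by rewrite divfK// gt_eqF.
(* the two copies on independent Gaussian vectors: Mt carries the first, Mf the
   second, while M puts both on the same vector *)
pose Mt (p : bool * J) : 'cV[R]_n := if p.1 then y p.2 else 0.
pose Mf (p : bool * J) : 'cV[R]_n := if p.1 then 0 else y p.2.
pose M (p : bool * J) := y p.2.
have := @softdiff_comparison R J j0 r b (glist Mt ++ glist Mf) (glist M) (fun=> 0).
have fS := functional_softdiff (J := J) r b.
rewrite rb integral_gaussian2//.
rewrite (_ : gavgs (glist M) _ _ = 1%E); last first.
  rewrite -integral_gaussian// -[RHS](integral_prob_cst P); apply: eq_integral => g _.
  by rewrite /softdiff /M/= mulNr subrr expR0.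
rewrite mule1 => H; rewrite -integral_prod_split//; try by move=> *; exact: expR_ge0.
apply: le_trans (H _ _).
- rewrite le_eqVlt; apply/orP; left; apply/eqP.
  apply: eq_integral => g _; apply: eq_integral => h _; congr EFin.
  rewrite -expRD; congr expR; rewrite /softdiff /softlin /Mt /Mf /=.
  congr (_ + _).
    rewrite /r mulrAC mulrA; congr (_ * lse _ / _).
    by apply/funext => j; rewrite mxdot0r addr0.
  rewrite /r !mulNr mulrAC mulrA; congr (- (_ * lse _ / _)).
  by apply/funext => j; rewrite mxdot0r add0r.
- move=> t j j'; rewrite cov_glist_cat /cov glist_cov /Mt /Mf /M /=.
  by case: t => /=; rewrite !mxdot0l ?addr0 ?add0r.
- move=> j j'; rewrite cov_glist_cat /cov glist_cov /Mt /Mf /M /=.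
  by rewrite mxdot0r mxdot0l !add0r unit_mxdot_le1.
Qed.

End concentration.
End gaussian_softmax.

(** * Tails of bilinear Gaussian forms *)

Section tails.
Context {R : realType}.
Notation RT := (measurableTypeR R).

Lemma mxdot_mulmx n m (A : 'M[R]_(n, m)) (x : 'cV[R]_m) (y : 'cV[R]_n) :
  mxdot A (y *m x^T) = mxdot (A *m x) y.
Proof.
apply: eq_bigr => i _; rewrite big_ord1 mxE mulr_suml.
by apply: eq_bigr => j _; rewrite !mxE big_ord1 !mxE; ring.
Qed.

Lemma mxdot_rank1 n m (x x' : 'cV[R]_m) (y y' : 'cV[R]_n) :
  mxdot (y *m x^T) (y' *m x'^T) = mxdot x x' * mxdot y y'.
Proof.
rewrite mxdot_mulmx -mulmxA; have -> : x^T *m x' = (mxdot x x')%:M.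
  apply/matrixP => i j; rewrite !ord1 !mxE eqxx mulr1n.
  by apply: eq_bigr => k _; rewrite big_ord1 !mxE.
by rewrite mul_mx_scalar mxdotZl.
Qed.

Lemma prob_markov d (T : measurableType d) (P : probability T R) (f : T -> \bar R)
  (B : set T) (k : R) : measurable B -> measurable_fun setT f -> (forall x, 0 <= f x)%E ->
  (forall x, B x -> (expR k)%:E <= f x)%E ->
  (P B <= (expR (- k))%:E * \int[P]_x f x)%E.
Proof.
move=> mB mf f0 fk.
have H : ((expR k)%:E * P B <= \int[P]_x f x)%E.
  rewrite -integral_cst//; apply: (@le_trans _ _ (\int[P]_(x in B) f x)%E).
    apply: ge0_le_integral => //.
    - by move=> x _; rewrite lee_fin expR_ge0.
    - exact: measurable_funTS.
  by apply: ge0_subset_integral.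
have := lee_wpmul2l (_ : 0 <= (expR (- k))%:E)%E H.
by rewrite muleA -EFinM -expRD addNr expR0 mul1e; apply; rewrite lee_fin expR_ge0.
Qed.

Variables (n m : nat) (I J : finType) (i0 : I) (j0 : J).
Variables (x : I -> 'cV[R]_m) (y : J -> 'cV[R]_n).
Hypotheses (x1 : forall i, mxdot (x i) (x i) = 1) (y1 : forall j, mxdot (y j) (y j) = 1).
Variables (b mu : R).
Hypotheses (mu0 : 0 < mu) (mub : mu <= b).

Let b0 : 0 < b. Proof. exact: lt_le_trans mub. Qed.
Let r : R := mu / b.
Let rb : r * b = mu. Proof. by rewrite divfK// gt_eqF. Qed.
Let r0 : 0 <= r. Proof. by rewrite divr_ge0 ?ltW. Qed.
Let r1 : r <= 1. Proof. by rewrite ler_pdivrMr// mul1r. Qed.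

Local Notation mx := (\int[gaussian m 1]_h softlin b x h).
Local Notation my := (\int[gaussian n 1]_g softlin b y g).

Let bilin (A : 'M[R]_(n, m)) (p : I * J) : R := mxdot (A *m x p.1) (y p.2).

Let softlinE k (K : finType) (z : K -> 'cV[R]_k) g :
  r * lse (fun j => b * mxdot g (z j)) = mu * softlin b z g.
Proof. by rewrite /softlin /r mulrAC mulrA. Qed.

(** Gordon's comparison of the processes <G x, y> + z and <g, y> + s <h, x>, with
    z an independent standard normal variable. Adding z multiplies the exponential
    moment by exp (mu ^ 2 / 2) >= 1, so z can be dropped from the smaller side. *)
Lemma soft_gordon (s : R) : s ^+ 2 = 1 ->
  (\int[gaussian n m]_A (expR (softminmax r s b (bilin A)))%:E <=
   (\int[gaussian n 1]_g (expR (s * mu * softlin b y g))%:E) *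
   (\int[gaussian m 1]_h (expR (mu * softlin b x h))%:E))%E.
Proof.
move=> s2.
pose Phi (u : I * J -> R) := (expR (softminmax r s b u))%:E.
have fPhi : functional Phi by exact: functional_softminmax.
pose M (p : I * J) := y p.2 *m (x p.1)^T.
pose Y (p : I * J) := y p.2.
pose X (p : I * J) := s *: x p.1.
have ME : (\int[gaussian n m]_A Phi (bilin A) = gavgs (glist M) Phi (fun=> 0%R))%E.
  rewrite -integral_gaussian; last exact: fPhi.
  apply: eq_integral => A _; congr Phi.
  by apply/funext => p; rewrite add0r mxdot_mulmx.
suff H : (gavgs (glist M) Phi (fun=> 0%R) <=
   (\int[gaussian n 1]_g (expR (s * mu * softlin b y g))%:E) *
   (\int[gaussian m 1]_h (expR (mu * softlin b x h))%:E))%E by move: H; rewrite -ME.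
(* a common shift z of all coordinates changes softminmax by s * mu * z *)
have shift (u : I * J -> R) z : softminmax r s b (fun p => u p + z * 1) = s * mu * z + softminmax r s b u.
  rewrite /softminmax mulr1.
  have -> : (fun i : I => s * lse (fun j : J => b * (u (i, j) + z))) =
            (fun i : I => s * (b * z) + s * lse (fun j : J => b * u (i, j))).
    apply/funext => i; rewrite -mulrDr -(lse_shift j0); congr (_ * lse _).
    by apply/funext => j; rewrite mulrDr addrC.
  by rewrite (lse_shift i0) mulrDr -rb; ring.
apply: (@le_trans _ _ (gavgs ((fun=> 1) :: glist M) Phi (fun=> 0))).
  rewrite /= -gavgs_gavgC//; apply: gavgs_le => //; first exact: functional_gavg.
  move=> u; rewrite /gavg.
  under eq_integral do rewrite /Phi shift expRD EFinM.
  rewrite ge0_integralZr ?lee_fin ?expR_ge0//; last first.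
    by apply/measurable_EFinP/measurableT_comp => //; exact: measurable_funM.
  rewrite normal_mgf -EFinM lee_fin ler_peMl ?expR_ge0//.
  by rewrite -expR0 ler_expR mulr_ge0// sqr_ge0.
apply: (@le_trans _ _ (gavgs (glist Y ++ glist X) Phi (fun=> 0))).
  have covM p p' : cov ((fun=> 1) :: glist M) p p' =
      1 + mxdot (x p.1) (x p'.1) * mxdot (y p.2) (y p'.2).
    by rewrite /cov big_cons mulr1 glist_cov mxdot_rank1.
  have covXY p p' : cov (glist Y ++ glist X) p p' =
      mxdot (y p.2) (y p'.2) + mxdot (x p.1) (x p'.1).
    by rewrite cov_glist_cat /X mxdotZl mxdotZr mulrA -expr2 s2 mul1r.
  apply: gordon_comparison => //; first by rewrite r0 r1.
    by move=> i j j'; rewrite covM covXY /= x1; ring.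
  move=> p p'; rewrite covM covXY.
  have h1 := unit_mxdot_le1 (x1 p.1) (x1 p'.1).
  have h2 := unit_mxdot_le1 (y1 p.2) (y1 p'.2).
  have : 0 <= (1 - mxdot (x p.1) (x p'.1)) * (1 - mxdot (y p.2) (y p'.2)).
    by rewrite mulr_ge0// subr_ge0.
  by lra.
rewrite integral_gaussian2// -integral_prod_split; last 4 first.
- by apply: measurableT_comp => //; apply: measurable_funM => //; exact: measurable_softlin.
- by apply: measurableT_comp => //; apply: measurable_funM => //; exact: measurable_softlin.
- by move=> g; exact: expR_ge0.
- by move=> g; exact: expR_ge0.
rewrite le_eqVlt; apply/orP; left; apply/eqP.
apply: eq_integral => g _; apply: eq_integral => h _; congr EFin.
rewrite -expRD; congr expR; rewrite /softminmax.
have -> : (fun i : I => s * lse (fun j : J => b * (mxdot g (Y (i, j)) + mxdot h (X (i, j))))) =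
    (fun i : I => s * lse (fun j : J => b * mxdot g (y j)) + b * mxdot h (x i)).
  apply/funext => i.
  have -> : (fun j : J => b * (mxdot g (Y (i, j)) + mxdot h (X (i, j)))) =
     (fun j : J => b * (s * mxdot h (x i)) + b * mxdot g (y j)).
    by apply/funext => j; rewrite /X mxdotZr /=; ring.
  rewrite (lse_shift j0) mulrDr addrC; congr (_ + _).
  by transitivity (s ^+ 2 * (b * mxdot h (x i))); [ring|rewrite s2 mul1r].
rewrite (lse_shift i0) -[s * mu * _]mulrA -(softlinE y g) -(softlinE x h); ring.
Qed.

Let mgfx := concentrated_mgf (@measurable_softlin R m I b x)
  (softlin_concentrated i0 x1 b0).
Let mgfy := concentrated_mgf (@measurable_softlin R n J b y)
  (softlin_concentrated j0 y1 b0).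

Let msoft s : measurable_fun setT (fun A => (expR (softminmax r s b (bilin A)))%:E).
Proof.
apply: ((functional_softminmax r s b).2 _ _ (fun p A => bilin A p)) => p.
under eq_fun do rewrite /bilin -mxdot_mulmx; exact: measurable_mxdot.
Qed.

(** Exponential Markov inequality for - mu * min_i max_j <A x_i, y_j>, with
    Gordon's comparison for s = - 1; the two smoothed maxima are then replaced by
    their means at the cost of exp (mu ^ 2) each. *)
Theorem minmax_tail (B : set 'M[R]_(n, m)) (c : R) : measurable B ->
  ln #|J|%:R <= b ->
  (forall A, B A -> exists i, forall j, mxdot (A *m x i) (y j) <= c) ->
  (gaussian n m B <= (expR (mu * (c + 1 + mx - my) + 2 * mu ^+ 2))%:E)%E.
Proof.
move=> mB Jb Bc.
apply: (le_trans (@prob_markov _ _ (gaussian n m) _ B (- (mu * (c + 1))) mB (msoft (-1)) _ _)).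
- by move=> A; rewrite lee_fin expR_ge0.
- move=> A /Bc[i Ac]; rewrite lee_fin ler_expR /softminmax.
  have h1 : lse (fun j : J => b * bilin A (i, j)) <= b * (c + 1).
    rewrite mulrDr mulr1; apply: (le_trans (@lse_le R J j0 _ (b * c) _)).
      by move=> j; rewrite ler_pM2l//; exact: Ac.
    by rewrite lerD2l.
  have h2 := lse_ge i0 (fun i : I => -1 * lse (fun j : J => b * bilin A (i, j))) i.
  rewrite -rb -mulrA -mulrN; apply: ler_wpM2l => //.
  by apply: le_trans h2; rewrite mulN1r lerN2.
rewrite opprK; have := soft_gordon (s := -1); rewrite sqrrN expr1n mulN1r => /(_ erefl) H.
apply: le_trans (lee_wpmul2l _ H) _; first by rewrite lee_fin expR_ge0.
have [_ hy] := mgfy mu0; have [hx _] := mgfx mu0.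
have : ((\int[gaussian n 1]_g (expR (- mu * softlin b y g))%:E) *
   (\int[gaussian m 1]_h (expR (mu * softlin b x h))%:E) <=
   (expR (mu ^+ 2 - mu * my))%:E * (expR (mu ^+ 2 + mu * mx))%:E)%E.
  by apply: lee_pmul => //; apply: integral_ge0 => g _; rewrite lee_fin expR_ge0.
move=> /(lee_wpmul2l (_ : 0 <= (expR (mu * (c + 1)))%:E)%E) h.
apply: (le_trans (h _)); first by rewrite lee_fin expR_ge0.
by rewrite -!EFinM -!expRD lee_fin ler_expR; lra.
Qed.

Theorem max_tail (B : set 'M[R]_(n, m)) (c : R) : measurable B ->
  (forall A, B A -> exists i j, c <= mxdot (A *m x i) (y j)) ->
  (gaussian n m B <= (expR (- mu * c + mu * (mx + my) + 2 * mu ^+ 2))%:E)%E.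
Proof.
move=> mB Bc.
apply: (le_trans (@prob_markov _ _ (gaussian n m) _ B (mu * c) mB (msoft 1) _ _)).
- by move=> A; rewrite lee_fin expR_ge0.
- move=> A /Bc[i [j Ac]]; rewrite lee_fin ler_expR /softminmax.
  have h1 := lse_ge j0 (fun j : J => b * bilin A (i, j)) j.
  have h2 := lse_ge i0 (fun i : I => 1 * lse (fun j : J => b * bilin A (i, j))) i.
  rewrite -rb -mulrA; apply: ler_wpM2l => //.
  apply: le_trans h2; rewrite mul1r; apply: le_trans h1.
  by rewrite ler_pM2l//; exact: Ac.
have := soft_gordon (s := 1); rewrite expr1n mul1r => /(_ erefl) H.
apply: le_trans (lee_wpmul2l _ H) _; first by rewrite lee_fin expR_ge0.
have [hy _] := mgfy mu0; have [hx _] := mgfx mu0.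
have : ((\int[gaussian n 1]_g (expR (mu * softlin b y g))%:E) *
   (\int[gaussian m 1]_h (expR (mu * softlin b x h))%:E) <=
   (expR (mu ^+ 2 + mu * my))%:E * (expR (mu ^+ 2 + mu * mx))%:E)%E.
  by apply: lee_pmul => //; apply: integral_ge0 => g _; rewrite lee_fin expR_ge0.
move=> /(lee_wpmul2l (_ : 0 <= (expR (- (mu * c)))%:E)%E) h.
apply: (le_trans (h _)); first by rewrite lee_fin expR_ge0.
by rewrite -!EFinM -!expRD lee_fin ler_expR; lra.
Qed.

End tails.

(** * Euclidean geometry of closed convex cones *)

Section euclid.
Context {R : realType}.

Lemma enorm_ge0 m (x : 'cV[R]_m) : 0 <= enorm x. Proof. exact: sqrtr_ge0. Qed.

Lemma enormE m (x : 'cV[R]_m) : enorm x = Num.sqrt (mxdot x x).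
Proof. by congr Num.sqrt; apply: eq_bigr => i _; rewrite big_ord1 expr2. Qed.

Lemma enorm_sqr m (x : 'cV[R]_m) : enorm x ^+ 2 = mxdot x x.
Proof. by rewrite enormE sqr_sqrtr// mxdot_ge0. Qed.

Lemma enorm0 m : enorm (0 : 'cV[R]_m) = 0.
Proof. by rewrite enormE mxdot0l sqrtr0. Qed.

Lemma enorm_eq0 m (x : 'cV[R]_m) : enorm x = 0 -> x = 0.
Proof. by move=> x0; apply: mxdot_eq0; rewrite -enorm_sqr x0 expr0n. Qed.

Lemma enorm_gt0 m (x : 'cV[R]_m) : x != 0 -> 0 < enorm x.
Proof.
move=> x0; rewrite lt_neqAle enorm_ge0 andbT eq_sym.
by apply: contra_neq x0; exact: enorm_eq0.
Qed.

Lemma enormZ m (c : R) (x : 'cV[R]_m) : enorm (c *: x) = `|c| * enorm x.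
Proof.
by rewrite !enormE mxdotZl mxdotZr mulrA -expr2 sqrtrM ?sqr_ge0// sqrtr_sqr.
Qed.

Lemma enormN m (x : 'cV[R]_m) : enorm (- x) = enorm x.
Proof. by rewrite -scaleN1r enormZ normrN1 mul1r. Qed.

Lemma enormB m (x y : 'cV[R]_m) : enorm (x - y) = enorm (y - x).
Proof. by rewrite -enormN opprB. Qed.

Lemma enorm_le m (x y : 'cV[R]_m) : (enorm x <= enorm y) = (mxdot x x <= mxdot y y).
Proof. by rewrite -!enorm_sqr ler_pXn2r// nnegrE enorm_ge0. Qed.

Lemma enorm_le_sqr m (x : 'cV[R]_m) (c : R) : 0 <= c -> mxdot x x <= c ^+ 2 -> enorm x <= c.
Proof. by move=> c0; rewrite -enorm_sqr ler_pXn2r// nnegrE ?enorm_ge0. Qed.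

Lemma cauchy_schwarz m (x y : 'cV[R]_m) : mxdot x y <= enorm x * enorm y.
Proof.
have [->|y0] := eqVneq y 0; first by rewrite mxdot0r enorm0 mulr0.
have [->|x0] := eqVneq x 0; first by rewrite mxdot0l enorm0 mul0r.
have hx := enorm_gt0 x0; have hy := enorm_gt0 y0.
have := mxdot_ge0 (enorm y *: x - enorm x *: y).
rewrite mxdotBl !mxdotBr !mxdotZl !mxdotZr -!enorm_sqr (mxdotC y x) => h.
have : 0 <= 2 * (enorm x * enorm y) * (enorm x * enorm y - mxdot x y) by lra.
by rewrite pmulr_rge0 ?subr_ge0// !mulr_gt0.
Qed.

Lemma cauchy_schwarz_norm m (x y : 'cV[R]_m) : `|mxdot x y| <= enorm x * enorm y.
Proof.
rewrite ler_norml cauchy_schwarz andbT lerNl -mxdotNl.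
by rewrite -(enormN x) cauchy_schwarz.
Qed.

Lemma enormD m (x y : 'cV[R]_m) : enorm (x + y) <= enorm x + enorm y.
Proof.
apply: enorm_le_sqr; first by rewrite addr_ge0// enorm_ge0.
rewrite mxdotDl !mxdotDr (mxdotC y x) -!enorm_sqr.
have := cauchy_schwarz x y; lra.
Qed.

Lemma enorm_coef m (x : 'cV[R]_m) i j : `|x i j| <= enorm x.
Proof.
rewrite ord1 -sqrtr_sqr ler_sqrt; last by apply: sumr_ge0 => k _; rewrite sqr_ge0.
by rewrite (bigD1 i)//= lerDl sumr_ge0// => k _; rewrite sqr_ge0.
Qed.

Lemma mx_norm_le n m (A : 'M[R]_(n, m)) (c : R) : 0 <= c ->
  (forall i j, `|A i j| <= c) -> `|A| <= c.
Proof.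
move=> c0 Ac; rewrite [leLHS]/Num.norm/= mx_normrE.
by apply: bigmax_le => // -[i j] _; exact: Ac.
Qed.

Lemma enorm_le_mx_norm m (x : 'cV[R]_m) : enorm x <= m%:R * `|x|.
Proof.
apply: enorm_le_sqr; first by rewrite mulr_ge0.
apply: (@le_trans _ _ (\sum_(i < m) `|x| ^+ 2)).
  apply: ler_sum => i _; rewrite big_ord1 -expr2 -[leLHS]real_normK ?num_real//.
  by rewrite lerXn2r ?nnegrE// mx_norm_coef.
rewrite sumr_const card_ord exprMn -[leLHS]mulr_natl.
apply: ler_wpM2r; first exact: sqr_ge0.
by rewrite -natrX ler_nat; case: (m) => // k; rewrite expnS expn1 leq_pmulr.
Qed.

Lemma enorm_continuous m : continuous (@enorm R m).
Proof.
apply: (@mx_lipschitz_continuous _ _ _ _ m%:R) => A B.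
rewrite -lerBlDl; apply: le_trans (enorm_le_mx_norm _).
by rewrite lerBlDr -[X in enorm X](subrK B) enormD.
Qed.

Lemma trmx_rV_continuous m : continuous (trmx : 'rV[R]_m -> 'cV[R]_m).
Proof.
move=> A; apply/(@cvgrPdist_le _ _ _ (nbhs A) (nbhs_filter A)) => e e0.
apply: filterS (nbhsx_ballx A _ e0) => B; rewrite -ball_normE /= => /ltW AB.
apply: mx_norm_le; first exact: ltW.
by move=> i j; apply: le_trans AB; rewrite !mxE; have := mx_norm_coef (A - B) j i; rewrite !mxE.
Qed.

(** Heine-Borel for the Euclidean norm, transported from row vectors. *)
Lemma cV_compact m (A : set 'cV[R]_m) (r : R) : closed A ->
  (forall x, A x -> enorm x <= r) -> compact A.
Proof.
move=> cA Ar.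
pose B := [set v : 'rV[R]_m | forall i, v ord0 i \in `[- r, r]].
have cB : compact B.
  apply: (@rV_compact _ _ (fun=> `[- r, r]%classic)) => _; exact: segment_compact.
have cB' : compact (trmx @` B).
  apply: continuous_compact => //; apply: continuous_subspaceT.
  exact: trmx_rV_continuous.
apply: subclosed_compact cA cB' _ => x Ax.
exists x^T; last by rewrite trmxK.
move=> i; rewrite mxE in_itv/= -ler_norml.
by apply: le_trans (Ar x Ax); exact: enorm_coef.
Qed.

Lemma mulmx_le n m (A : 'M[R]_(n, m)) (x : 'cV[R]_m) :
  enorm (A *m x) <= n%:R * m%:R * `|A| * enorm x.
Proof.
apply: (le_trans (enorm_le_mx_norm _)); rewrite -!mulrA; apply: ler_wpM2l => //.
apply: mx_norm_le; first by rewrite !mulr_ge0// enorm_ge0.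
move=> i j; rewrite mxE (le_trans (ler_norm_sum _ _ _))//.
apply: (@le_trans _ _ (\sum_(k < m) `|A| * enorm x)).
  by apply: ler_sum => k _; rewrite normrM ler_pM// ?mx_norm_coef// enorm_coef.
by rewrite sumr_const card_ord mulr_natl.
Qed.

End euclid.

Section cones.
Context {R : realType} {m : nat}.
Variable C : set 'cV[R]_m.
Hypothesis coneC : closed_convex_cone C.

Lemma coneZ (t : R) x : 0 <= t -> C x -> C (t *: x).
Proof. by case: coneC => _ _; apply. Qed.

Lemma coneD x y : C x -> C y -> C (x + y).
Proof.
move=> Cx Cy.
have h0 : (0 : R) <= 1 / 2 by [].
have h1 : (1 / 2 : R) <= 1 by lra.
have [_ /(_ x y (Itv01 h0 h1))] := coneC.
rewrite !inE => /(_ Cx Cy) /= H _.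
have := coneZ (ler0n R 2) H.
rewrite [conv _ _ _](_ : _ = (1 / 2) *: x + (1 - 1 / 2) *: y)//.
rewrite scalerDr !scalerA.
have -> : 2 * (1 / 2) = 1 :> R by field.
have -> : 2 * (1 - 1 / 2) = 1 :> R by field.
by rewrite !scale1r.
Qed.

Lemma cone0 x : C x -> C 0.
Proof. by move=> Cx; rewrite -(scale0r x); exact: coneZ. Qed.

Hypothesis C0 : C 0.

(** Points of the cone of norm above 2 |y| are farther from y than 0 is, so the
    minimum is over a compact set. *)
Lemma proj_exists (y : 'cV[R]_m) :
  exists p, C p /\ forall z, C z -> enorm (y - p) <= enorm (y - z).
Proof.
pose K := C `&` [set z | enorm z <= 2 * enorm y].
have cK : compact K.
  apply: (@cV_compact _ _ _ (2 * enorm y)); last by move=> x [].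
  apply: closedI; first by case: coneC.
  rewrite (_ : [set z | _] = @enorm R m @^-1` `]-oo, 2 * enorm y]%classic).
    by apply: closed_comp; [move=> x _; exact: enorm_continuous|exact: interval_closed].
  by apply/seteqP; split=> z /=; rewrite in_itv.
have cf : continuous (fun z : 'cV[R]_m => enorm (y - z)).
  apply: (@mx_lipschitz_continuous _ _ _ _ m%:R) => A B.
  rewrite -lerBlDl -[`|A - B|]normrN opprB; apply: le_trans (enorm_le_mx_norm _).
  rewrite lerBlDr -[y - A](subrK (y - B)); apply: le_trans (enormD _ _) _.
  rewrite lerD2r (_ : y - A - (y - B) = B - A)//.
  by rewrite opprB addrC addrA subrK.
have [|p /set_mem[Cp py] pmin] := @compact_EVT_min _ R _ K _ cK (continuous_subspaceT cf).
  by exists 0; split => //=; rewrite enorm0 mulr_ge0// enorm_ge0.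
exists p; split=> // z Cz.
have [zy|zy] := leP (enorm z) (2 * enorm y); first by apply: pmin; rewrite inE.
apply: (@le_trans _ _ (enorm (y - 0))).
  by apply: pmin; rewrite inE; split => //=; rewrite enorm0 mulr_ge0// enorm_ge0.
rewrite subr0.
have := enormD (z - y) y; rewrite subrK (enormB z); lra.
Qed.

Definition pnorm y : R := enorm (Defs.proj C y).

Lemma projP y : C (Defs.proj C y) /\ forall z, C z -> enorm (y - Defs.proj C y) <= enorm (y - z).
Proof. by rewrite /Defs.proj; case: xgetP => [p -> //|]; have [p Hp] := proj_exists y; move=> /(_ p). Qed.

(** Otherwise moving from the projection a little in direction z comes closer to
    y. *)
Lemma proj_dot_le y z : C z -> mxdot (y - Defs.proj C y) z <= 0.
Proof.
move=> Cz; have [Cp pmin] := projP y; set p := Defs.proj C y in Cp pmin *.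
rewrite leNgt; apply/negP => pos.
have z0 : 0 < mxdot z z.
  rewrite lt_neqAle mxdot_ge0 andbT eq_sym; apply/eqP => /mxdot_eq0 z0.
  by move: pos; rewrite z0 mxdot0r ltxx.
pose t := mxdot (y - p) z / mxdot z z.
have t0 : 0 < t by rewrite divr_gt0.
have := pmin _ (coneD Cp (coneZ (ltW t0) Cz)).
have tz : t * mxdot z z = mxdot (y - p) z by rewrite /t divfK// gt_eqF.
rewrite enorm_le opprD addrA; move: (y - p) pos tz => w pos tz.
rewrite mxdotBl !mxdotBr !mxdotZl !mxdotZr (mxdotC z) tz.
have : 0 < t * mxdot w z by rewrite mulr_gt0.
by lra.
Qed.

(** The derivative of t |-> |y - t p| ^ 2 vanishes at t = 1, where p is the
    projection; moving to larger t is covered by the previous lemma. *)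
Lemma proj_dot_self y : mxdot y (Defs.proj C y) = pnorm y ^+ 2.
Proof.
rewrite /pnorm enorm_sqr; apply/eqP; rewrite -subr_eq0 -mxdotBl.
have [Cp pmin] := projP y; rewrite eq_le proj_dot_le//=.
set p := Defs.proj C y in Cp pmin *.
rewrite leNgt; apply/negP => neg.
have p0 : 0 < mxdot p p.
  rewrite lt_neqAle mxdot_ge0 andbT eq_sym; apply/eqP => /mxdot_eq0 p0.
  by move: neg; rewrite p0 mxdot0r ltxx.
pose t := Num.min 1 (- mxdot (y - p) p / mxdot p p).
have t0 : 0 < t by rewrite lt_min ltr01 divr_gt0// oppr_gt0.
have t1 : t <= 1 by rewrite ge_min lexx.
have tp : t * mxdot p p <= - mxdot (y - p) p.
  by rewrite -ler_pdivlMr// ge_min lexx orbT.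
have := pmin _ (coneZ (_ : 0 <= 1 - t) Cp); rewrite subr_ge0 => /(_ t1).
rewrite scalerBl scale1r opprB addrCA addrC enorm_le.
move: t t0 t1 tp => t t0 t1; move: (y - p) neg => w neg tp.
rewrite mxdotDl !mxdotDr !mxdotZl !mxdotZr (mxdotC p).
have := ler_wpM2l (ltW t0) tp.
have : 0 < t * - mxdot w p by rewrite mulr_gt0// oppr_gt0.
lra.
Qed.

Lemma pnorm_ge0 y : 0 <= pnorm y. Proof. exact: enorm_ge0. Qed.

(** With [pnorm_unit]: |Pi_C(y)| is the maximum of <y, z> over unit vectors z of
    C, unless it is 0. *)
Lemma dot_le_pnorm y z : C z -> mxdot y z <= pnorm y * enorm z.
Proof.
move=> Cz; have := proj_dot_le y Cz; rewrite mxdotBl subr_le0 => h.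
by apply: (le_trans h); exact: cauchy_schwarz.
Qed.

Lemma pnorm_lipschitz y y' : pnorm y <= pnorm y' + enorm (y - y').
Proof.
have [->|p0] := eqVneq (pnorm y) 0; first by rewrite addr_ge0 ?enorm_ge0.
have pp : 0 < pnorm y by rewrite lt_neqAle eq_sym p0 pnorm_ge0.
rewrite -(ler_pM2r pp) -expr2 -proj_dot_self.
rewrite -[y in mxdot y](subrK y') mxdotDl addrC mulrDl lerD//.
  exact/dot_le_pnorm/(projP y).1.
exact: cauchy_schwarz.
Qed.

Lemma pnorm_le y : pnorm y <= enorm y.
Proof.
have [->|p0] := eqVneq (pnorm y) 0; first exact: enorm_ge0.
have pp : 0 < pnorm y by rewrite lt_neqAle eq_sym p0 pnorm_ge0.
rewrite -(ler_pM2r pp) -expr2 -proj_dot_self; exact: cauchy_schwarz.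
Qed.

Lemma pnorm_unit y : pnorm y != 0 ->
  exists z, [/\ C z, enorm z = 1 & mxdot y z = pnorm y].
Proof.
move=> p0; have pp : 0 < pnorm y by rewrite lt_neqAle eq_sym p0 pnorm_ge0.
exists ((pnorm y)^-1 *: Defs.proj C y); split.
- by apply: coneZ; [rewrite invr_ge0 ltW|exact: (projP y).1].
- by rewrite enormZ ger0_norm ?invr_ge0 ?ltW// mulVf.
- by rewrite mxdotZr proj_dot_self expr2 mulKf.
Qed.

End cones.

(** * Operator norm, restricted singular values and condition number *)

Section opnorm.
Context {R : realType} {n m : nat}.
Implicit Types A B : 'M[R]_(n, m).

Lemma opnorm_has_sup A :
  has_sup [set enorm (A *m x) | x in [set x : 'cV[R]_m | enorm x <= 1]].
Proof.
split; first by exists (enorm (A *m 0)), 0 => //=; rewrite enorm0.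
exists (n%:R * m%:R * `|A|) => _ [x /= x1 <-].
apply: (le_trans (mulmx_le _ _)); rewrite -[leRHS]mulr1.
by apply: ler_wpM2l => //; rewrite !mulr_ge0.
Qed.

Lemma mulmx_le_opnorm A x : enorm (A *m x) <= opnorm A * enorm x.
Proof.
have [->|x0] := eqVneq x 0; first by rewrite mulmx0 !enorm0 mulr0.
have xp := enorm_gt0 x0; have xV : 0 <= (enorm x)^-1 by rewrite invr_ge0 ltW.
have : enorm (A *m ((enorm x)^-1 *: x)) <= opnorm A.
  apply: sup_upper_bound; first exact: opnorm_has_sup.
  exists ((enorm x)^-1 *: x) => //=.
  by rewrite enormZ (ger0_norm xV) mulVf ?gt_eqF.
by rewrite -scalemxAr enormZ (ger0_norm xV) mulrC ler_pdivrMr.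
Qed.

Lemma opnorm_ub A (c : R) : (forall x, enorm x <= 1 -> enorm (A *m x) <= c) ->
  opnorm A <= c.
Proof.
move=> Ac; apply: ge_sup; first by case: (opnorm_has_sup A).
by move=> _ [x /= x1 <-]; exact: Ac.
Qed.

Lemma opnorm_ge0 A : 0 <= opnorm A.
Proof.
apply: sup_upper_bound; first exact: opnorm_has_sup.
by exists 0; [rewrite /= enorm0 ler01|rewrite mulmx0 enorm0].
Qed.

Lemma opnorm_lipschitz A B : opnorm A <= opnorm B + n%:R * m%:R * `|A - B|.
Proof.
apply: opnorm_ub => x x1; rewrite -[A in A *m x](subrK B) mulmxDl addrC.
apply: (le_trans (enormD _ _)); apply: lerD.
  apply: (le_trans (mulmx_le_opnorm _ _)); rewrite -[leRHS]mulr1.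
  by apply: ler_wpM2l => //; exact: opnorm_ge0.
apply: (le_trans (mulmx_le _ _)); rewrite -[leRHS]mulr1.
by apply: ler_wpM2l => //; rewrite !mulr_ge0.
Qed.

Variables (C : set 'cV[R]_m) (D : set 'cV[R]_n).
Hypotheses (coneC : closed_convex_cone C) (coneD : closed_convex_cone D).
Hypotheses (C0 : nonzero_cone C) (D0 : D 0).

Lemma cone_unit : exists x, C x /\ enorm x = 1.
Proof.
have [x Cx x0] := C0; exists ((enorm x)^-1 *: x).
have xp := enorm_gt0 x0; have xV : 0 <= (enorm x)^-1 by rewrite invr_ge0 ltW.
split; first exact: coneZ.
by rewrite enormZ (ger0_norm xV) mulVf ?gt_eqF.
Qed.

Lemma rsv_lb A (c : R) : (forall x, C x -> enorm x = 1 -> c <= pnorm D (A *m x)) ->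
  c <= rsv C D A.
Proof.
move=> h; apply: lb_le_inf.
  by have [x [Cx x1]] := cone_unit; exists (enorm (Defs.proj D (A *m x))), x.
by move=> _ [x [Cx x1] <-]; exact: h.
Qed.

Lemma rsv_le A x : C x -> enorm x = 1 -> rsv C D A <= pnorm D (A *m x).
Proof.
move=> Cx x1; apply: ge_inf; last by exists x.
by exists 0 => _ [z _ <-]; exact: enorm_ge0.
Qed.

Lemma rsv_ge0 A : 0 <= rsv C D A.
Proof. by apply: rsv_lb => x _ _; exact: enorm_ge0. Qed.

Lemma rsv_lipschitz A B : rsv C D A <= rsv C D B + n%:R * m%:R * `|A - B|.
Proof.
rewrite -lerBlDr; apply: rsv_lb => x Cx x1; rewrite lerBlDr.
apply: (le_trans (rsv_le A Cx x1)).
apply: (le_trans (pnorm_lipschitz coneD D0 _ (B *m x))); rewrite lerD2l -mulmxBl.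
by apply: (le_trans (mulmx_le _ _)); rewrite x1 mulr1.
Qed.

End opnorm.

Section renegar.
Context {R : realType} {n m : nat}.
Notation RT := (measurableTypeR R).
Variables (C : set 'cV[R]_m) (D : set 'cV[R]_n).
Hypotheses (coneC : closed_convex_cone C) (coneD : closed_convex_cone D).
Hypotheses (C0 : nonzero_cone C) (D0 : nonzero_cone D).

Lemma nonzero_cone_0 k (K : set 'cV[R]_k) : closed_convex_cone K ->
  nonzero_cone K -> K 0.
Proof. by move=> cK [x Kx _]; exact: cone0 Kx. Qed.

Lemma measurable_opnorm : measurable_fun setT (@opnorm R n m : _ -> RT).
Proof. by apply: mx_lipschitz_measurable => A B; exact: opnorm_lipschitz. Qed.

Lemma measurable_rsv : measurable_fun setT (rsv C D : 'M[R]_(n, m) -> RT).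
Proof.
apply: mx_lipschitz_measurable => A B; apply: rsv_lipschitz => //.
exact: nonzero_cone_0 D0.
Qed.

Lemma rsvT_lipschitz (A B : 'M[R]_(n, m)) :
  rsv D C (- A^T) <= rsv D C (- B^T) + m%:R * n%:R * `|A - B|.
Proof.
apply: (le_trans (rsv_lipschitz coneD coneC D0 (nonzero_cone_0 coneC C0) _ (- B^T))).
rewrite lerD2l; apply: ler_wpM2l; first by rewrite mulr_ge0.
rewrite opprK addrC -[`|A - B|]normrN opprB -linearB.
by apply: mx_norm_le => // i j; rewrite mxE mx_norm_coef.
Qed.

Lemma measurable_rsvT :
  measurable_fun setT ((fun A => rsv D C (- A^T)) : 'M[R]_(n, m) -> RT).
Proof. by apply: mx_lipschitz_measurable => A B; exact: rsvT_lipschitz. Qed.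

(** Away from the zeros of g, the inverse is exp (- ln g). *)
Lemma measurable_quot_oo d (T : measurableType d) (f g : T -> R) :
  measurable_fun setT (f : T -> RT) -> measurable_fun setT (g : T -> RT) ->
  (forall x, 0 <= g x) -> measurable_fun setT (fun x => quot_oo (f x) (g x)).
Proof.
move=> mf mg g0.
rewrite (_ : (fun x => quot_oo _ _) =
    (fun x => if g x == 0 then +oo%E else (f x * expR (- ln (g x)))%:E)).
  apply: measurable_fun_ifT => //.
    by apply: measurable_fun_eqr => //; exact: measurable_cst.
  apply/measurable_EFinP; apply: measurable_funM => //.
  apply: measurableT_comp => //; apply: measurableT_comp => //.
  exact: measurableT_comp.
apply/funext => x; rewrite /quot_oo; have [//|gx] := eqVneq (g x) 0.
by rewrite expRN lnK// posrE lt_neqAle eq_sym gx g0.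
Qed.

Lemma measurable_renegar : measurable_fun setT (renegar C D : 'M[R]_(n, m) -> \bar R).
Proof.
apply: measurable_mine; apply: measurable_quot_oo.
- exact: measurable_opnorm.
- exact: measurable_rsv.
- by move=> A; exact: rsv_ge0.
- exact: measurable_opnorm.
- exact: measurable_rsvT.
- by move=> A; exact: rsv_ge0.
Qed.

Lemma renegar_ge0 (A : 'M[R]_(n, m)) : (0 <= renegar C D A)%E.
Proof.
have q0 (a b : R) : 0 <= a -> 0 <= b -> (0 <= quot_oo a b)%E.
  by move=> a0 b0; rewrite /quot_oo; case: ifP => _; rewrite ?leey// lee_fin divr_ge0.
rewrite le_min !q0 ?opnorm_ge0 ?rsv_ge0//.
Qed.

Let quot_le (a b K c : R) : 0 <= a -> a <= K -> 0 < c -> c <= b ->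
  (quot_oo a b <= (K / c)%:E)%E.
Proof.
move=> a0 aK c0 cb; have b0 : 0 < b by exact: lt_le_trans cb.
rewrite /quot_oo gt_eqF// lee_fin; apply: ler_pM => //.
  by rewrite invr_ge0 ltW.
by rewrite lef_pV2 ?posrE.
Qed.

Lemma renegar_le (A : 'M[R]_(n, m)) (K c : R) : opnorm A <= K -> 0 < c ->
  c <= rsv C D A \/ c <= rsv D C (- A^T) -> (renegar C D A <= (K / c)%:E)%E.
Proof.
move=> AK c0 h; rewrite ge_min; apply/orP.
by case: h => h; [left|right]; apply: quot_le => //; exact: opnorm_ge0.
Qed.

End renegar.

(** * Existence of a well-posed matrix *)

Section positive_rsv.
Context {R : realType} {n m : nat}.
Variables (C : set 'cV[R]_m) (D : set 'cV[R]_n).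
Hypotheses (coneC : closed_convex_cone C) (coneD : closed_convex_cone D).
Hypotheses (C0 : nonzero_cone C) (D0 : nonzero_cone D).

Lemma enorm_sphere_compact (F : set 'cV[R]_m) : closed F ->
  compact (F `&` [set x | enorm x = 1]).
Proof.
move=> cF; apply: (@cV_compact _ _ _ 1); last by move=> x [_ ->].
apply: closedI => //.
rewrite (_ : [set x | _] = @enorm R m @^-1` [set 1]) //.
by apply: closed_comp; [move=> x _; exact: enorm_continuous|exact: closed_eq].
Qed.

Lemma sphere_subcover (F : set 'cV[R]_m) (U : 'cV[R]_m -> set 'cV[R]_m) :
  closed F -> (forall x, open (U x)) -> (forall x, F x -> enorm x = 1 -> U x x) ->
  exists s : seq 'cV[R]_m, (forall x, x \in s -> F x /\ enorm x = 1) /\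
    forall z, F z -> enorm z = 1 -> exists2 x, x \in s & U x z.
Proof.
move=> cF oU FU; have := enorm_sphere_compact cF.
rewrite compact_cover => /(_ _ (F `&` [set x | enorm x = 1]) U (fun x _ => oU x))[|K' K'K cov].
  by move=> x [Fx x1]; exists x => //; exact: FU.
exists (finmap.enum_fset K'); split=> [x xs|z Fz z1].
  by have /set_mem[] := K'K x xs.
by have [x xK' Ux] := cov z (conj Fz z1); exists x.
Qed.

(** The continuous function |Pi_D (A x)| attains its minimum over the unit vectors
    of C, and it is positive where A x has positive inner product with some
    element of D. *)
Lemma rsv_gt0 (A : 'M[R]_(n, m)) :
  (forall x, C x -> enorm x = 1 -> exists2 z, D z & 0 < mxdot (A *m x) z) ->
  0 < rsv C D A.
Proof.
move=> h; pose K := C `&` [set x | enorm x = 1].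
have cK : compact K by apply: enorm_sphere_compact; case: coneC.
have D00 := nonzero_cone_0 coneD D0.
have cf : continuous (fun x : 'cV[R]_m => pnorm D (A *m x)).
  apply: (@mx_lipschitz_continuous _ _ _ _ (n%:R * m%:R * `|A| * m%:R)) => x y.
  apply: (le_trans (pnorm_lipschitz coneD D00 _ (A *m y))); rewrite lerD2l -mulmxBr.
  apply: (le_trans (mulmx_le _ _)); rewrite -[leRHS]mulrA; apply: ler_wpM2l.
    by rewrite !mulr_ge0.
  exact: enorm_le_mx_norm.
have [|x /set_mem[Cx x1] xmin] := @compact_EVT_min _ R _ K _ cK (continuous_subspaceT cf).
  by have [x [Cx x1]] := cone_unit coneC C0; exists x.
have [z Dz Az] := h x Cx x1.
have px : 0 < pnorm D (A *m x).
  rewrite lt_neqAle pnorm_ge0 andbT eq_sym; apply/eqP => p0.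
  by have := dot_le_pnorm coneD D00 (A *m x) Dz; rewrite p0 mul0r leNgt Az.
apply: (lt_le_trans px); apply: rsv_lb => // y Cy y1.
by apply: xmin; rewrite inE.
Qed.

(** The vector Pi_C(- x) + x has nonnegative inner product with C, and a positive
    one with x unless - x is in C. By compactness a finite sum of these vectors
    works for all x in F. *)
Lemma cone_separation (F : set 'cV[R]_m) : closed F -> F `<=` C ->
  (forall x, F x -> enorm x = 1 -> ~ C (- x)) ->
  exists w : 'cV[R]_m, forall x, F x -> enorm x = 1 -> 0 < mxdot w x.
Proof.
move=> cF FC FN; pose K := F `&` [set x | enorm x = 1].
have C00 := nonzero_cone_0 coneC C0.
pose v x := Defs.proj C (- x) + x.
have v_ge0 x z : C z -> 0 <= mxdot (v x) z.
  move=> Cz; have := proj_dot_le coneC C00 (- x) Cz.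
  by rewrite -oppr_ge0 -mxdotNl opprB opprK.
have v_gt0 x : K x -> 0 < mxdot (v x) x.
  move=> [Fx x1]; have p2 := proj_dot_self coneC C00 (- x).
  have E : mxdot (v x) x = mxdot (v x) (v x).
    rewrite [in RHS]/v mxdotDr; apply/eqP; rewrite -subr_eq0 opprD addrCA subrr addr0.
    rewrite oppr_eq0 /v mxdotDl; move: p2; rewrite /pnorm enorm_sqr mxdotNl => <-.
    by rewrite addNr.
  rewrite E lt_neqAle mxdot_ge0 andbT eq_sym; apply/eqP => /mxdot_eq0 v0.
  apply: (FN x Fx x1); have [Cp _] := projP coneC C00 (- x).
  by rewrite (_ : - x = Defs.proj C (- x))//; apply/eqP; rewrite eq_sym -addr_eq0 -/(v x) v0.
have op x : open [set z | 0 < mxdot (v x) z].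
  rewrite (_ : [set z | _] = mxdot (v x) @^-1` `]0, +oo[%classic); last first.
    by apply/seteqP; split => z /=; rewrite in_itv/= andbT.
  apply: open_comp; last exact: interval_open.
  move=> z _; apply: (@mx_lipschitz_continuous _ _ _ _ (enorm (v x) * m%:R)) => a b.
  rewrite -lerBlDl -mxdotBr; apply: (le_trans (cauchy_schwarz _ _)).
  by rewrite -mulrA; apply: ler_wpM2l; [exact: enorm_ge0|exact: enorm_le_mx_norm].
have [s [_ cov]] := sphere_subcover cF op (fun x Fx x1 => v_gt0 x (conj Fx x1)).
exists (\sum_(x <- s) v x) => x Fx x1.
have vsum : mxdot (\sum_(x <- s) v x) x = \sum_(z <- s) mxdot (v z) x.
  by elim/big_ind2 : _ => [|a b c d <- <-|//]; rewrite ?mxdot0l ?mxdotDl.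
have [z zs /= zx] := cov x Fx x1.
rewrite vsum (big_rem z)//= ltr_pwDl//; apply: sumr_ge0 => y _.
by apply: v_ge0; exact: FC.
Qed.

End positive_rsv.

Section generic_wellposed.
Context {R : realType}.

(** Isometries of R^p into the lineality spaces of the two cones. *)
Definition lineal_pair n m (C : set 'cV[R]_m) (D : set 'cV[R]_n) p
    (E : 'M[R]_(m, p)) (F : 'M[R]_(n, p)) : Prop :=
  [/\ E^T *m E = 1%:M, F^T *m F = 1%:M & forall v, C (E *m v) /\ D (F *m v)].

Lemma mxdot_mul n p (F : 'M[R]_(n, p)) (u : 'cV[R]_p) (z : 'cV[R]_n) :
  mxdot (F *m u) z = mxdot u (F^T *m z).
Proof.
have dotE k (a b : 'cV[R]_k) : mxdot a b = (a^T *m b) 0 0.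
  by rewrite mxE; apply: eq_bigr => i _; rewrite big_ord1 mxE.
by rewrite !dotE trmx_mul mulmxA.
Qed.

(** Suppose that the image of E is the lineality space of C. If D contains some d
    != 0 orthogonal to the image of F, then A = F E^T + d w^T works, where w is
    positive on the part of C orthogonal to E: a vector x of C is sent to F E^T x,
    an element of D, plus a multiple of d, which is a positive one when E^T x = 0.
    If there is no such d then D is the image of F, and - A^T with A = F E^T sends
    a unit vector y of D to - E F^T y, a nonzero element of C. *)
Lemma wellposed_half n m (C : set 'cV[R]_m) (D : set 'cV[R]_n) p
    (E : 'M[R]_(m, p)) (F : 'M[R]_(n, p)) :
  closed_convex_cone C -> closed_convex_cone D ->
  nonzero_cone C -> nonzero_cone D -> lineal_pair C D E F ->
  (forall x, C x -> C (- x) -> x = E *m (E^T *m x)) ->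
  exists A : 'M[R]_(n, m), 0 < rsv C D A \/ 0 < rsv D C (- A^T).
Proof.
move=> cC cD C0 D0 [EE FF EF] linC.
have unit_neq0 k (x : 'cV[R]_k) : enorm x = 1 -> x != 0.
  by move=> x1; apply/eqP => x0; move: x1; rewrite x0 enorm0 => /esym/eqP; rewrite oner_eq0.
have dot_gt0 k (x : 'cV[R]_k) : x != 0 -> 0 < mxdot x x.
  by move=> x0; rewrite -enorm_sqr exprn_gt0// enorm_gt0.
(* whether D has a nonzero vector orthogonal to F *)
have [[d [Dd d0 Fd]]|noD] := pselect (exists d, [/\ D d, d != 0 & F^T *m d = 0]).
  pose K := C `&` [set x | E^T *m x = 0].
  have cK : closed K.
    apply: closedI; first by case: cC.
    rewrite (_ : [set x | _] = (fun x => enorm (E^T *m x)) @^-1` [set 0]); last first.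
      apply/seteqP; split => x /=; first by move=> ->; rewrite enorm0.
      exact: enorm_eq0.
    apply: closed_comp; last exact: closed_eq.
    move=> x _; apply: (@mx_lipschitz_continuous _ _ _ _ (p%:R * m%:R * `|E^T| * m%:R)) => a b.
    rewrite -lerBlDl; apply: (@le_trans _ _ (enorm (E^T *m (a - b)))).
      by rewrite lerBlDr mulmxBr -[X in enorm X <= _](subrK (E^T *m b)) enormD.
    apply: (le_trans (mulmx_le _ _)); rewrite -[leRHS]mulrA; apply: ler_wpM2l.
      by rewrite !mulr_ge0.
    exact: enorm_le_mx_norm.
  have [w wK] : exists w : 'cV[R]_m, forall x, K x -> enorm x = 1 -> 0 < mxdot w x.
    apply: (cone_separation cC C0 cK); first by move=> x [].
    move=> x [Cx Ex] x1 CNx; have := linC x Cx CNx.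
    by rewrite Ex mulmx0; apply/eqP; exact: unit_neq0.
  exists (F *m E^T + d *m w^T); left; apply: rsv_gt0 => // x Cx x1.
  have Ax : (F *m E^T + d *m w^T) *m x = F *m (E^T *m x) + mxdot w x *: d.
    rewrite mulmxDl -!mulmxA; congr (_ + _).
    rewrite (_ : w^T *m x = (mxdot w x)%:M) ?mul_mx_scalar//.
    apply/matrixP => i j; rewrite !ord1 !mxE eqxx mulr1n.
    by apply: eq_bigr => k _; rewrite big_ord1 mxE.
  have [Ex|Ex] := eqVneq (E^T *m x) 0.
    exists d => //; rewrite Ax Ex mulmx0 add0r mxdotZl mulr_gt0 ?dot_gt0//.
    exact: wK.
  exists (F *m (E^T *m x)); first by case: (EF (E^T *m x)).
  have dF : mxdot d (F *m (E^T *m x)) = 0 by rewrite mxdotC mxdot_mul Fd mxdot0r.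
  rewrite Ax mxdotDl mxdotZl dF mulr0 addr0 mxdot_mul [F^T *m _]mulmxA FF mul1mx.
  exact: dot_gt0.
exists (F *m E^T); right; apply: rsv_gt0 => // y Dy y1.
have yF : y = F *m (F^T *m y).
  apply: contrapT => /eqP; rewrite -subr_eq0 => h; apply: noD.
  exists (y - F *m (F^T *m y)); split => //.
    by rewrite -mulmxN; apply: coneD => //; case: (EF (- (F^T *m y))).
  by rewrite mulmxBr !mulmxA FF mul1mx subrr.
have Fy : F^T *m y != 0.
  by apply/eqP => Fy; have := unit_neq0 _ _ y1; rewrite yF Fy mulmx0 eqxx.
exists (E *m (- (F^T *m y))); first by case: (EF (- (F^T *m y))).
rewrite trmx_mul trmxK mulNmx -mulmxA mulmxN mxdotNl mxdotNr opprK.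
by rewrite mxdot_mul mulmxA EE mul1mx dot_gt0.
Qed.

Lemma lineal_pair_dim n m (C : set 'cV[R]_m) (D : set 'cV[R]_n) p
    (E : 'M[R]_(m, p)) (F : 'M[R]_(n, p)) : lineal_pair C D E F -> (p <= m)%N.
Proof.
move=> [EE _ _]; have := mulmx_max_rank E^T E; rewrite EE mxrank1; apply.
Qed.

(** Gram-Schmidt: one more orthonormal vector in each lineality space. *)
Lemma lineal_pair_extend n m (C : set 'cV[R]_m) (D : set 'cV[R]_n) p
    (E : 'M[R]_(m, p)) (F : 'M[R]_(n, p)) x y :
  closed_convex_cone C -> closed_convex_cone D -> lineal_pair C D E F ->
  C x -> C (- x) -> x != E *m (E^T *m x) -> D y -> D (- y) -> y != F *m (F^T *m y) ->
  exists (E' : 'M[R]_(m, p + 1)) (F' : 'M[R]_(n, p + 1)), lineal_pair C D E' F'.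
Proof.
move=> cC cD [EE FF EF] Cx CNx xE Dy DNy yF.
have ext k (K : set 'cV[R]_k) (G : 'M[R]_(k, p)) z : closed_convex_cone K ->
    G^T *m G = 1%:M -> (forall v, K (G *m v)) -> K z -> K (- z) ->
    z != G *m (G^T *m z) ->
    exists G' : 'M[R]_(k, p + 1), G'^T *m G' = 1%:M /\ forall v, K (G' *m v).
  move=> cK GG KG Kz KNz zG.
  pose e0 := z - G *m (G^T *m z).
  have e00 : 0 < enorm e0 by rewrite enorm_gt0// subr_eq0.
  pose e := (enorm e0)^-1 *: e0.
  have Ge : G^T *m e = 0.
    by rewrite -scalemxAr mulmxBr !mulmxA GG mul1mx subrr scaler0.
  have ee : e^T *m e = 1%:M.
    apply/matrixP => i j; rewrite !ord1 !mxE eqxx mulr1n.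
    transitivity (mxdot e e); first by apply: eq_bigr => l _; rewrite big_ord1 mxE.
    by rewrite mxdotZl mxdotZr -enorm_sqr; field; rewrite gt_eqF.
  have Ke (c : R) : K (c *: e).
    rewrite scalerA; move: (c / enorm e0) => t; rewrite /e0.
    have KG' v : K (- (G *m v)) by rewrite -mulmxN.
    have [t0|/ltW t0] := leP 0 t; first by apply: coneZ => //; exact: coneD.
    rewrite -[t]opprK scaleNr -scalerN opprB addrC.
    apply: coneZ => //; first by rewrite oppr_ge0.
    exact: coneD.
  exists (row_mx G e); split.
    rewrite tr_row_mx mul_col_row GG Ge ee.
    have -> : e^T *m G = 0 by apply: trmx_inj; rewrite trmx_mul trmxK Ge trmx0.
    by rewrite -scalar_mx_block.
  move=> v; rewrite -[v]vsubmxK mul_row_col; apply: coneD => //.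
  rewrite [dsubmx v]mx11_scalar mul_mx_scalar; exact: Ke.
have [E' [E1 E2]] := ext _ _ _ _ cC EE (fun v => (EF v).1) Cx CNx xE.
have [F' [F1 F2]] := ext _ _ _ _ cD FF (fun v => (EF v).2) Dy DNy yF.
by exists E', F'.
Qed.

(** For a pair of isometries with p maximal, one of the two lineality spaces is
    exhausted. The two cones play symmetric roles, up to replacing A by - A^T. *)
Theorem exists_wellposed n m (C : set 'cV[R]_m) (D : set 'cV[R]_n) :
  closed_convex_cone C -> closed_convex_cone D ->
  nonzero_cone C -> nonzero_cone D ->
  exists A : 'M[R]_(n, m), 0 < rsv C D A \/ 0 < rsv D C (- A^T).
Proof.
move=> cC cD C0 D0.
pose Q p := `[< exists (E : 'M[R]_(m, p)) (F : 'M[R]_(n, p)), lineal_pair C D E F >].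
have Q0 : exists p, Q p.
  exists 0%N; apply/asboolP; exists 0, 0; split.
  - by apply/matrixP => -[].
  - by apply/matrixP => -[].
  - by move=> v; rewrite !mul0mx; split; exact: nonzero_cone_0.
have Qm p : Q p -> (p <= m)%N by move=> /asboolP[E [F]]; exact: lineal_pair_dim.
case: (ex_maxnP Q0 Qm) => p /asboolP[E [F EF]] pmax.
have [linC|nlinC] := pselect (forall x, C x -> C (- x) -> x = E *m (E^T *m x)).
  exact: wellposed_half EF linC.
have [linD|nlinD] := pselect (forall y, D y -> D (- y) -> y = F *m (F^T *m y)).
  have FE : lineal_pair D C F E.
    by case: EF => ? ? h; split => // v; case: (h v).
  have [A h] := wellposed_half cD cC D0 C0 FE linD.
  by exists (- A^T); rewrite linearN/= trmxK opprK; case: h => h; [right|left].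
exfalso.
have [x [Cx CNx xE]] : exists x, [/\ C x, C (- x) & x != E *m (E^T *m x)].
  apply: contrapT => h; apply: nlinC => x Cx CNx; apply: contrapT => /eqP xE.
  by apply: h; exists x.
have [y [Dy DNy yF]] : exists y, [/\ D y, D (- y) & y != F *m (F^T *m y)].
  apply: contrapT => h; apply: nlinD => y Dy DNy; apply: contrapT => /eqP yF.
  by apply: h; exists y.
have [E' [F' EF']] := lineal_pair_extend cC cD EF Cx CNx xE Dy DNy yF.
have : Q (p + 1)%N by apply/asboolP; exists E', F'.
by move=> /pmax; rewrite addn1 ltnn.
Qed.

End generic_wellposed.

(** * Support and second moments of the Gaussian law *)

Section gaussian_support.
Context {R : realType}.
Notation RT := (measurableTypeR R).

Lemma normal_itv_gt0 (a e : R) : 0 < e ->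
  (0 < normal_prob 0 1 [set` `]a - e, a + e[%R])%E.
Proof.
move=> e0.
pose c : R := (Num.sqrt (pi *+ 2))^-1 * expR (- ((`|a| + e) ^+ 2 / 2)).
have c0 : 0 < c.
  by rewrite mulr_gt0 ?expR_gt0// invr_gt0 sqrtr_gt0 pmulrn_lgt0// pi_gt0.
have mS : measurable ([set` `]a - e, a + e[%R] : set RT) by exact: measurable_itv.
apply: (@lt_le_trans _ _ (c%:E * lebesgue_measure [set` `]a - e, a + e[%R])%E).
  rewrite lebesgue_measure_itv/= lte_fin ifT; last by lra.
  by rewrite -EFinD -EFinM lte_fin mulr_gt0//; lra.
rewrite -integral_cst// /normal_prob; apply: ge0_le_integral => //.
- by move=> x _; rewrite lee_fin ltW.
- by apply/measurable_EFinP/measurable_funTS; exact: measurable_normal_pdf.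
- move=> x; rewrite /= in_itv/= -ltr_distl => /ltW xa; rewrite lee_fin normal01E.
  rewrite ler_pM2l; last by rewrite invr_gt0 sqrtr_gt0 pmulrn_lgt0// pi_gt0.
  rewrite ler_expR lerN2 ler_pM2r// -[leLHS]real_normK ?num_real//.
  have ae0 : 0 <= `|a| + e by rewrite addr_ge0// ltW.
  rewrite lerXn2r ?nnegrE//.
  by have := ler_normD (x - a) a; rewrite subrK; lra.
Qed.

Definition mxbox n m (A0 : 'M[R]_(n, m)) (e : R) : set 'M[R]_(n, m) :=
  [set A | forall i j, [set` `]A0 i j - e, A0 i j + e[%R] (A i j)].

Lemma measurable_mxbox n m (A0 : 'M[R]_(n, m)) (e : R) :
  measurable (mxbox A0 e).
Proof.
rewrite (_ : mxbox A0 e =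
    \bigcap_(i in [set: 'I_n]) \bigcap_(j in [set: 'I_m])
      ((fun A : 'M[R]_(n, m) => A i j : RT) @^-1` [set` `]A0 i j - e, A0 i j + e[%R])).
  apply: fin_bigcap_measurable => // i _; apply: fin_bigcap_measurable => // j _.
  rewrite -[X in measurable X]setTI.
  have mc : measurable_fun setT ((fun A : 'M[R]_(n, m) => A i j) : 'M[R]_(n, m) -> RT).
    apply: (@mx_lipschitz_measurable _ _ _ _ 1) => A B.
    rewrite mul1r -lerBlDl (le_trans (ler_norm _))//.
    by have := mx_norm_coef (A - B) i j; rewrite !mxE.
  by apply: mc => //; exact: measurable_itv.
by apply/seteqP; split => A h i *; [move=> j _|]; apply: h.
Qed.

Lemma gaussian_box_gt0 n m (A0 : 'M[R]_(n, m)) (e : R) : 0 < e ->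
  (0 < gaussian n m (mxbox A0 e))%E.
Proof.
move=> e0; rewrite /mxbox (gaussian_box n m
  (fun i j => [set` `]A0 i j - e, A0 i j + e[%R])); last first.
  by move=> i j; exact: measurable_itv.
elim/big_ind : _ => [|x y x0 y0|i _]; [exact: lte01|exact: mule_gt0|].
elim/big_ind : _ => [|x y x0 y0|j _]; [exact: lte01|exact: mule_gt0|].
exact: normal_itv_gt0.
Qed.

Lemma half_margin (a b x t : R) : t = a -> a <= b + x -> x <= t / 2 -> t / 2 <= b.
Proof. by lra. Qed.

(** The restricted singular values are Lipschitz, so the condition number is
    bounded in a box around a well-posed matrix, and every box has positive
    probability. *)
Lemma bounded_renegar_set n m (C : set 'cV[R]_m) (D : set 'cV[R]_n) :
  closed_convex_cone C -> closed_convex_cone D ->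
  nonzero_cone C -> nonzero_cone D ->
  exists (E : set 'M[R]_(n, m)) (K : R),
    [/\ measurable E, (0 < gaussian n m (~` E))%E &
      forall A, (~` E) A -> (renegar C D A <= K%:E)%E].
Proof.
move=> cC cD C0 D0.
have [A0 h] := exists_wellposed cC cD C0 D0.
pose s := Num.max (rsv C D A0) (rsv D C (- A0^T)).
have s0 : 0 < s by rewrite lt_max; apply/orP; case: h => ->; [left|right].
pose L : R := n%:R * m%:R + 1.
have L0 : 0 < L by rewrite ltr_wpDl// mulr_ge0.
(* half of the positive value s survives in the box *)
pose e := s / (2 * L).
have e0 : 0 < e by rewrite divr_gt0// mulr_gt0.
pose B := mxbox A0 e.
exists (~` B), ((opnorm A0 + L * e) / (s / 2)); rewrite setCK; split.
- by apply: measurableC; exact: measurable_mxbox.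
- exact: gaussian_box_gt0.
move=> A BA.
have AA : `|A - A0| <= e.
  apply: mx_norm_le => [|i j]; first exact: ltW.
  by have := BA i j; rewrite !mxE /= in_itv/= -ltr_distl => /ltW.
have LA : n%:R * m%:R * `|A - A0| <= L * e.
  by apply: ler_pM => //; rewrite ?mulr_ge0// lerDl.
have Le : L * e = s / 2 by rewrite /e; field; rewrite gt_eqF.
have h0 : opnorm A <= opnorm A0 + L * e.
  by apply: le_trans (opnorm_lipschitz A A0) _; rewrite lerD2l.
have s2 : 0 < s / 2 by rewrite divr_gt0.
apply: (renegar_le h0 s2).
have h1 := rsv_lipschitz cC cD C0 (nonzero_cone_0 cD D0) A0 A.
have h2 := rsvT_lipschitz cC cD C0 D0 A0 A.
rewrite -opprB normrN in h1; rewrite -opprB normrN (mulrC m%:R) in h2.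
have : s = rsv C D A0 \/ s = rsv D C (- A0^T).
  by rewrite /s; case: (leP (rsv C D A0) (rsv D C (- A0^T))) => _; [right|left].
have Xs : n%:R * m%:R * `|A - A0| <= s / 2 by rewrite -Le.
by case=> sE; [left; exact: half_margin sE h1 Xs|right; exact: half_margin sE h2 Xs].
Qed.

End gaussian_support.

Section second_moment.
Context {R : realType}.
Notation RT := (measurableTypeR R).
Local Open Scope ereal_scope.

Lemma gaussian_tuple_sqr p :
  \int[gaussian_tuple p]_t (\sum_i (tnth t i : R) ^+ 2)%R%:E = (p%:R : R)%:E.
Proof.
have mS q : measurable_fun setT (fun t : q.-tuple RT => (\sum_i (tnth t i : R) ^+ 2)%R%:E).
  apply/measurable_EFinP/measurable_sum => i; apply: measurable_funX.
  exact: measurable_tnth.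
have S0 q (t : q.-tuple RT) : 0 <= (\sum_i (tnth t i : R) ^+ 2)%R%:E.
  by rewrite lee_fin sumr_ge0// => i _; rewrite sqr_ge0.
elim: p => [|p IH].
  by under eq_integral do rewrite big_ord0; rewrite integral_prob_cst.
rewrite /= ge0_integral_distribution; [|exact: mS|by move=> t; exact: S0].
rewrite fubini_tonelli1; last 2 first.
- exact: (measurableT_comp (mS _) (measurable_tuple_cons (n := p))).
- by move=> t; exact: S0.
transitivity (\int[@normal_prob R 0 1]_z (p%:R%:E + 1%:E * ((z : R) ^+ 2)%:E)).
  apply: eq_integral => z _; rewrite /fubini_F /=.
  transitivity (\int[gaussian_tuple p]_t (((z : R) ^+ 2)%:E + 1%:E * (\sum_i (tnth t i : R) ^+ 2)%R%:E)).
    apply: eq_integral => t _; rewrite mul1e -EFinD big_ord_recl; congr (_ + _)%:E.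
    by apply: eq_bigr => i _; rewrite tnthS.
  rewrite (integral_affine (gaussian_tuple p) (sqr_ge0 (z : R)) ler01 (mS p) (S0 p)).
  by rewrite IH !mul1e addeC.
rewrite integral_affine//; last 2 first.
- by apply/measurable_EFinP; exact: measurable_funX.
- by move=> z; rewrite lee_fin sqr_ge0.
by rewrite normal_sqr mule1 -EFinD natr1.
Qed.

Lemma measurable_enorm n : measurable_fun setT (@enorm R n : _ -> RT).
Proof. exact: (mx_continuous_measurable (@enorm_continuous R n)). Qed.

Lemma gaussian_enorm_sqr n : \int[gaussian n 1]_g (enorm g ^+ 2)%:E = (n%:R : R)%:E.
Proof.
rewrite ge0_integral_distribution; last 2 first.
- by apply/measurable_EFinP/measurable_funX; exact: measurable_enorm.
- by move=> g; rewrite lee_fin sqr_ge0.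
transitivity (\int[gaussian_tuple (n * 1)]_t (\sum_i (tnth t i : R) ^+ 2)%R%:E); last first.
  by rewrite gaussian_tuple_sqr muln1.
apply: eq_integral => t _ /=; congr EFin; rewrite enorm_sqr mxdot_vec.
by apply: eq_bigr => k _; rewrite /tuple_mx vec_mxK mxE expr2.
Qed.

Lemma measurable_pnorm n (C : set 'cV[R]_n) : closed_convex_cone C -> C 0%R ->
  measurable_fun setT (pnorm C : _ -> RT).
Proof.
move=> cC C0; apply: (@mx_lipschitz_measurable _ _ _ _ n%:R) => A B.
by apply: (le_trans (pnorm_lipschitz cC C0 A B)); rewrite lerD2l enorm_le_mx_norm.
Qed.

(** The expectation is finite, being at most n. *)
Lemma statdimE n (C : set 'cV[R]_n) : closed_convex_cone C -> C 0%R ->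
  \int[gaussian n 1]_g (pnorm C g ^+ 2)%:E = (statdim C)%:E.
Proof.
move=> cC C0; rewrite /statdim unlock fineK//.
have I0 : 0 <= \int[gaussian n 1]_g (pnorm C g ^+ 2)%:E.
  by apply: integral_ge0 => g _; rewrite lee_fin sqr_ge0.
rewrite ge0_fin_numE//; apply: (@le_lt_trans _ _ (\int[gaussian n 1]_g (enorm g ^+ 2)%:E)).
  apply: ge0_le_integral => //.
  - by move=> g _; rewrite lee_fin sqr_ge0.
  - by apply/measurable_EFinP/measurable_funX; exact: measurable_pnorm.
  - by apply/measurable_EFinP/measurable_funX; exact: measurable_enorm.
  - move=> g _; rewrite lee_fin lerXn2r ?nnegrE ?pnorm_ge0 ?enorm_ge0//.
    exact: pnorm_le.
by rewrite gaussian_enorm_sqr ltry.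
Qed.

Lemma statdim_ge0 n (C : set 'cV[R]_n) : (0 <= statdim C)%R.
Proof.
by rewrite /statdim fine_ge0// unlock integral_ge0// => g _; rewrite lee_fin sqr_ge0.
Qed.

(** A linear form in a Gaussian vector with unit coefficient vector is standard
    normal; the computation is done on the averaging operators. *)
Lemma gaussian_linear_mgf n (y : 'cV[R]_n) : mxdot y y = 1%R ->
  \int[gaussian n 1]_g (expR (- mxdot g y))%:E = (expR (1 / 2))%:E.
Proof.
move=> y1; pose Phi (u : unit -> R) := (expR (- u tt))%:E.
have fPhi : functional Phi.
  split=> [u|d T U mU]; first by rewrite lee_fin expR_ge0.
  by apply/measurable_EFinP/measurableT_comp => //; exact: measurableT_comp.
have H l u : gavgs l Phi u = (expR (cov l tt tt / 2 - u tt))%:E.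
  elim: l u => [|a l IH] u; first by rewrite /cov big_nil mul0r add0r.
  rewrite /= /gavg; under eq_integral do rewrite IH.
  transitivity (\int[@normal_prob R 0 1]_z ((expR (cov l tt tt / 2 - u tt))%:E *
     (expR (- a tt * z))%:E)).
    by apply: eq_integral => z _; rewrite -EFinM -expRD; congr (expR _)%:E; ring.
  rewrite ge0_integralZl ?lee_fin ?expR_ge0//; last first.
    by apply/measurable_EFinP/measurableT_comp => //; exact: measurable_funM.
  rewrite normal_mgf -EFinM -expRD; congr (expR _)%:E.
  by rewrite /cov big_cons; field.
transitivity (gavgs (glist (fun _ : unit => y)) Phi (fun=> 0%R)).
  rewrite -integral_gaussian; last exact: fPhi.
  by apply: eq_integral => g _; rewrite /Phi add0r.
by rewrite H /cov glist_cov y1 subr0.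
Qed.

End second_moment.

(** * Means of smoothed maxima over nets *)

Section nets.
Context {R : realType} {m : nat}.

Definition is_net (C : set 'cV[R]_m) (e : R) (I : finType) (x : I -> 'cV[R]_m) : Prop :=
  [/\ forall i, C (x i), forall i, enorm (x i) = 1 &
      forall z, C z -> enorm z = 1 -> exists i, enorm (z - x i) <= e].

Lemma net_unit (C : set 'cV[R]_m) (e : R) (I : finType) (x : I -> 'cV[R]_m) :
  is_net C e x -> forall i, mxdot (x i) (x i) = 1.
Proof. by case=> _ h _ i; rewrite -enorm_sqr h expr1n. Qed.

(** Compactness of the unit vectors of C. *)
Lemma exists_net (C : set 'cV[R]_m) (e : R) : closed_convex_cone C -> nonzero_cone C ->
  0 < e -> exists (I : finType) (i0 : I) (x : I -> 'cV[R]_m), is_net C e x.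
Proof.
move=> cC C0 e0.
have op (x : 'cV[R]_m) : open [set z | enorm (z - x) < e].
  rewrite (_ : [set z | _] = (fun z => enorm (z - x)) @^-1` `]-oo, e[%classic); last first.
    by apply/seteqP; split => z /=; rewrite in_itv/=.
  apply: open_comp; last exact: interval_open.
  move=> z _; apply: (@mx_lipschitz_continuous _ _ _ _ m%:R) => a b.
  rewrite -lerBlDl; apply: le_trans (enorm_le_mx_norm _).
  rewrite lerBlDr (_ : a - x = (a - b) + (b - x)) ?enormD//.
  by rewrite addrA subrK.
have clC : closed C by case: cC.
have [|s [sC cov]] := sphere_subcover clC op.
  by move=> x _ _ /=; rewrite subrr enorm0.
have cov' z : C z -> enorm z = 1 -> exists i : 'I_(size s), enorm (z - nth 0 s i) <= e.
  move=> Cz z1; have [x xs /= zx] := cov z Cz z1.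
  have xi : (index x s < size s)%N by rewrite index_mem.
  by exists (Ordinal xi); rewrite /= nth_index// ltW.
have [z0 [Cz0 z01]] := cone_unit cC C0; have [i0 _] := cov' z0 Cz0 z01.
exists 'I_(size s), i0, (fun i : 'I_(size s) => nth 0 s i).
by split => // i; case: (sC _ (mem_nth 0 (ltn_ord i))).
Qed.

End nets.

Lemma mean_margin {R : realFieldType} (s M mm e q : R) :
  s <= (M + 1) + 3 + e * (q + 1) -> M <= mm + 2 -> e <= 1 -> s - 7 - e * q <= mm.
Proof. by lra. Qed.

Section means.
Context {R : realType} {n : nat}.
Notation RT := (measurableTypeR R).
Variables (C : set 'cV[R]_n) (e : R) (I : finType) (i0 : I) (x : I -> 'cV[R]_n) (b : R).
Hypotheses (cC : closed_convex_cone C) (C0 : C 0).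
Hypotheses (xnet : is_net C e x) (e0 : 0 < e) (b0 : 0 < b) (bI : ln #|I|%:R <= b).
Local Notation P := (gaussian n 1).
Local Notation f := (softlin b x).
Local Notation mean := (\int[P]_g f g).

Let x1 i : mxdot (x i) (x i) = 1.
Proof. exact: net_unit xnet i. Qed.

Let mf : measurable_fun setT (f : _ -> RT) := @measurable_softlin R n I b x.
Let conc := softlin_concentrated i0 x1 b0.
Let fint := concentrated_integrable mf conc.

Lemma softlin_ge g i : mxdot g (x i) <= f g.
Proof. by rewrite /softlin ler_pdivlMr// mulrC; exact: (lse_ge i0 (fun i => b * mxdot g (x i))). Qed.

Lemma softlin_le g : f g <= pnorm C g + 1.
Proof.
rewrite /softlin ler_pdivrMr// mulrDl mul1r mulrC.
apply: (le_trans (@lse_le R I i0 _ (b * pnorm C g) _)); last by rewrite lerD2l.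
move=> i; rewrite ler_pM2l//; case: xnet => Cx en _.
by have := dot_le_pnorm cC C0 g (Cx i); rewrite en mulr1.
Qed.

(** By E X <= (E X ^ 2 / a + a) / 2 with X = |Pi_C(g)| and a = sqrt delta(C) + 1,
    which is positive even when delta(C) = 0. *)
Lemma softlin_mean_le : mean <= Num.sqrt (statdim C) + 2.
Proof.
pose a := Num.sqrt (statdim C) + 1.
have a0 : 0 < a by rewrite ltr_wpDl// sqrtr_ge0.
have mp : measurable_fun setT (fun g => (pnorm C g ^+ 2)%:E).
  by apply/measurable_EFinP/measurable_funX; exact: measurable_pnorm.
have p0 g : (0 <= (pnorm C g ^+ 2)%:E)%E by rewrite lee_fin sqr_ge0.
have pint : P.-integrable setT (fun g => (pnorm C g ^+ 2)%:E).
  apply/integrableP; split => //.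
  by under eq_integral do rewrite gee0_abs//; rewrite statdimE ?ltry.
pose k : R := (2 * a)^-1.
have k0 : 0 <= k by rewrite invr_ge0 mulr_ge0// ltW.
have hint : P.-integrable setT (fun g => ((a / 2 + 1)%:E + k%:E * (pnorm C g ^+ 2)%:E)%E).
  apply: integrableD => //; first exact: (finite_measure_integrable_cst P (a / 2 + 1)).
  exact: integrableZl.
have H : (\int[P]_g (f g)%:E <= \int[P]_g ((a / 2 + 1)%:E + k%:E * (pnorm C g ^+ 2)%:E))%E.
  apply: le_integral => // g _; rewrite -EFinM -EFinD lee_fin.
  apply: (le_trans (softlin_le g)).
  have -> : a / 2 + 1 + k * pnorm C g ^+ 2 =
      pnorm C g + 1 + (pnorm C g - a) ^+ 2 / (2 * a).
    by rewrite /k; field; rewrite gt_eqF.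
  by rewrite lerDl divr_ge0 ?sqr_ge0// mulr_ge0// ltW.
rewrite integral_affine// ?statdimE// in H; last first.
  by rewrite addr_ge0// divr_ge0// ltW.
have fm : (\int[P]_g (f g)%:E = mean%:E)%E.
  by rewrite /Rintegral fineK// integrable_fin_num.
rewrite fm -EFinM -EFinD lee_fin in H.
apply: (le_trans H).
have sa : statdim C <= a ^+ 2.
  rewrite -[leLHS]sqr_sqrtr ?statdim_ge0// lerXn2r ?nnegrE ?sqrtr_ge0 ?ltW//.
  by rewrite /a ltrDl.
have : k * statdim C <= a / 2.
  apply: le_trans (ler_wpM2l k0 sa) _; rewrite /k le_eqVlt; apply/orP; left; apply/eqP.
  by field; rewrite gt_eqF.
rewrite /a; lra.
Qed.

(** In L^2, |Pi_C(g)| is at most the smoothed maximum plus e |g|, and the smoothed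
    maximum is at most its mean plus its standard deviation. The mean itself could
    be negative, but not below - 1, by Jensen's inequality and a single point of
    the net. *)
Lemma softlin_mean_ge : e <= 1 -> Num.sqrt (statdim C) - 7 - e * Num.sqrt n%:R <= mean.
Proof.
move=> e1.
(* E exp (- f) <= E exp (- <g, x_i0>) = exp (1 / 2) *)
have m1 : - 1 <= mean.
  have h1 := jensen_expR (- 1) fint.
  have h2 : (\int[P]_g (expR (- 1 * f g))%:E <= \int[P]_g (expR (- mxdot g (x i0)))%:E)%E.
    apply: ge0_le_integral => //.
    - by apply/measurable_EFinP/measurableT_comp => //; exact: measurable_funM.
    - apply/measurable_EFinP/measurableT_comp => //; apply: measurableT_comp => //.
      exact: measurable_mxdot.
    - by move=> g _; rewrite lee_fin ler_expR mulN1r lerN2 softlin_ge.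
  have := le_trans h1 h2; rewrite gaussian_linear_mgf// lee_fin ler_expR; lra.
set mm := mean in m1 *.
have sn0 : 0 <= Num.sqrt n%:R :> R by rewrite sqrtr_ge0.
pose M := `|mm|.
have M0 : 0 <= M by rewrite normr_ge0.
have v1 : (\int[P]_g (`|f g| ^+ 2)%:E <= (((M + 1) + 3) ^+ 2)%:E)%E.
  apply: (@L2_triangle _ _ _ P _ (fun=> M) (fun g => `|f g - mm|)) => //.
  - by rewrite ltr_wpDl.
  - exact: measurableT_comp.
  - by apply: measurableT_comp => //; exact: measurable_funB.
  - move=> g; rewrite normr_ge0/=.
    by rewrite -[f g in leLHS](subrK mm) addrC ler_normD.
  - by rewrite integral_prob_cst lee_fin lerXn2r ?nnegrE ?addr_ge0// lerDl.
  - under eq_integral do rewrite real_normK ?num_real//.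
    apply: (le_trans (concentrated_var mf conc)); rewrite lee_fin; lra.
have v2 : (\int[P]_g (pnorm C g ^+ 2)%:E <= (((M + 1) + 3 + e * (Num.sqrt n%:R + 1)) ^+ 2)%:E)%E.
  apply: (@L2_triangle _ _ _ P _ (fun g => `|f g|) (fun g => e * enorm g)) => //.
  - by rewrite !ltr_wpDl// addr_ge0.
  - by rewrite mulr_gt0// ltr_wpDl.
  - exact: measurable_pnorm.
  - exact: measurableT_comp.
  - by apply: measurable_funM => //; exact: measurable_enorm.
  - move=> g; rewrite pnorm_ge0/=.
    have [->|pg] := eqVneq (pnorm C g) 0.
      by rewrite addr_ge0// mulr_ge0 ?enorm_ge0// ltW.
    have [z [Cz z1 <-]] := pnorm_unit cC C0 pg.
    have [_ _ /(_ z Cz z1)[i zi]] := xnet.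
    rewrite -[z in mxdot g z](subrK (x i)) addrC mxdotDr lerD//.
      by apply: (le_trans (softlin_ge g i)); exact: ler_norm.
    apply: (le_trans (cauchy_schwarz _ _)); rewrite mulrC ler_wpM2r ?enorm_ge0//.
  - under eq_integral do rewrite exprMn EFinM.
    rewrite ge0_integralZl//; last 3 first.
    + by apply/measurable_EFinP/measurable_funX; exact: measurable_enorm.
    + by move=> g _; rewrite lee_fin sqr_ge0.
    + by rewrite lee_fin sqr_ge0.
    rewrite gaussian_enorm_sqr -EFinM lee_fin exprMn ler_wpM2l ?sqr_ge0//.
    rewrite -[leLHS]sqr_sqrtr// lerXn2r ?nnegrE ?addr_ge0//.
    by rewrite lerDl.
rewrite statdimE// lee_fin in v2.
have b1 : 0 <= (M + 1) + 3 + e * (Num.sqrt n%:R + 1).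
  by rewrite !addr_ge0// mulr_ge0 ?addr_ge0// ltW.
have h : Num.sqrt (statdim C) <= (M + 1) + 3 + e * (Num.sqrt n%:R + 1).
  by rewrite -[leRHS](ger0_norm b1) -sqrtr_sqr ler_sqrt// sqr_ge0.
have Mm : M <= mm + 2.
  by rewrite /M; have [mm0|mm0] := leP 0 mm; [rewrite ger0_norm|rewrite ltr0_norm]; lra.
exact: mean_margin h Mm e1.
Qed.

End means.

(** * Tail bound for the condition number *)

(** For c + a = - t the exponent is minimal at mu = t / 4. *)
Lemma chernoff_margin {R : realFieldType} (mu c a t : R) : 0 < mu ->
  c + a <= - t -> t = 4 * mu -> mu * (c + a) + 2 * mu ^+ 2 <= - (t ^+ 2 / 8).
Proof.
move=> mu0 h te; rewrite te in h *.
apply: (le_trans (lerD (ler_wpM2l (ltW mu0) h) (lexx _))).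
by rewrite le_eqVlt; apply/orP; left; apply/eqP; field.
Qed.

Section one_k.
Context {R : realType} {n m : nat}.
Notation RT := (measurableTypeR R).
Variables (C : set 'cV[R]_m) (D : set 'cV[R]_n) (e tau : R).
Hypotheses (cC : closed_convex_cone C) (cD : closed_convex_cone D).
Hypotheses (C0 : nonzero_cone C) (D0 : nonzero_cone D).
Hypotheses (e0 : 0 < e) (e4 : e <= 1 / 4) (tau0 : 0 < tau) (n0 : (0 < n)%N).

Local Notation sn := (Num.sqrt n%:R).
Let mu : R := tau * sn / 4.
Let mu0 : 0 < mu.
Proof. by rewrite divr_gt0// mulr_gt0// sqrtr_gt0 ltr0n. Qed.
Let tmu : tau * sn = 4 * mu. Proof. by rewrite /mu; field. Qed.
Let tsn : (tau * sn) ^+ 2 = tau ^+ 2 * n%:R.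
Proof. by rewrite exprMn sqr_sqrtr. Qed.
Let e1 : e <= 1. Proof. by apply: (le_trans e4); lra. Qed.

(** A smoothing parameter with mu <= b, as Gordon's comparison requires, for which
    the smoothing errors ln |I| / b and ln |J| / b are at most 1. *)
Let smoothing_level (I J : finType) (i : I) (j : J) : exists b,
  [/\ mu <= b, 0 < b, ln #|I|%:R <= b & ln #|J|%:R <= b].
Proof.
have ln0 (K : finType) (k : K) : 0 <= ln (#|K|%:R : R).
  by apply: ln_ge0; rewrite ler1n; apply/card_gt0P; exists k.
have I0 := ln0 I i; have J0 := ln0 J j.
have m0 := ltW mu0; exists (mu + ln #|I|%:R + ln #|J|%:R); split.
- by rewrite -addrA lerDl addr_ge0.
- by rewrite -addrA ltr_pwDl// addr_ge0.
- by rewrite addrAC lerDr addr_ge0.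
- by rewrite lerDr addr_ge0.
Qed.

Let mset (I J : finType) (x : I -> 'cV[R]_m) (y : J -> 'cV[R]_n) (Z : set R) :
  measurable (Z : set RT) -> forall i j,
  measurable [set A : 'M[R]_(n, m) | Z (mxdot (A *m x i) (y j))].
Proof.
move=> mZ i j.
rewrite (_ : [set A | _] = (fun A : 'M[R]_(n, m) => mxdot A (y j *m (x i)^T)) @^-1` Z).
  by rewrite -[X in measurable X]setTI; exact: measurable_mxdot.
by apply/seteqP; split => A /=; rewrite mxdot_mulmx.
Qed.

(** The constant 10 collects the additive errors of the means and of the
    smoothing, e * sqrt n comes from the net of D, tau * sqrt n is the deviation,
    and q is left for the net of C. *)
Definition sigma_level (q : R) : R :=
  Num.sqrt (statdim D) - Num.sqrt (statdim C) - 10 - e * sn - tau * sn - q.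

(** Outside the exceptional event every x_i in the net of C has some y_j in the
    net of D with <A x_i, y_j> > c. A unit vector z of C is at distance at most e
    of some x_i, which costs e * |A|. *)
Lemma sigma_tail : exists B : set 'M[R]_(n, m),
  [/\ measurable B, (gaussian n m B <= (expR (- (tau ^+ 2 * n%:R / 8)))%:E)%E &
   forall A K, (~` B) A -> opnorm A <= K -> sigma_level (e * K) <= rsv C D A].
Proof.
have [I [i0 [x xnet]]] := exists_net cC C0 e0.
have [J [j0 [y ynet]]] := exists_net cD D0 e0.
have C00 := nonzero_cone_0 cC C0; have D00 := nonzero_cone_0 cD D0.
have [b [mub b0 Ib Jb]] := smoothing_level i0 j0.
pose c := sigma_level 0.
pose B : set 'M[R]_(n, m) := [set A | exists i, forall j, mxdot (A *m x i) (y j) <= c].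
have mB : measurable B.
  rewrite (_ : B = \bigcup_(i in [set: I]) \bigcap_(j in [set: J])
     [set A | [set z : R | z <= c] (mxdot (A *m x i) (y j))]).
    apply: fin_bigcup_measurable => // i _; apply: fin_bigcap_measurable => // j _.
    apply: mset; rewrite (_ : [set z : R | _] = [set` `]-oo, c]%R]); last first.
      by apply/seteqP; split => z /=; rewrite in_itv.
    exact: measurable_itv.
  apply/seteqP; split => A; first by move=> [i h]; exists i => // j _; exact: h.
  by move=> [i _ h]; exists i => j; exact: h.
have x1 := net_unit xnet; have y1 := net_unit ynet.
exists B; split => //.
  apply: (le_trans (minmax_tail i0 j0 x1 y1 mu0 mub mB Jb (fun A h => h))).
  rewrite lee_fin ler_expR -tsn.
  have hx := softlin_mean_le i0 cC C00 xnet b0 Ib.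
  have hy := softlin_mean_ge j0 cD D00 ynet e0 b0 e1.
  move: hx hy; move: (Rintegral _ _ _) (Rintegral _ _ _) => X Y hx hy.
  rewrite -addrA -addrA.
  apply: chernoff_margin => //; move: hx hy; rewrite /c /sigma_level.
  move: (Num.sqrt (statdim C)) (Num.sqrt (statdim D)) (e * sn) (tau * sn).
  by move=> sC sD es ts hx hy; lra.
move=> A K nB AK; apply: rsv_lb => // z Cz z1.
have [Cx en /(_ z Cz z1)[i zi]] := xnet; have [Dy eny _] := ynet.
have [j Aij] : exists j, c < mxdot (A *m x i) (y j).
  apply: contrapT => h; apply: nB; exists i => j; rewrite leNgt; apply/negP => h'.
  by apply: h; exists j.
have h1 := dot_le_pnorm cD D00 (A *m z) (Dy j); rewrite eny mulr1 in h1.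
apply: le_trans h1.
rewrite -[z in A *m z](subrK (x i)) mulmxDr mxdotDl.
have h2 := cauchy_schwarz_norm (A *m (z - x i)) (y j); rewrite eny mulr1 in h2.
have h3 : enorm (A *m (z - x i)) <= e * K.
  apply: (le_trans (mulmx_le_opnorm _ _)); rewrite mulrC.
  by apply: ler_pM => //; [exact: enorm_ge0|exact: opnorm_ge0].
have h4 : - (e * K) <= mxdot (A *m (z - x i)) (y j).
  by have := le_trans h2 h3; rewrite ler_norml => /andP[].
have -> : sigma_level (e * K) = - (e * K) + c.
  by rewrite /c /sigma_level subr0 addrC.
by apply: lerD => //; exact: ltW.
Qed.

Lemma setT_cone k : closed_convex_cone [set: 'cV[R]_k].
Proof. by split. Qed.

Lemma statdim_setT k : Num.sqrt (statdim [set: 'cV[R]_k]) <= Num.sqrt k%:R.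
Proof.
rewrite ler_sqrt// -lee_fin -statdimE//; last exact: setT_cone.
rewrite -gaussian_enorm_sqr; apply: ge0_le_integral => //.
- by move=> g _; rewrite lee_fin sqr_ge0.
- by apply/measurable_EFinP/measurable_funX; apply: measurable_pnorm => //; exact: setT_cone.
- by apply/measurable_EFinP/measurable_funX; exact: measurable_enorm.
- move=> g _; rewrite lee_fin lerXn2r ?nnegrE ?pnorm_ge0 ?enorm_ge0//.
  by apply: pnorm_le => //; exact: setT_cone.
Qed.

Definition norm_level : R :=
  (Num.sqrt m%:R + sn + 4 + tau * sn) / (1 - 2 * e).

(** The norm is the maximum of <A u, v> over all unit vectors; replacing u and v
    by points of the nets costs 2 e |A|, which is absorbed on the left, hence the
    denominator 1 - 2 e. *)
Lemma norm_tail : exists B : set 'M[R]_(n, m),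
  [/\ measurable B, (gaussian n m B <= (expR (- (tau ^+ 2 * n%:R / 8)))%:E)%E &
   forall A, (~` B) A -> opnorm A <= norm_level].
Proof.
have T0 k (K : set 'cV[R]_k) : nonzero_cone K -> nonzero_cone [set: 'cV[R]_k].
  by move=> [z _ z0]; exists z.
have [I [i0 [x xnet]]] := exists_net (setT_cone m) (T0 _ _ C0) e0.
have [J [j0 [y ynet]]] := exists_net (setT_cone n) (T0 _ _ D0) e0.
have [b [mub b0 Ib Jb]] := smoothing_level i0 j0.
pose c : R := Num.sqrt m%:R + sn + 4 + tau * sn.
have c0 : 0 <= c by rewrite !addr_ge0 ?sqrtr_ge0// mulr_ge0 ?sqrtr_ge0// ltW.
pose B : set 'M[R]_(n, m) := [set A | exists i j, c <= mxdot (A *m x i) (y j)].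
have mB : measurable B.
  rewrite (_ : B = \bigcup_(i in [set: I]) \bigcup_(j in [set: J])
     [set A | [set z : R | c <= z] (mxdot (A *m x i) (y j))]).
    apply: fin_bigcup_measurable => // i _; apply: fin_bigcup_measurable => // j _.
    apply: mset; rewrite (_ : [set z : R | _] = [set` `[c, +oo[%R]); last first.
      by apply/seteqP; split => z /=; rewrite in_itv/= andbT.
    exact: measurable_itv.
  apply/seteqP; split => A; first by move=> [i [j h]]; exists i => //; exists j.
  by move=> [i _ [j _ h]]; exists i, j.
have x1 := net_unit xnet; have y1 := net_unit ynet.
exists B; split => //.
  apply: (le_trans (max_tail i0 j0 x1 y1 mu0 mub mB (fun A h => h))).
  rewrite lee_fin ler_expR -tsn.
  have hx := softlin_mean_le i0 (setT_cone m) Logic.I xnet b0 Ib.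
  have hy := softlin_mean_le j0 (setT_cone n) Logic.I ynet b0 Jb.
  have hx' := le_trans hx (lerD (statdim_setT m) (lexx 2)).
  have hy' := le_trans hy (lerD (statdim_setT n) (lexx 2)).
  move: hx' hy'; move: (Rintegral _ _ _) (Rintegral _ _ _) => X Y hx' hy'.
  rewrite mulNr -mulrN -mulrDr.
  apply: chernoff_margin => //; move: hx' hy'; rewrite /c.
  move: (Num.sqrt m%:R) sn (tau * sn).
  by move=> sm s ts hx' hy'; lra.
move=> A nB; have e2 : 0 < 1 - 2 * e by rewrite subr_gt0; move: e4; lra.
rewrite /norm_level ler_pdivlMr// -/c.
rewrite (_ : opnorm A * _ = opnorm A - 2 * e * opnorm A); last by ring.
rewrite lerBlDr.
apply: opnorm_ub => z z1.
have o0 := opnorm_ge0 A.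
have bound0 : 0 <= c + 2 * e * opnorm A.
  by rewrite addr_ge0// !mulr_ge0// ltW.
have [->|Az0] := eqVneq (A *m z) 0; first by rewrite enorm0.
have Azp := enorm_gt0 Az0.
have z0 : z != 0 by apply: contra_neq Az0 => ->; rewrite mulmx0.
have zp := enorm_gt0 z0.
pose u := (enorm z)^-1 *: z.
pose v := (enorm (A *m z))^-1 *: (A *m z).
have unit k (a : 'cV[R]_k) : 0 < enorm a -> enorm ((enorm a)^-1 *: a) = 1.
  move=> a0; rewrite enormZ ger0_norm ?mulVf ?gt_eqF//.
  by rewrite invr_ge0 ltW.
have [_ en /(_ u Logic.I (unit _ _ zp))[i ui]] := xnet.
have [_ eny /(_ v Logic.I (unit _ _ Azp))[j vj]] := ynet.
have Aij : mxdot (A *m x i) (y j) <= c.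
  by rewrite leNgt; apply/negP => /ltW h; apply: nB; exists i, j.
have Auv : mxdot (A *m u) v <= c + 2 * e * opnorm A.
  have -> : mxdot (A *m u) v = mxdot (A *m x i) (y j) +
      (mxdot (A *m (u - x i)) (y j) + mxdot (A *m u) (v - y j)).
    by rewrite mulmxBr mxdotBl mxdotBr; ring.
  apply: lerD => //; rewrite (_ : 2 * e * opnorm A = opnorm A * e + opnorm A * e); last by ring.
  apply: lerD.
    apply: (le_trans (cauchy_schwarz _ _)); rewrite eny mulr1.
    by apply: (le_trans (mulmx_le_opnorm _ _)); apply: ler_wpM2l.
  apply: (le_trans (cauchy_schwarz _ _)); apply: ler_pM => //; rewrite ?enorm_ge0//.
  by apply: (le_trans (mulmx_le_opnorm _ _)); rewrite (unit _ _ zp) mulr1.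
have E : enorm (A *m z) = enorm z * mxdot (A *m u) v.
  rewrite /u /v -scalemxAr mxdotZl mxdotZr -enorm_sqr expr2 !mulrA.
  by rewrite mulfV ?gt_eqF// mul1r mulVf ?gt_eqF// mul1r.
rewrite E -[leRHS]mul1r.
have uv0 : 0 <= mxdot (A *m u) v.
  by rewrite /u /v -scalemxAr mxdotZl mxdotZr !mulr_ge0 ?invr_ge0 ?enorm_ge0 ?mxdot_ge0.
by apply: ler_pM => //; exact: enorm_ge0.
Qed.

Theorem renegar_tail : exists B : set 'M[R]_(n, m),
  [/\ measurable B, (gaussian n m B <= (2 * expR (- (tau ^+ 2 * n%:R / 8)))%:E)%E &
   forall A, (~` B) A -> opnorm A <= norm_level /\
     sigma_level (e * norm_level) <= rsv C D A].
Proof.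
have [B1 [mB1 P1 H1]] := sigma_tail; have [B2 [mB2 P2 H2]] := norm_tail.
exists (B1 `|` B2); split; first exact: measurableU.
  apply: (le_trans (measureU2 _ mB1 mB2)).
  by rewrite mulr_natl mulr2n EFinD; exact: leeD.
move=> A; rewrite setCU => -[A1 A2]; have h2 := H2 A A2; split => //.
exact: H1.
Qed.

End one_k.

(** * Families of cones *)

Section limits.
Context {R : realType}.

(** The parameter e plays three roles: the mesh of the nets, the size of the
    deviations, and the distance of the normalized dimensions and of the constants
    from their limits. All of them change the two levels by O (e) * sqrt n, with g
    = gamma, and s, sm, sC, sD the square roots of n, m, delta(C), delta(D). *)
Lemma level_ratio (a b g e s sm sC sD eta : R) :
  let d := b - a * g in let L := (1 + g) / d in
  0 < g <= 1 -> 0 < d -> 0 < eta -> 0 < s ->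
  0 < e -> e <= 1 / 8 -> e <= d / 18 -> e <= eta * d / (13 + 9 * (L + eta)) ->
  sm <= (g + e) * s -> 10 <= e * s -> (b - e) * s <= sD -> sC <= (a * g + e) * s ->
  let K := (sm + s + 4 + e * s) / (1 - 2 * e) in
  let S := sD - sC - 10 - e * s - e * s - e * K in
  0 < S /\ K / S <= L + eta.
Proof.
move=> d L /andP[g0 g1] d0 eta0 s0 e0 e8 ed eL hm hs hD hC K S.
have L0 : 0 < L by rewrite divr_gt0// addr_gt0.
have q0 : 0 < 1 - 2 * e by move: e8; clear; lra.
(* 13 and 9 are crude bounds for the coefficients of e, valid for g <= 1 and e <=
   1 / 8 *)
have K1 : K <= (1 + g + 13 * e) * s.
  rewrite /K ler_pdivrMr//.
  have h1 : sm + s + 4 + e * s <= (1 + g + 3 * e) * s by clear -hm hs e0 s0; nra.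
  apply: (le_trans h1); rewrite -mulrA (mulrC s) mulrA; apply: ler_wpM2r; first exact: ltW.
  by clear -e0 e8 g0 g1; nra.
have K4 : K <= 4 * s.
  apply: (le_trans K1); apply: ler_wpM2r; first exact: ltW.
  by clear -e8 g1; lra.
have eK : e * K <= 4 * (e * s).
  by rewrite [leRHS]mulrCA; apply: ler_wpM2l => //; exact: ltW.
have S1 : (d - 9 * e) * s <= S.
  have -> : (d - 9 * e) * s = (b - e) * s - (a * g + e) * s - 7 * (e * s).
    by rewrite /d; ring.
  rewrite /S; move: eK hD hC hs; move: (e * K) (e * s) (_ * s) (_ * s).
  by move=> x y z t; lra.
have d9 : 0 < d - 9 * e by move: ed d0; clear; lra.
have S0 : 0 < S by apply: lt_le_trans S1; rewrite mulr_gt0.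
split => //; rewrite ler_pdivrMr//; apply: (le_trans K1).
apply: (@le_trans _ _ ((L + eta) * ((d - 9 * e) * s))); last first.
  by apply: ler_wpM2l => //; rewrite addr_ge0// ltW.
rewrite mulrA; apply: ler_wpM2r; first exact: ltW.
have Ld : L * d = 1 + g by rewrite /L divfK// gt_eqF.
have den : 0 < 13 + 9 * (L + eta) by move: L0 eta0; clear; lra.
move: eL; rewrite ler_pdivlMr// => eL.
have -> : (L + eta) * (d - 9 * e) = L * d + eta * d - 9 * e * (L + eta) by ring.
rewrite Ld; move: eL; clear.
have -> : e * (13 + 9 * (L + eta)) = 13 * e + 9 * e * (L + eta) by ring.
by move: (_ * (_ + _)) (eta * d) => x y; lra.
Qed.

Lemma cond_expectation_ge0 d (T : measurableType d) (P : probability T R)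
    (X : T -> \bar R) (A : set T) :
  (forall t, (0 <= X t)%E) -> (0 <= cond_expectation P X A)%E.
Proof.
move=> X0; rewrite /cond_expectation mule_ge0//; first exact: integral_ge0.
by rewrite lee_fin invr_ge0 fine_ge0.
Qed.

(** On the complement of E, X is at most L outside B and at most K on B. *)
Lemma cond_expectation_le d (T : measurableType d) (P : probability T R)
    (X : T -> \bar R) (E B : set T) (K L : R) :
  measurable E -> measurable B -> measurable_fun setT X ->
  (forall t, (0 <= X t)%E) -> 0 <= K -> 0 <= L ->
  (forall t, ~ E t -> (X t <= K%:E)%E) -> (forall t, ~ B t -> (X t <= L%:E)%E) ->
  (0 < P (~` E))%E ->
  (cond_expectation P X (~` E) <= (L + K * fine (P B) / fine (P (~` E)))%:E)%E.
Proof.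
move=> mE mB mX X0 K0 L0 XK XL PE.
have mE' := measurableC mE.
have PEf : (P (~` E) = (fine (P (~` E)))%:E)%E by rewrite fineK// fin_num_measure.
have PBf : (P B = (fine (P B))%:E)%E by rewrite fineK// fin_num_measure.
have p0 : 0 < fine (P (~` E)) by rewrite -lte_fin -PEf.
have h : (\int[P]_(x in ~` E) X x <= (L * fine (P (~` E)) + K * fine (P B))%:E)%E.
  apply: (@le_trans _ _ (\int[P]_(x in ~` E) (L%:E + K%:E * (\1_B x)%:E))%E).
    apply: ge0_le_integral => //.
    - exact: measurable_funS mX.
    - apply: emeasurable_funD; first exact: measurable_cst.
      apply: emeasurable_funM; first exact: measurable_cst.
      by apply/measurable_EFinP; exact: measurable_indic.
    - move=> x nE; rewrite indicE; case: (boolP (x \in B)) => xB.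
        rewrite mule1; apply: (le_trans (XK x nE)).
        by rewrite -EFinD lee_fin lerDr.
      by rewrite mule0 adde0; apply: XL => xB'; rewrite mem_set in xB.
  rewrite ge0_integralD//; last 2 first.
  - by move=> x _; rewrite mule_ge0// lee_fin.
  - apply: emeasurable_funM; first exact: measurable_cst.
    by apply/measurable_EFinP; exact: measurable_indic.
  rewrite integral_cst// ge0_integralZl//; last first.
    by apply/measurable_EFinP; exact: measurable_indic.
  rewrite integral_indic// EFinD !EFinM -PEf -PBf.
  rewrite leeD2l// lee_wpmul2l ?lee_fin//.
  by apply: le_measure; rewrite ?inE//; exact: measurableI.
rewrite /cond_expectation.
apply: (@le_trans _ _ ((L * fine (P (~` E)) + K * fine (P B))%:E * ((fine (P (~` E)))^-1)%:E)%E).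
  by apply: lee_wpmul2r => //; rewrite lee_fin invr_ge0 ltW.
by rewrite -EFinM lee_fin mulrDl mulfK// gt_eqF.
Qed.

End limits.

Section families.
Context {R : realType}.
Variables (m n : nat -> nat).
Variables (C : forall k, set 'cV[R]_(m k)) (D : forall k, set 'cV[R]_(n k)).
Arguments C : clear implicits.
Arguments D : clear implicits.
Variables (alpha beta gamma : R).
Hypothesis C_cone : forall k, closed_convex_cone (C k).
Hypothesis C_nonzero : forall k, nonzero_cone (C k).
Hypothesis D_cone : forall k, closed_convex_cone (D k).
Hypothesis D_nonzero : forall k, nonzero_cone (D k).
Hypothesis lim_C : (fun k => statdim (C k) / (m k)%:R) @ \oo --> alpha ^+ 2.
Hypothesis lim_D : (fun k => statdim (D k) / (n k)%:R) @ \oo --> beta ^+ 2.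
Hypothesis lim_mn : (fun k => (m k)%:R / (n k)%:R : R) @ \oo --> gamma ^+ 2.
Hypotheses (alpha0 : 0 < alpha) (beta0 : 0 < beta) (gamma01 : 0 < gamma <= 1).
Hypothesis beta_gt : alpha * gamma < beta.
Hypothesis lim_n : n @ \oo --> \oo.

Let L : R := (1 + gamma) / (beta - alpha * gamma).

Lemma nonzero_cone_dim_gt0 k (K : set 'cV[R]_k) : nonzero_cone K -> (0 < k)%N.
Proof.
by case: k K => [|//] K [x _ /eqP[]]; apply/matrixP => -[].
Qed.

Lemma cvg_sqrt (u : nat -> R) (a : R) : 0 < a -> u @ \oo --> a ^+ 2 ->
  (fun k => Num.sqrt (u k)) @ \oo --> a.
Proof.
move=> a0 h; have := continuous_cvg _ (@sqrt_continuous R (a ^+ 2)) h.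
rewrite sqrtr_sqr gtr0_norm//; exact.
Qed.

Lemma dim_near (r : R) : \forall k \near \oo, r <= (n k)%:R.
Proof. exact: (lim_n (nbhs_infty_ger r)). Qed.

Lemma expRN_dim_near (c a : R) : 0 < c -> 0 < a ->
  \forall k \near \oo, expR (- (c * (n k)%:R)) <= a.
Proof.
move=> c0 a0; near=> k.
rewrite -ler_ln ?posrE ?expR_gt0// expRK lerNl mulrC -ler_pdivrMr//.
by near: k; exact: dim_near.
Unshelve. all: by end_near. Qed.

(** The factor 2 of the tail bound is absorbed in half of the exponent. *)
Lemma renegar_le_near eta : 0 < eta -> exists2 c, 0 < c &
  \forall k \near \oo, exists B : set 'M[R]_(n k, m k),
    [/\ measurable B, (gaussian (n k) (m k) B <= (expR (- (c * (n k)%:R)))%:E)%E &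
      forall A, (~` B) A -> (renegar (C k) (D k) A <= (L + eta)%:E)%E].
Proof.
move=> eta0; have d0 : 0 < beta - alpha * gamma by rewrite subr_gt0.
have /andP[gamma0 gamma1] := gamma01.
have L0 : 0 < L by rewrite divr_gt0// addr_gt0.
have den : 0 < 13 + 9 * (L + eta) by rewrite addr_gt0// mulr_gt0// addr_gt0.
pose d := beta - alpha * gamma.
pose e : R := Num.min (1 / 8) (Num.min (d / 18) (eta * d / (13 + 9 * (L + eta)))).
have e0 : 0 < e by rewrite !lt_min !divr_gt0// mulr_gt0.
have e8 : e <= 1 / 8 by rewrite ge_min lexx.
have ed : e <= d / 18 by rewrite /e minCA ge_min lexx.
have eL : e <= eta * d / (13 + 9 * (L + eta)) by rewrite /e !ge_min lexx !orbT.
have e4 : e <= 1 / 4 by apply: (le_trans e8); lra.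
have c0 : 0 < e ^+ 2 / 16 by rewrite divr_gt0// exprn_gt0.
exists (e ^+ 2 / 16) => //.
(* sqrt (delta(C) / m) * sqrt (m / n) = sqrt (delta(C) / n) *)
have hC : (fun k => Num.sqrt (statdim (C k) / (m k)%:R) * Num.sqrt ((m k)%:R / (n k)%:R))
    @ \oo --> alpha * gamma.
  exact: cvgM (cvg_sqrt alpha0 lim_C) (cvg_sqrt gamma0 lim_mn).
near=> k.
have n0 := nonzero_cone_dim_gt0 (D_nonzero k).
have m0 := nonzero_cone_dim_gt0 (C_nonzero k).
have nR : 0 < (n k)%:R :> R by rewrite ltr0n.
have mR : 0 < (m k)%:R :> R by rewrite ltr0n.
have s0 : 0 < Num.sqrt (n k)%:R :> R by rewrite sqrtr_gt0.
have [B [mB PB BR]] := renegar_tail (C_cone k) (D_cone k) (C_nonzero k) (D_nonzero k) e0 e4 e0 n0.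
exists B; split => //.
  apply: (le_trans PB); rewrite lee_fin.
  rewrite (_ : e ^+ 2 * _ / 8 = e ^+ 2 / 16 * (n k)%:R + e ^+ 2 / 16 * (n k)%:R); last by field.
  rewrite opprD expRD mulrA ler_piMl ?expR_ge0// mulrC -ler_pdivlMr// mul1r.
  by near: k; apply: expRN_dim_near.
have hm : Num.sqrt (m k)%:R <= (gamma + e) * Num.sqrt (n k)%:R.
  rewrite -ler_pdivrMr// -sqrtrV// -sqrtrM//.
  by near: k; apply: (cvgr_le _ (cvg_sqrt gamma0 lim_mn)); rewrite ltrDl.
have hs : 10 <= e * Num.sqrt (n k)%:R.
  rewrite mulrC -ler_pdivrMr//.
  have q0 : 0 <= 10 / e by rewrite divr_ge0// ltW.
  rewrite -(ger0_norm q0) -sqrtr_sqr ler_sqrt//.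
  by near: k; exact: dim_near.
have hD : (beta - e) * Num.sqrt (n k)%:R <= Num.sqrt (statdim (D k)).
  rewrite -ler_pdivlMr// -sqrtrV// -sqrtrM ?statdim_ge0//.
  by near: k; apply: (cvgr_ge _ (cvg_sqrt beta0 lim_D)); rewrite ltrBlDr ltrDl.
have hC' : Num.sqrt (statdim (C k)) <= (alpha * gamma + e) * Num.sqrt (n k)%:R.
  rewrite -ler_pdivrMr// -sqrtrV// -sqrtrM ?statdim_ge0//.
  have -> : statdim (C k) * ((n k)%:R)^-1 =
      (statdim (C k) / (m k)%:R) * ((m k)%:R / (n k)%:R).
    by rewrite mulrA divfK// gt_eqF.
  rewrite sqrtrM ?divr_ge0 ?statdim_ge0//.
  by near: k; apply: (cvgr_le _ hC); rewrite ltrDl.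
have [S0 KS] := level_ratio gamma01 d0 eta0 s0 e0 e8 ed eL hm hs hD hC'.
move=> A /BR[h1 h2]; have := renegar_le h1 S0 (or_introl h2).
by move=> h; apply: (le_trans h); rewrite lee_fin.
Unshelve. all: by end_near. Qed.

(** The number u k is the larger of L and the conditional expectation, plus 1 / (k
    + 1). *)
Theorem renegar_expectation : exists (E : forall k, set 'M[R]_(n k, m k)) (u : nat -> R),
  [/\ forall k, measurable (E k),
      exp_small (fun k => gaussian (n k) (m k) (E k)) (fun k => (n k)%:R),
      forall k, (0 < gaussian (n k) (m k) (~` E k))%E,
      forall k, (cond_expectation (gaussian (n k) (m k))
                   (renegar (C k) (D k)) (~` E k) < (u k)%:E)%E &
      u @ \oo --> L].
Proof.
have /andP[gamma0 gamma1] := gamma01.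
have L0 : 0 < L by rewrite divr_gt0 ?subr_gt0// addr_gt0.
have [c c0 [k0 _ hk0]] := renegar_le_near ltr01.
have H k : exists (E : set 'M[R]_(n k, m k)) (K : R),
    [/\ measurable E, (0 < gaussian (n k) (m k) (~` E))%E, 0 <= K,
      forall A, ~ E A -> (renegar (C k) (D k) A <= K%:E)%E &
      (k0 <= k)%N -> K = L + 1 /\
        (gaussian (n k) (m k) E <= (expR (- (c * (n k)%:R)))%:E)%E].
  have [kk|kk] := leqP k0 k; last first.
    have [E [K [mE PE EK]]] :=
      bounded_renegar_set (C_cone k) (D_cone k) (C_nonzero k) (D_nonzero k).
    exists E, (Num.max 0 K); split => //; first by rewrite le_max lexx.
    by move=> A nE; apply: (le_trans (EK A nE)); rewrite lee_fin le_max lexx orbT.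
  have [B [mB PB BR]] := hk0 k kk.
  exists B, (L + 1); split => //.
  - rewrite probability_setC// sube_gt0; apply: (le_lt_trans PB).
    rewrite lte_fin expR_lt1 oppr_lt0 mulr_gt0// ltr0n.
    exact: nonzero_cone_dim_gt0 (D_nonzero k).
  - by rewrite addr_ge0// ltW.
pose E k := sval (cid (H k)); pose K k := sval (cid (svalP (cid (H k)))).
have HE k : [/\ measurable (E k), (0 < gaussian (n k) (m k) (~` E k))%E, 0 <= K k,
      forall A, ~ E k A -> (renegar (C k) (D k) A <= (K k)%:E)%E &
      (k0 <= k)%N -> K k = L + 1 /\
        (gaussian (n k) (m k) (E k) <= (expR (- (c * (n k)%:R)))%:E)%E].
  exact: (svalP (cid (svalP (cid (H k))))).
pose X k := renegar (C k) (D k).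
pose P k := gaussian (n k) (m k) : probability 'M[R]_(n k, m k) R.
pose ce k := cond_expectation (P k) (X k) (~` E k).
have mX k : measurable_fun setT (X k) by exact: measurable_renegar.
have X0 k A : (0 <= X k A)%E by exact: renegar_ge0.
have ce0 k : (0 <= ce k)%E by exact: cond_expectation_ge0.
have ceE k : ce k = (fine (ce k))%:E.
  rewrite fineK// ge0_fin_numE//.
  have [mE PE K0 EK _] := HE k.
  exact: (le_lt_trans (cond_expectation_le mE mE (mX k) (X0 k) K0 K0 EK EK PE) (ltry _)).
pose u k := Num.max L (fine (ce k)) + k.+1%:R^-1.
exists E, u; split.
- by move=> k; have [] := HE k.
- exists c => //; exists k0 => // k /= kk.
  by have [_ _ _ _ /(_ kk)[]] := HE k.
- by move=> k; have [] := HE k.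
- move=> k; rewrite -/(ce k) ceE lte_fin /u.
  by apply: ltr_pwDr; rewrite ?invr_gt0// le_max lexx orbT.
rewrite -[L]addr0; apply: cvgD; last exact: cvg_harmonic.
apply/cvgrPdist_le => eps eps0.
have eps2 : 0 < eps / 2 by rewrite divr_gt0.
have [c' c'0 hc'] := renegar_le_near eps2.
(* with P B <= eps / (4 (L + 1)) and P (~ E) >= 1 / 2, the event B adds at most
   eps / 2 *)
have a0 : 0 < eps / (4 * (L + 1)) by rewrite divr_gt0// mulr_gt0// addr_gt0.
near=> k.
have kk : (k0 <= k)%N by near: k; exact: nbhs_infty_ge.
have [mE PE K0 EK /(_ kk)[KE Esm]] := HE k.
have [B [mB PB BL]] : exists B : set 'M[R]_(n k, m k),
    [/\ measurable B, (gaussian (n k) (m k) B <= (expR (- (c' * (n k)%:R)))%:E)%E &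
      forall A, (~` B) A -> (renegar (C k) (D k) A <= (L + eps / 2)%:E)%E].
  by near: k.
have Leps : 0 <= L + eps / 2 by rewrite addr_ge0// ltW.
have := cond_expectation_le mE mB (mX k) (X0 k) K0 Leps EK BL PE.
rewrite -/(ce k) ceE lee_fin => ceL.
have PE2 : 1 / 2 <= fine (P k (~` E k)).
  rewrite -lee_fin fineK ?fin_num_measure//; last exact: measurableC.
  rewrite probability_setC// (_ : (1 / 2)%:E = (1 - (1 / 2)%:E)%E :> \bar R); last first.
    by rewrite -EFinB; congr EFin; field.
  apply: leeB => //; apply: (le_trans Esm); rewrite lee_fin.
  by near: k; apply: expRN_dim_near => //; rewrite divr_gt0.
have PBs : fine (P k B) <= eps / (4 * (L + 1)).
  rewrite -lee_fin fineK ?fin_num_measure//; apply: (le_trans PB).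
  by rewrite lee_fin; near: k; exact: expRN_dim_near.
have tail : K k * fine (P k B) / fine (P k (~` E k)) <= eps / 2.
  rewrite KE ler_pdivrMr; last by apply: lt_le_trans PE2; rewrite divr_gt0.
  apply: (@le_trans _ _ (eps / 2 * (1 / 2))); last by apply: ler_wpM2l => //; exact: ltW.
  rewrite (_ : eps / 2 * _ = (L + 1) * (eps / (4 * (L + 1)))); last first.
    by field; rewrite gt_eqF// addr_gt0.
  by apply: ler_wpM2l => //; rewrite addr_ge0// ltW.
rewrite distrC ger0_norm ?subr_ge0 ?le_max ?lexx//.
rewrite lerBlDr ge_max lerDr (ltW eps0)/= addrC.
apply: (le_trans ceL); rewrite [eps in leRHS]splitr addrA.
exact: lerD.
Unshelve. all: by end_near. Qed.

End families.

Theorem theorem1p5 (R : realType) (m n : nat -> nat)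
    (C : forall k, set 'cV[R]_(m k)) (D : forall k, set 'cV[R]_(n k))
    (alpha beta gamma : R)
    (C_cone : forall k, closed_convex_cone (C k))
    (C_nonzero : forall k, nonzero_cone (C k))
    (D_cone : forall k, closed_convex_cone (D k))
    (D_nonzero : forall k, nonzero_cone (D k))
    (lim_C : (fun k => statdim (C k) / (m k)%:R) @ \oo --> alpha ^+ 2)
    (lim_D : (fun k => statdim (D k) / (n k)%:R) @ \oo --> beta ^+ 2)
    (lim_mn : (fun k => (m k)%:R / (n k)%:R : R) @ \oo --> gamma ^+ 2)
    (alpha01 : 0 < alpha <= 1) (beta01 : 0 < beta <= 1)
    (gamma01 : 0 < gamma <= 1) (beta_gt : alpha * gamma < beta)
    (lim_n : n @ \oo --> \oo) :
  (exists (E : forall k, set 'M[R]_(n k, m k)) (u : nat -> R),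
    [/\ forall k, measurable (E k),
        exp_small (fun k => gaussian (n k) (m k) (E k)) (fun k => (n k)%:R),
        forall k, (0 < gaussian (n k) (m k) (~` E k))%E,
        forall k, (cond_expectation (gaussian (n k) (m k))
                     (renegar (C k) (D k)) (~` E k) < (u k)%:E)%E &
        u @ \oo --> (1 + gamma) / (beta - alpha * gamma)])
  /\
  ((exists2 c : R, 0 < c & \forall k \near \oo, c * k%:R <= (n k)%:R) ->
    weak_expectation_O (fun k => gaussian (n k) (m k))
      (fun k => renegar (C k) (D k)) (fun _ => 1)).
Proof.
have /andP[alpha0 _] := alpha01; have /andP[beta0 _] := beta01.
have main := renegar_expectation C_cone C_nonzero D_cone D_nonzero
  lim_C lim_D lim_mn alpha0 beta0 gamma01 beta_gt lim_n.
split=> // -[c c0 hc].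
have [E [u [mE [c' c'0 Esm] PE ceu uL]]] := main.
split; first by move=> k; exact: measurable_renegar.
exists E; split => //.
  exists (c' * c); first exact: mulr_gt0.
  near=> k; apply: (@le_trans _ _ (expR (- (c' * (n k)%:R)))%:E); first by near: k.
  by rewrite lee_fin ler_expR lerN2 -mulrA ler_pM2l//; near: k.
exists ((1 + gamma) / (beta - alpha * gamma) + 1); near=> k.
apply: (le_trans (ltW (ceu k))); rewrite lee_fin mulr1.
by near: k; apply: (cvgr_le _ uL); rewrite ltrDl.
Unshelve. all: by end_near. Qed.
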